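(* Let $\mathcal{T}_2$ be the universal unital C$^*$-algebra generated by two isometries $s_1, s_2$ satisfying $s_1s_1^*+s_2s_2^*\le 1$. Let $\jmath_0,\jmath_1:\mathcal{T}_2\to\mathcal{T}_2\ast_{\mathbb{C}}\mathcal{T}_2$ be the two canonical unital embeddings of $\mathcal{T}_2$ in the full unital free product $\mathcal{T}_2\ast_{\mathbb{C}}\mathcal{T}_2$, and let $\tilde u$ be a $K_1$-trivial unitary of $\mathcal{T}_2\ast_{\mathbb{C}}\mathcal{T}_2$ such that $\jmath_1(s_1)=\jmath_1(s_1)\jmath_0(s_1)^*\jmath_0(s_1)=\tilde u\cdot\jmath_0(s_1)$ (such a unitary exists). The following assertions are equivalent: (a) The full unital free product $\mathcal{T}_2\ast_{\mathbb{C}}\mathcal{T}_2$ is $K_1$-injective. (b) The unitary $\tilde u$ belongs to the connected component $\mathcal{U}^0(\mathcal{T}_2\ast_{\mathbb{C}}\mathcal{T}_2)$ of the unit in the unitary group of $\mathcal{T}_2\ast_{\mathbb{C}}\mathcal{T}_2$. (c) For every second countable compact Hausdorff space $X$, every separable unital continuous $C(X)$-algebra $A$ with properly infinite fibres is a properly infinite C$^*$-algebra.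
   Context: A unital C$^*$-algebra $B$ is properly infinite if it contains two isometries with mutually orthogonal range projections (equivalently, there is a unital embedding $\mathcal{T}_2\hookrightarrow B$). A unitary $v$ in a unital C$^*$-algebra $B$ is $K_1$-trivial if its class in $K_1(B)$ is zero. $B$ is $K_1$-injective if every $K_1$-trivial unitary $v\in\mathcal{U}(B)$ is homotopic to $1_B$ in $\mathcal{U}(B)$ (norm topology). For a compact Hausdorff space $X$, a unital $C(X)$-algebra is a unital C$^*$-algebra $A$ with a unital $*$-homomorphism from $C(X)$ to the centre of $A$. The fibre of $A$ at $x\in X$ is $A_x:=A/(C_0(X\setminus\{x\})\cdot A)$, and $a_x$ is the image of $a\in A$ in $A_x$. $A$ is continuous if $x\mapsto\|a_x\|$ is continuous on $X$ for every $a\in A$. *)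

(* Defs.v *)
From HB Require Import structures.
From mathcomp Require Import all_boot all_order all_algebra.
From mathcomp Require Import complex.
From mathcomp Require Import all_classical all_reals all_analysis.

Set Implicit Arguments.
Unset Strict Implicit.
Unset Printing Implicit Defensive.

Import Order.TTheory GRing.Theory Num.Theory numFieldNormedType.Exports.

Local Open Scope classical_set_scope.
Local Open Scope ring_scope.

(* Unital nonzero C*-algebras over the complex numbers R[i].  The norm takes its
   values in R[i], as the norm of any normedModType R[i] does.  The ring
   operations are fields, from which the algType structure is derived below,
   because the hierarchy builder rejects a structure inheriting from both
   CompleteNormedModule and GRing.Algebra: it would be a second join, next to
   NumDomain, of PzSemiRing and SemiNormedZmodule. *)
HB.mixin Record isCStarAlgebra (R : realType) A
    & CompleteNormedModule R[i] A := {
  cstar_one : A;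
  cstar_mul : A -> A -> A;
  star : A -> A;
  cstar_mulA : associative cstar_mul;
  cstar_mul1x : left_id cstar_one cstar_mul;
  cstar_mulx1 : right_id cstar_one cstar_mul;
  cstar_mulDl : left_distributive cstar_mul +%R;
  cstar_mulDr : right_distributive cstar_mul +%R;
  cstar_one_neq0 : cstar_one != 0;
  cstar_scaleAl : forall (c : R[i]) a b,
    c *: cstar_mul a b = cstar_mul (c *: a) b;
  cstar_scaleAr : forall (c : R[i]) a b,
    c *: cstar_mul a b = cstar_mul a (c *: b);
  starK : involutive star;
  starD : {morph star : a b / a + b};
  starZ : forall (c : R[i]) a, star (c *: a) = c^* *: star a;
  cstar_starM : forall a b, star (cstar_mul a b) = cstar_mul (star b) (star a);
  cstar_norm_mul : forall a b, `|cstar_mul a b| <= `|a| * `|b|;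
  cstar_norm_star : forall a, `|cstar_mul (star a) a| = `|a| ^+ 2
}.

#[short(type="cstarAlgType")]
HB.structure Definition CStarAlgebra (R : realType) :=
  { A of isCStarAlgebra R A & CompleteNormedModule R[i] A }.

Section AlgebraStructure.
Variables (R : realType) (A : cstarAlgType R).

#[non_forgetful_inheritance]
HB.instance Definition _ := GRing.Zmodule_isNzRing.Build A
  cstar_mulA cstar_mul1x cstar_mulx1 cstar_mulDl cstar_mulDr cstar_one_neq0.

#[non_forgetful_inheritance]
HB.instance Definition _ := GRing.Lmodule_isLalgebra.Build R[i] A cstar_scaleAl.

#[non_forgetful_inheritance]
HB.instance Definition _ := GRing.Lalgebra_isAlgebra.Build R[i] A cstar_scaleAr.

Implicit Types a b : A.

Lemma starM a b : star (a * b) = star b * star a.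
Proof. exact: cstar_starM. Qed.

Lemma cstar_normrM a b : `|a * b| <= `|a| * `|b|.
Proof. exact: cstar_norm_mul. Qed.

Lemma normr_starM a : `|star a * a| = `|a| ^+ 2.
Proof. exact: cstar_norm_star. Qed.

End AlgebraStructure.

Section Elements.
Variables (R : realType) (A : cstarAlgType R).
Implicit Types a b s u : A.

Definition cstar_positive a := exists b, a = star b * b.
Definition cstar_le a b := cstar_positive (b - a).

Definition isometry s := star s * s = 1.

Definition unitary : set A := [set u | star u * u = 1 /\ u * star u = 1].

Definition properly_infinite := exists s t,
  [/\ isometry s, isometry t & (s * star s) * (t * star t) = 0].

Definition separable := exists2 D : set A, countable D & dense D.

Definition linear_span (S : set A) : set A :=
  [set a | exists n (c : 'I_n -> R[i]) (v : 'I_n -> A),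
     (forall i, S (v i)) /\ a = \sum_(i < n) c i *: v i].

Definition cstar_subalgebra (S : set A) := [/\ closed S, S 1,
  forall (c : R[i]) a b, S a -> S b -> S (c *: a + b),
  forall a b, S a -> S b -> S (a * b) &
  forall a, S a -> S (star a)].

Definition generates (G : set A) := forall S : set A,
  cstar_subalgebra S -> G `<=` S -> S = [set: A].

End Elements.

Definition star_hom (R : realType) (A B : cstarAlgType R)
  (f : {lrmorphism A -> B}) := forall a, f (star a) = star (f a).

Definition homotopic_in (R : realType) (T : topologicalType) (S : set T)
    (x y : T) := exists gamma : R -> T,
  [/\ {within `[0, 1], continuous gamma},
      forall t, t \in `[0, 1] -> S (gamma t), gamma 0 = x & gamma 1 = y].

Section K1.
Variables (R : realType) (A : cstarAlgType R).

(* The library topology on 'M[A]_n is that of entrywise convergence; it is the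
   topology of the C*-norm of M_n(A), because
   max_ij |a_ij| <= |a| <= \sum_ij |a_ij|. *)
Definition mxstar n (u : 'M[A]_n) : 'M[A]_n := (map_mx star u)^T.

Definition unitary_mx n : set 'M[A]_n :=
  [set u | mxstar u *m u = 1%:M /\ u *m mxstar u = 1%:M].

(* Equality of the classes of u, v in U_n(A) in the group
   K_1(A) = U_oo(A) / ~_1, where u ~_1 v iff u (+) 1_k and v (+) 1_k are
   homotopic in U_(n + k)(A) for some k. *)
Definition K1_eq n (u v : 'M[A]_n) := exists k,
  homotopic_in R (@unitary_mx (n + k))
    (block_mx u 0 0 1%:M) (block_mx v 0 0 1%:M).

Definition K1_trivial (v : A) := K1_eq (v%:M : 'M[A]_1) 1%:M.

Definition K1_injective := forall v : A,
  unitary v -> K1_trivial v -> homotopic_in R (@unitary R A) v 1.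

End K1.

Section UniversalAlgebras.
Variable R : realType.

Definition T2_relations (B : cstarAlgType R) (t1 t2 : B) :=
  [/\ isometry t1, isometry t2 & cstar_le (t1 * star t1 + t2 * star t2) 1].

Definition is_T2 (T : cstarAlgType R) (s1 s2 : T) :=
  [/\ T2_relations s1 s2, generates [set s1; s2] &
      forall (B : cstarAlgType R) (t1 t2 : B), T2_relations t1 t2 ->
        exists f : {lrmorphism T -> B},
          [/\ star_hom f, f s1 = t1 & f s2 = t2]].

Definition is_full_free_product (A0 A1 F : cstarAlgType R)
    (j0 : {lrmorphism A0 -> F}) (j1 : {lrmorphism A1 -> F}) :=
  [/\ star_hom j0, star_hom j1 &
      forall (B : cstarAlgType R)
        (f0 : {lrmorphism A0 -> B}) (f1 : {lrmorphism A1 -> B}),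
      star_hom f0 -> star_hom f1 ->
      let extends (f : {lrmorphism F -> B}) :=
        [/\ star_hom f, f \o j0 =1 f0 & f \o j1 =1 f1] in
      exists f, extends f /\ forall g, extends g -> g =1 f].

End UniversalAlgebras.

Section CXAlgebras.
Variables (R : realType) (X : topologicalType) (A : cstarAlgType R).
Local Notation CX := (continuousType X R[i]^o).

(* theta is a unital *-homomorphism from C(X), with its pointwise operations,
   to the centre of A. *)
Definition CX_algebra (theta : CX -> A) :=
  [/\ forall (c : R[i]) (f g h : CX), (forall x, h x = c * f x + g x) ->
        theta h = c *: theta f + theta g,
      forall f g h : CX, (forall x, h x = f x * g x) ->
        theta h = theta f * theta g,
      forall e : CX, (forall x, e x = 1) -> theta e = 1,
      forall f h : CX, (forall x, h x = (f x)^*) -> theta h = star (theta f) &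
      forall (f : CX) (a : A), theta f * a = a * theta f].

(* C_0(X \ {x}) . A, as a closed ideal. *)
Definition fibre_ideal (theta : CX -> A) (x : X) : set A :=
  closure (linear_span [set b | exists (f : CX) (a : A),
                                  f x = 0 /\ b = theta f * a]).

(* p exhibits B as the quotient A / (C_0(X \ {x}) . A); the C*-algebra B is
   determined up to *-isomorphism, which is automatically isometric. *)
Definition is_fibre (theta : CX -> A) (x : X) (B : cstarAlgType R)
    (p : {lrmorphism A -> B}) :=
  [/\ star_hom p, forall b, exists a, p a = b &
      forall a, p a = 0 <-> fibre_ideal theta x a].

End CXAlgebras.

(* Every separable unital continuous C(X)-algebra with properly infinite fibres
   is properly infinite; p x : A -> Ax x are the fibres, a |-> a_x. *)
Definition properly_infinite_fibres_property (R : realType) :=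
  forall X : topologicalType,
    compact [set: X] -> hausdorff_space X -> @second_countable X ->
  forall (A : cstarAlgType R) (theta : continuousType X R[i]^o -> A)
    (Ax : X -> cstarAlgType R) (p : forall x, {lrmorphism A -> Ax x}),
    CX_algebra theta -> separable A -> (forall x, is_fibre theta x (p x)) ->
    (forall a, continuous (fun x => `|p x a| : R[i]^o)) ->
    (forall x, properly_infinite (Ax x)) ->
  properly_infinite A.

(* Main.v *)
(* (b) -> (c): a unitary in the component of 1 is a finite product of Cayley
   transforms of self-adjoint elements, so its image in a quotient lifts to a
   unitary.  Every point of X has a closed neighbourhood carrying a pair of elements
   of A that are almost isometries with almost orthogonal ranges there, and such a
   pair can be improved at will.  Two pairs over closed sets V and W define a
   *-homomorphism from T_2 * T_2 to the restriction of A to V n W, which sends u to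
   a unitary carrying the first isometry of one pair to that of the other.
   Multiplying the first pair by a lift of this unitary, one can take a common first
   isometry s; if k^2 + l^2 = 1 are Urysohn functions and x, y are the second
   isometries, then s^2 and k x + l s y is a pair over V u W.  Compactness of X
   finishes.

   (c) -> (a): for a K_1-trivial unitary v, let D be the sections f of the mapping
   torus of Ad v, i.e. f(0) = v f(1) v^*.  Folding the circle makes D a continuous
   C([0, 1])-algebra with fibres F or F x F, so D contains isometries S, T with
   S^* T = 0.  Rotating T_t v into S_t and S_t into T_t gives a path of isometries
   R_t with R_0 = v R_1.  Since F is properly infinite, the homotopy which trivialises
   diag(v, 1, ..., 1) fits into a corner of F; combined with R_t it connects v to 1.

   A unitary u with t1 = u s1 is u0 (1 - s2 s2^* + s2 u0^* s2^* ), where u0 s1 = t1 and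
   the second factor cancels the K_1-class of u0. *)

Require Import Defs.
From HB Require Import structures.
From mathcomp Require Import all_boot all_order all_algebra.
From mathcomp Require Import complex.
From mathcomp Require Import all_classical all_reals all_analysis.
From mathcomp Require Import ring lra.

Set Implicit Arguments.
Unset Strict Implicit.
Unset Printing Implicit Defensive.

Import Order.TTheory GRing.Theory Num.Theory numFieldNormedType.Exports.

Local Open Scope classical_set_scope.
Local Open Scope ring_scope.

(** The restriction of [A] to a closed set is represented by the closure of the image of [A] in the
    bounded families of fibres. Lifts to [A] are therefore only approximate, and the gluing runs on
    pairs that satisfy the isometry relations up to 1/20, below which polar decomposition and
    Gram-Schmidt produce genuine isometries. Over V n W the second isometries x and y are unrelated,
    so k x + l y need not be an isometry; s y has its range inside that of s, hence orthogonal to x.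
    The price is that s becomes s^2, whose range is orthogonal to that of s y because s^* y = 0.
    Spectral theory is replaced by three devices: an iteration for square roots of elements near 1,
    the dilation of a self-adjoint contraction to a unitary, and the bound |r - a| <= r in place of
    positivity of a. In (c) -> (a) the free product enters only as a separable properly infinite
    algebra; its universal property serves there for separability. Folding the circle allows [0, 1]
    as base, at the price of fibres over two points. *)

Local Notation isometry := Defs.isometry.

(* Reflexive normalisation in noncommutative rings, modulo relations of the form
   x * y = 1 and x * y = 0 between atoms. *)
Module NC.

Inductive expr :=
  | Var of nat | One | Zero | Add of expr & expr | Opp of expr | Mul of expr & expr.

Definition word := seq nat.
Definition poly := seq (word * int).
Definition rels := seq (nat * nat * bool).

Fixpoint find_rel (rs : rels) i j :=
  if rs is r :: rs' then
    if (i == r.1.1) && (j == r.1.2) then Some r.2 else find_rel rs' i j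
  else None.

(** [None] codes a product equal to 0. Letters are prepended one at a time from the right, so a
    letter exposed by a cancellation is still compared with the next one pushed. *)
Definition push (rs : rels) i (w : word) : option word :=
  if w is j :: w' then
    if find_rel rs i j is Some b then (if b then Some w' else None)
    else Some (i :: w)
  else Some [:: i].

Definition cat_word rs (w1 w2 : word) : option word :=
  foldr (fun i o => if o is Some w then push rs i w else None) (Some w2) w1.

Fixpoint insert (w : word) (c : int) (p : poly) : poly :=
  if p is t :: p' then
    if w == t.1 then (w, c + t.2) :: p' else t :: insert w c p'
  else [:: (w, c)].

Definition add (p q : poly) := foldr (fun t r => insert t.1 t.2 r) q p.
Definition opp (p : poly) : poly := [seq (t.1, - t.2) | t <- p].
Definition mul1 rs (t : word * int) (p : poly) : poly :=
  foldr (fun u r => if cat_word rs t.1 u.1 is Some w then insert w (t.2 * u.2) r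
                    else r) [::] p.
Definition mul rs (p q : poly) := foldr (fun t r => add (mul1 rs t q) r) [::] p.

Fixpoint norm rs e : poly :=
  match e with
  | Var i => [:: ([:: i], 1)]
  | One => [:: ([::], 1)]
  | Zero => [::]
  | Add a b => add (norm rs a) (norm rs b)
  | Opp a => opp (norm rs a)
  | Mul a b => mul rs (norm rs a) (norm rs b)
  end.

Definition check rs e1 e2 :=
  all (fun t : word * int => t.2 == 0) (norm rs (Add e1 (Opp e2))).

Section Correct.
Variables (S : pzRingType) (env : seq S).

Fixpoint eval e : S :=
  match e with
  | Var i => nth 0 env i
  | One => 1
  | Zero => 0
  | Add a b => eval a + eval b
  | Opp a => - eval a
  | Mul a b => eval a * eval b
  end.

Fixpoint rels_ok (rs : rels) : Prop :=
  if rs is r :: rs' then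
    nth 0 env r.1.1 * nth 0 env r.1.2 = (if r.2 then 1 else 0) /\ rels_ok rs'
  else True.

Variables (rs : rels) (ok : rels_ok rs).

Definition eval_word (w : word) : S := foldr (fun i x => nth 0 env i * x) 1 w.
Definition eval_poly (p : poly) : S :=
  foldr (fun t x => eval_word t.1 *~ t.2 + x) 0 p.

Lemma find_relP i j b : find_rel rs i j = Some b ->
  nth 0 env i * nth 0 env j = (if b then 1 else 0).
Proof.
elim: rs ok => //= r rs' IH [h /IH {}IH].
by case: ifP => [/andP[/eqP-> /eqP->] [<-]|_ /IH].
Qed.

Definition eval_opt (o : option word) : S := if o is Some w then eval_word w else 0.

Lemma push_correct i w : eval_opt (push rs i w) = nth 0 env i * eval_word w.
Proof.
case: w => [|j w] //=; case E: find_rel => [b|] //=.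
by rewrite mulrA (find_relP E); case: b E => _; rewrite /= ?mul1r ?mul0r.
Qed.

Lemma cat_word_correct w1 w2 :
  eval_opt (cat_word rs w1 w2) = eval_word w1 * eval_word w2.
Proof.
elim: w1 => [|i w1 IH] /=; first by rewrite mul1r.
by rewrite -mulrA -IH; case: cat_word => [w|] /=; rewrite ?mulr0// push_correct.
Qed.

Lemma insert_correct w c p : eval_poly (insert w c p) = eval_word w *~ c + eval_poly p.
Proof.
elim: p => [|t p IH] //=; case: eqP => [->|_] /=; first by rewrite mulrzDr addrA.
by rewrite IH addrCA.
Qed.

Lemma add_correct p q : eval_poly (add p q) = eval_poly p + eval_poly q.
Proof.
by elim: p => [|t p IH] /=; rewrite ?add0r// insert_correct IH addrA.
Qed.

Lemma opp_correct p : eval_poly (opp p) = - eval_poly p.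
Proof.
by elim: p => [|t p IH] /=; rewrite ?oppr0// IH mulrNz opprD.
Qed.

Lemma mul1_correct t p : eval_poly (mul1 rs t p) = eval_word t.1 *~ t.2 * eval_poly p.
Proof.
elim: p => [|u p IH] /=; first by rewrite mulr0.
rewrite mulrDr -{}IH mulrzAl mulrzAr -mulrzA [u.2 * t.2]mulrC -cat_word_correct.
by case: cat_word => [w|] /=; rewrite ?insert_correct// mul0rz add0r.
Qed.

Lemma mul_correct p q : eval_poly (mul rs p q) = eval_poly p * eval_poly q.
Proof.
elim: p => [|t p IH] /=; first by rewrite mul0r.
by rewrite add_correct mul1_correct IH mulrDl.
Qed.

Lemma norm_correct e : eval_poly (norm rs e) = eval e.
Proof.
elim: e => [i|||a IHa b IHb|a IHa|a IHa b IHb] /=; rewrite ?addr0 ?mulr1//.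
- by rewrite add_correct IHa IHb.
- by rewrite opp_correct IHa.
- by rewrite mul_correct IHa IHb.
Qed.

Lemma check_correct e1 e2 : check rs e1 e2 -> eval e1 = eval e2.
Proof.
move=> h; apply/eqP; rewrite -subr_eq0; apply/eqP.
have -> : eval e1 - eval e2 = eval (Add e1 (Opp e2)) by [].
rewrite -norm_correct; move: h; rewrite /check; elim: norm => //= t p IH.
by move=> /andP[/eqP-> /IH->]; rewrite addr0.
Qed.

End Correct.

(** The inner [match goal] runs a tactic inside a term-producing Ltac; its failure makes the outer
    [match] try the next branch. *)
Ltac index_of x l :=
  match l with
  | ?y :: _ => let _ := match goal with _ => first [constr_eq x y | unify x y] end in
               constr:(0%N)
  | _ :: ?l' => let n := index_of x l' in constr:(n.+1)
  end.

Ltac add_atom x l :=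
  match l with
  | _ => let n := index_of x l in l
  | nil => constr:(x :: nil)
  | ?y :: ?l' => let r := add_atom x l' in constr:(y :: r)
  end.

Ltac atoms e l :=
  match e with
  | (?a + ?b)%R => let l1 := atoms a l in atoms b l1
  | (- ?a)%R => atoms a l
  | (?a * ?b)%R => let l1 := atoms a l in atoms b l1
  | 1%R => l
  | 0%R => l
  | _ => add_atom e l
  end.

Ltac reify e l :=
  match e with
  | (?a + ?b)%R => let x := reify a l in let y := reify b l in constr:(Add x y)
  | (- ?a)%R => let x := reify a l in constr:(Opp x)
  | (?a * ?b)%R => let x := reify a l in let y := reify b l in constr:(Mul x y)
  | 1%R => constr:(One)
  | 0%R => constr:(Zero)
  | _ => let n := index_of e l in constr:(Var n)
  end.

Ltac rel_atoms hs l :=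
  match hs with
  | tt => l
  | (?hs', ?h) =>
    let l1 := rel_atoms hs' l in
    let T := type of h in let T' := eval hnf in T in
    match T' with (?a * ?b)%R = _ => let l2 := add_atom a l1 in add_atom b l2 end
  end.

Ltac rel_list hs l :=
  match hs with
  | tt => constr:(@nil (nat * nat * bool))
  | (?hs', ?h) =>
    let r := rel_list hs' l in
    let T := type of h in let T' := eval hnf in T in
    match T' with
    | (?a * ?b)%R = ?c =>
      let i := index_of a l in let j := index_of b l in
      match c with
      | 1%R => constr:((i, j, true) :: r)
      | 0%R => constr:((i, j, false) :: r)
      end
    end
  end.

Ltac rel_proof hs :=
  match hs with
  | tt => exact I
  | (?hs', ?h) => split; [exact h | rel_proof hs']
  end.

Ltac solve hs :=
  match goal with
  | |- @eq ?T ?e1 ?e2 =>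
    let l1 := rel_atoms hs (@nil T) in
    let l2 := atoms e1 l1 in
    let l := atoms e2 l2 in
    let r := rel_list hs l in
    let x1 := reify e1 l in
    let x2 := reify e2 l in
    refine (@check_correct _ l r _ x1 x2 _);
      [cbn [rels_ok nth fst snd]; rel_proof hs | vm_compute; exact isT]
  end.

End NC.

Tactic Notation "nc" := NC.solve tt.
Tactic Notation "nc" constr(h1) := NC.solve (tt, h1).
Tactic Notation "nc" constr(h1) constr(h2) := NC.solve (tt, h1, h2).
Tactic Notation "nc" constr(h1) constr(h2) constr(h3) := NC.solve (tt, h1, h2, h3).
Tactic Notation "nc" constr(h1) constr(h2) constr(h3) constr(h4) :=
  NC.solve (tt, h1, h2, h3, h4).
Tactic Notation "nc" constr(h1) constr(h2) constr(h3) constr(h4) constr(h5)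
  constr(h6) constr(h7) constr(h8) :=
  NC.solve (tt, h1, h2, h3, h4, h5, h6, h7, h8).

(** * Real-valued norms *)

Section RealNorm.
Variable R : realType.

(** The norm of a space over [R[i]] is itself a complex number; the real part brings estimates
    within reach of [lra] and [nra]. *)
Definition nrm (V : normedZmodType R[i]) (a : V) : R := complex.Re `|a|.

Lemma nrmE (V : normedZmodType R[i]) (a : V) : `|a| = (nrm a)%:C%C.
Proof. by rewrite /nrm RRe_real// normr_real. Qed.

Lemma nrm_lt (V : normedZmodType R[i]) (a : V) (e : R) : (`|a| < e%:C%C) = (nrm a < e).
Proof. by rewrite nrmE ltcR. Qed.

Section Zmod.
Variable V : normedZmodType R[i].
Implicit Types a b : V.

Lemma nrm_ge0 a : 0 <= nrm a.
Proof. by rewrite -ler0c -nrmE. Qed.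

Lemma nrm0 : nrm (0 : V) = 0.
Proof. by rewrite /nrm normr0. Qed.

Lemma nrm_eq0 a : (nrm a == 0) = (a == 0).
Proof. by rewrite -(normr_eq0 a) nrmE eq_complex /= eqxx andbT. Qed.

Lemma nrm0_eq0 a : nrm a = 0 -> a = 0.
Proof. by move/eqP; rewrite nrm_eq0 => /eqP. Qed.

Lemma nrmN a : nrm (- a) = nrm a.
Proof. by rewrite /nrm normrN. Qed.

Lemma nrmBC a b : nrm (a - b) = nrm (b - a).
Proof. by rewrite -nrmN opprB. Qed.

Lemma nrmD a b : nrm (a + b) <= nrm a + nrm b.
Proof. by have := ler_normD a b; rewrite !nrmE -rmorphD lecR. Qed.

Lemma nrmB a b : nrm (a - b) <= nrm a + nrm b.
Proof. by rewrite -(nrmN b) nrmD. Qed.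

Lemma nrm_dist a b c : nrm (a - c) <= nrm (a - b) + nrm (b - c).
Proof. by rewrite (_ : a - c = (a - b) + (b - c)) ?nrmD// addrA subrK. Qed.

Lemma nrm_le_dist a b : nrm a <= nrm (a - b) + nrm b.
Proof. by rewrite -[X in nrm X <= _](subrK b) nrmD. Qed.

Lemma nrm_dist_le a b : `|nrm a - nrm b| <= nrm (a - b).
Proof.
have h1 := nrm_le_dist a b; have h2 := nrm_le_dist b a.
by rewrite nrmBC in h2; rewrite ler_norml; lra.
Qed.

Lemma nrm_sum n (v : 'I_n -> V) : nrm (\sum_i v i) <= \sum_i nrm (v i).
Proof.
elim/big_ind2: _ => [|a x b y ax cy|//]; first by rewrite nrm0.
by apply: le_trans (nrmD _ _) _; exact: lerD.
Qed.

Lemma nrm_small_eq0 a : (forall e, 0 < e -> nrm a <= e) -> a = 0.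
Proof.
move=> h; apply: nrm0_eq0; apply/eqP; rewrite eq_le nrm_ge0 andbT.
by apply/ler_addgt0Pl => e e0; rewrite addr0 h.
Qed.

End Zmod.

Lemma nrm_real (r : R) : nrm (r%:C%C : R[i]) = `|r|.
Proof. by rewrite /nrm normc_def /= expr0n addr0 sqrtr_sqr. Qed.

Lemma nrm_conjc (z : R[i]) : nrm (z^*) = nrm z.
Proof. by rewrite /nrm norm_conjC. Qed.

Lemma nrm_sqr (z : R[i]) : nrm z ^+ 2 = complex.Re z ^+ 2 + complex.Im z ^+ 2.
Proof. by apply: complexI; rewrite add_Re2_Im2 rmorphXn /= -nrmE. Qed.

Lemma nrm_i : nrm ('i : R[i]) = 1.
Proof. by rewrite /nrm normCi. Qed.

Section Mod.
Variable V : normedModType R[i].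
Implicit Types a b : V.

Lemma nrmZ (c : R[i]) a : nrm (c *: a) = nrm c * nrm a.
Proof. by apply: complexI; rewrite rmorphM /= -!nrmE normrZ. Qed.

Lemma nrmZr (r : R) a : nrm (r%:C%C *: a) = `|r| * nrm a.
Proof. by rewrite nrmZ nrm_real. Qed.

Lemma nbhs_nrmP a (P : set V) :
  nbhs a P <-> exists2 e : R, 0 < e & forall b, nrm (b - a) < e -> P b.
Proof.
split.
  move/nbhs_normP => -[e /= e0 h]; exists (complex.Re e).
    by move: e0; rewrite ltcE => /andP[].
  move=> b bae; apply: h => /=.
  rewrite -[e]RRe_real ?gtr0_real// nrm_lt.
  by rewrite nrmBC.
move=> [e e0 h]; apply/nbhs_normP; exists (e%:C%C) => /=.
  by rewrite (ltcR 0).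
by move=> b /=; rewrite nrm_lt nrmBC => /h.
Qed.

Lemma closed_nrm (S : set V) a : closed S ->
  (forall e : R, 0 < e -> exists2 b, S b & nrm (b - a) < e) -> S a.
Proof.
move=> clS h; rewrite ((closure_id S).1 clS) => B /nbhs_nrmP[e e0 hB].
by have [b Sb /hB Bb] := h _ e0; exists b.
Qed.

Lemma closure_nrmP (S : set V) a : closure S a <->
  forall e : R, 0 < e -> exists2 b, S b & nrm (b - a) < e.
Proof.
split=> [h e e0|h B /nbhs_nrmP[e e0 hB]].
  have [|b [Sb bB]] := h [set b | nrm (b - a) < e]; last by exists b.
  by apply/nbhs_nrmP; exists e.
by have [b Sb /hB Bb] := h _ e0; exists b.
Qed.

Lemma openP_nrm (S : set V) : (forall a, S a -> exists2 e : R, 0 < e &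
  forall b, nrm (b - a) < e -> S b) -> open S.
Proof. by move=> h; rewrite openE => a /h ?; apply/nbhs_nrmP. Qed.

End Mod.

Lemma continuous_nrmP (T : topologicalType) (V : normedModType R[i]) (f : T -> V) x :
  {for x, continuous f} <->
  forall e : R, 0 < e -> \forall y \near x, nrm (f y - f x) < e.
Proof.
split=> [h e e0|h B /nbhs_nrmP[e e0 hB]].
  by apply: (h [set b | nrm (b - f x) < e]); apply/nbhs_nrmP; exists e.
by apply: filterS (h _ e0) => y /hB.
Qed.

Lemma nrm_continuous (V : normedModType R[i]) : continuous (@nrm V : V -> R).
Proof.
move=> a; apply/cvgrPdist_lt => e e0; apply/nbhs_nrmP; exists e => // b be.
by apply: le_lt_trans (nrm_dist_le _ _) _; rewrite nrmBC.
Qed.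

Definition cvgs (V : normedZmodType R[i]) (u : nat -> V) (l : V) :=
  forall e : R, 0 < e -> exists N, forall n, (N <= n)%N -> nrm (u n - l) < e.

Section Cvgs.
Variable V : normedModType R[i].
Implicit Types (u v : nat -> V) (l m : V).

Lemma cvgs_unique u l m : cvgs u l -> cvgs u m -> l = m.
Proof.
move=> ul um; apply/eqP; rewrite -subr_eq0; apply/eqP/nrm_small_eq0 => e e0.
have [N1 h1] := ul _ (divr_gt0 e0 (ltr0n R 2)).
have [N2 h2] := um _ (divr_gt0 e0 (ltr0n R 2)).
have {}h1 := h1 _ (leq_maxl N1 N2); have {}h2 := h2 _ (leq_maxr N1 N2).
have := nrm_dist l (u (maxn N1 N2)) m; rewrite (nrmBC l (u _)); lra.
Qed.

Lemma cvgs_cst l : cvgs (fun=> l) l.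
Proof. by move=> e e0; exists 0%N => n _; rewrite subrr nrm0. Qed.

Lemma cvgsD u v l m : cvgs u l -> cvgs v m -> cvgs (fun n => u n + v n) (l + m).
Proof.
move=> ul vm e e0.
have [N1 h1] := ul _ (divr_gt0 e0 (ltr0n R 2)).
have [N2 h2] := vm _ (divr_gt0 e0 (ltr0n R 2)).
exists (maxn N1 N2) => n; rewrite geq_max => /andP[/h1 {}h1 /h2 {}h2].
have := nrmD (u n - l) (v n - m); rewrite opprD addrACA; lra.
Qed.

Lemma cvgsS u l : cvgs u l -> cvgs (fun n => u n.+1) l.
Proof. by move=> ul e /ul[N h]; exists N => n Nn; apply: h; exact: leqW. Qed.

Lemma cvgs_le u l (r : R) : cvgs u l -> (forall n, nrm (u n) <= r) -> nrm l <= r.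
Proof.
move=> ul h; apply/ler_addgt0Pl => e e0; have [N /(_ N (leqnn N)) hN] := ul _ e0.
by have := nrm_le_dist l (u N); rewrite nrmBC; have := h N; lra.
Qed.

Lemma cvgsZ (c : R[i]) u l : cvgs u l -> cvgs (fun n => c *: u n) (c *: l).
Proof.
move=> ul e e0; have c1 : 0 < nrm c + 1 by rewrite ltr_wpDl ?nrm_ge0.
have [N h] := ul _ (divr_gt0 e0 c1); exists N => n /h {}h.
rewrite -scalerBr nrmZ; apply: le_lt_trans (_ : (nrm c + 1) * nrm (u n - l) < e).
  by rewrite ler_wpM2r ?nrm_ge0// lerDl.
by rewrite mulrC -ltr_pdivlMr.
Qed.

End Cvgs.

Lemma cvgs_geometric (V : completeNormedModType R[i]) (u : nat -> V) (C q : R) :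
  0 <= q < 1 -> (forall n, nrm (u n.+1 - u n) <= C * q ^+ n) ->
  exists l, cvgs u l.
Proof.
move=> /andP[q0 q1] h.
have C0 : 0 <= C by have := h 0%N; rewrite expr0 mulr1; apply: le_trans (nrm_ge0 _).
have q1' : 0 < 1 - q by rewrite subr_gt0.
have hd n k : nrm (u (n + k)%N - u n) <= C * q ^+ n / (1 - q).
  (* The exact partial sum of the geometric series is carried along, since the cruder bound is not
     inductive. *)
  have : nrm (u (n + k)%N - u n) <= C * q ^+ n / (1 - q) * (1 - q ^+ k).
    elim: k => [|k IH]; first by rewrite addn0 subrr nrm0 subrr mulr0.
    have := nrm_dist (u (n + k.+1)%N) (u (n + k)%N) (u n); move/le_trans; apply.
    rewrite addnS; apply: le_trans (lerD (h _) IH) _.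
    rewrite exprD [in leRHS]exprS; set x := q ^+ n; set y := q ^+ k.
    rewrite le_eqVlt; apply/orP; left; apply/eqP; field; lra.
  move/le_trans; apply; rewrite ler_piMr//.
    by rewrite mulr_ge0 ?invr_ge0 ?mulr_ge0 ?exprn_ge0 ?(ltW q1').
  by rewrite lerBlDr lerDl exprn_ge0.
have small (e : R) : 0 < e -> exists N, forall n, (N <= n)%N -> C * q ^+ n / (1 - q) < e.
  move=> e0.
  have /cvgrPdist_lt/(_ e e0) : (geometric (C / (1 - q)) q : nat -> R) @ \oo --> (0 : R).
    by apply: cvg_geometric; rewrite ger0_norm.
  move=> [N _ hN]; exists N => n /hN /=; rewrite sub0r normrN ger0_norm.
    by rewrite mulrAC.
  by rewrite mulr_ge0 ?exprn_ge0 ?divr_ge0 ?(ltW q1').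
have : cvgn u.
  apply/cauchy_cvgP; apply/cauchy_ballP => e e0.
  have er : e = (complex.Re e)%:C%C by rewrite RRe_real ?gtr0_real.
  have e0' : 0 < complex.Re e / 2 by rewrite divr_gt0// -(ltcR 0) -er.
  have [N hN] := small _ e0'; near_simpl.
  exists ([set n | (N <= n)%N], [set n | (N <= n)%N]) => /=.
    by split; exists N.
  move=> [n m] /= [Nn Nm]; rewrite -ball_normE /= er nrm_lt.
  have h1 := hd N (n - N)%N; have h2 := hd N (m - N)%N; have h3 := hN _ (leqnn N).
  rewrite !subnKC// in h1 h2.
  have := nrm_dist (u n) (u N) (u m); rewrite (nrmBC (u N) (u m)); lra.
move=> /cvg_ex[l ul]; exists l => e e0.
have := ul [set b | nrm (b - l) < e]; case; first by apply/nbhs_nrmP; exists e.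
by move=> N _ hN; exists N => n /hN.
Qed.

End RealNorm.

Notation "r *c: a" := (r%:C%C *: a) (at level 40).

(** * Functional calculus by hand: square roots, dilations, Cayley transforms *)

Section CStarBasics.
Variables (R : realType) (A : cstarAlgType R).
Implicit Types a b c x y z : A.

Lemma star0 : star (0 : A) = 0.
Proof. by have := starZ (0 : R[i]) (0 : A); rewrite !scale0r conjC0 scale0r. Qed.

Lemma starN a : star (- a) = - star a.
Proof. by rewrite -scaleN1r starZ rmorphN1 scaleN1r. Qed.

Lemma starB a b : star (a - b) = star a - star b.
Proof. by rewrite starD starN. Qed.

Lemma star1 : star (1 : A) = 1.
Proof. by rewrite -[LHS]mulr1 -[X in _ * X]starK -starM mulr1 starK. Qed.

Lemma starZr (r : R) a : star (r *c: a) = r *c: star a.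
Proof. by rewrite starZ; congr (_ *: _); rewrite conj_Creal// complex_real. Qed.

Lemma starX a n : star (a ^+ n) = star a ^+ n.
Proof. by elim: n => [|n IH]; rewrite ?star1// exprS starM IH exprSr. Qed.

Lemma star_sum I (r : seq I) (F : I -> A) :
  star (\sum_(i <- r) F i) = \sum_(i <- r) star (F i).
Proof. exact: (big_morph _ (@starD _ A) star0). Qed.

Lemma scalecA (r s : R) a : r *c: (s *c: a) = (r * s) *c: a.
Proof. by rewrite scalerA rmorphM. Qed.

Lemma scalecDl (r s : R) a : (r + s) *c: a = r *c: a + s *c: a.
Proof. by rewrite rmorphD scalerDl. Qed.

Lemma scalecBl (r s : R) a : (r - s) *c: a = r *c: a - s *c: a.
Proof. by rewrite rmorphB scalerBl. Qed.

Lemma scale1c a : 1 *c: a = a.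
Proof. by rewrite scale1r. Qed.

Lemma nrmM a b : nrm (a * b) <= nrm a * nrm b.
Proof. by have := cstar_normrM a b; rewrite !nrmE -rmorphM lecR. Qed.

Lemma nrm_starM a : nrm (star a * a) = nrm a ^+ 2.
Proof. by apply: complexI; rewrite rmorphXn /= -!nrmE normr_starM. Qed.

Lemma nrm_star a : nrm (star a) = nrm a.
Proof.
suff h b : nrm b <= nrm (star b) by apply/le_anti; rewrite h -{2}[a]starK h.
have [->|] := eqVneq b 0; first by rewrite star0.
rewrite -nrm_eq0 => b0; have bp : 0 < nrm b by rewrite lt_def b0 nrm_ge0.
by rewrite -(ler_pM2r bp) -expr2 -nrm_starM nrmM.
Qed.

Lemma nrm_Mstar a : nrm (a * star a) = nrm a ^+ 2.
Proof. by rewrite -{1}[a]starK nrm_starM nrm_star. Qed.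

Lemma nrm1 : nrm (1 : A) = 1.
Proof.
have n0 : nrm (1 : A) != 0 by rewrite nrm_eq0 oner_eq0.
have := nrm_starM (1 : A); rewrite star1 mulr1 expr2 => /esym h.
by apply: (mulfI n0); rewrite h mulr1.
Qed.

Lemma nrm_scale1 (r : R) : nrm (r *c: (1 : A)) = `|r|.
Proof. by rewrite nrmZr nrm1 mulr1. Qed.

Lemma nrmX a n : nrm (a ^+ n) <= nrm a ^+ n.
Proof.
elim: n => [|n IH]; first by rewrite nrm1.
by rewrite !exprS (le_trans (nrmM _ _))// ler_wpM2l ?nrm_ge0.
Qed.

(** Replaces the spectral radius formula: on taking large powers, a multiplicative constant in an
    estimate disappears, as in [sup_fibre_norm]. *)
Lemma nrm_sa_pow2 a n : star a = a -> nrm (a ^+ (2 ^ n)) = nrm a ^+ (2 ^ n).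
Proof.
move=> sa; elim: n => [|n IH]; first by rewrite expn0 !expr1.
by rewrite expnS mulnC exprM expr2 -{1}sa -starX nrm_starM IH -exprM mulnC.
Qed.

Lemma nrm_isometry a : isometry a -> nrm a = 1.
Proof.
move=> ia; have := nrm_starM a; rewrite ia nrm1 => /esym/eqP.
by rewrite sqrf_eq1 => /orP[/eqP//|/eqP h]; have := nrm_ge0 a; rewrite h ler0N1.
Qed.

Lemma nrm_unitary a : unitary a -> nrm a = 1.
Proof. by case=> /nrm_isometry. Qed.

Lemma cvgsM (u v : nat -> A) (l m : A) :
  cvgs u l -> cvgs v m -> cvgs (fun n => u n * v n) (l * m).
Proof.
move=> ul vm e e0; pose K := nrm l + nrm m + 1.
have K1 : 1 <= K by rewrite /K; have := nrm_ge0 l; have := nrm_ge0 m; lra.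
have K0 : 0 < K by lra.
have [N1 h1] := ul _ (divr_gt0 e0 (mulr_gt0 (ltr0n R 3) K0)).
have [N2 h2] := vm _ (divr_gt0 e0 (mulr_gt0 (ltr0n R 3) K0)).
have [N3 h3] := vm _ (ltr01 : 0 < (1 : R)).
exists (maxn N1 (maxn N2 N3)) => n; rewrite !geq_max => /and3P[/h1 {}h1 /h2 {}h2 /h3 {}h3].
rewrite (_ : u n * v n - l * m = (u n - l) * v n + l * (v n - m)); last first.
  by rewrite mulrBl mulrBr addrA subrK.
apply: le_lt_trans (nrmD _ _) _.
have hv : nrm (v n) <= K.
  by have := nrm_le_dist (v n) m; rewrite /K; have := nrm_ge0 l; lra.
have h4 : nrm ((u n - l) * v n) <= e / (3 * K) * K.
  by apply: le_trans (nrmM _ _) _; apply: ler_pM; rewrite ?nrm_ge0 ?(ltW h1).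
have h5 : nrm (l * (v n - m)) <= K * (e / (3 * K)).
  apply: le_trans (nrmM _ _) _; apply: ler_pM; rewrite ?nrm_ge0 ?(ltW h2)//.
  by rewrite /K; have := nrm_ge0 m; lra.
have e3 : e / (3 * K) * K = e / 3 by field; rewrite gt_eqF.
by rewrite mulrC e3 in h5; rewrite e3 in h4; lra.
Qed.

Lemma cvgs_star (u : nat -> A) (l : A) : cvgs u l -> cvgs (fun n => star (u n)) (star l).
Proof. by move=> ul e /ul[N h]; exists N => n /h; rewrite -starB nrm_star. Qed.

Lemma cvgs_intertwine (u v : nat -> A) y z c : cvgs u y -> cvgs v z ->
  (forall n, u n * c = c * v n) -> y * c = c * z.
Proof.
move=> uy vz h; apply: (@cvgs_unique _ _ (fun n => u n * c)).
  exact: cvgsM uy (cvgs_cst c).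
by under [X in cvgs X _]funext => n do rewrite h; exact: cvgsM (cvgs_cst c) vz.
Qed.

Definition inverse_of a z := a * z = 1 /\ z * a = 1.

Lemma inverse_unique a z w : inverse_of a z -> inverse_of a w -> z = w.
Proof. by move=> [az za] [aw wa]; rewrite -[z]mulr1 -aw mulrA za mul1r. Qed.

Lemma inverse_star a z : inverse_of a z -> inverse_of (star a) (star z).
Proof. by move=> [az za]; split; rewrite -starM ?az ?za star1. Qed.

Lemma neumann y : nrm y < 1 ->
  exists2 z, inverse_of (1 - y) z & nrm z <= (1 - nrm y)^-1.
Proof.
move=> y1; pose u n := \sum_(k < n) y ^+ k.
have uE n : (1 - y) * u n = 1 - y ^+ n.
  by rewrite -opprB mulNr -subrX1 opprB.
have uE' n : u n * (1 - y) = 1 - y ^+ n.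
  rewrite -uE /u mulr_suml mulr_sumr; apply: eq_bigr => k _.
  by rewrite mulrBl mulrBr mulr1 mul1r -exprS -exprSr.
have [|n|z uz] := @cvgs_geometric _ A u 1 (nrm y).
- by rewrite nrm_ge0.
- by rewrite /u big_ord_recr /= addrAC subrr add0r mul1r nrmX.
have y0 : cvgs (fun n => 1 - y ^+ n) 1.
  move=> e e0.
  have /cvgrPdist_lt/(_ e e0)[N _ hN] :
      (geometric 1 (nrm y) : nat -> R) @ \oo --> (0 : R).
    by apply: cvg_geometric; rewrite ger0_norm ?nrm_ge0.
  exists N => n /hN /=; rewrite sub0r normrN mul1r ger0_norm ?exprn_ge0 ?nrm_ge0//.
  apply: le_lt_trans; rewrite addrAC subrr add0r nrmN.
  exact: nrmX.
exists z.
  split.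
    apply: (@cvgs_unique _ _ (fun n => (1 - y) * u n)).
      exact: cvgsM (cvgs_cst _) uz.
    by under [X in cvgs X _]funext => n do rewrite uE.
  apply: (@cvgs_unique _ _ (fun n => u n * (1 - y))).
    exact: cvgsM uz (cvgs_cst _).
  by under [X in cvgs X _]funext => n do rewrite uE'.
apply: (cvgs_le uz) => n.
have y1' : 0 < 1 - nrm y by rewrite subr_gt0.
apply: le_trans (_ : series (geometric 1 (nrm y)) n <= _).
  rewrite /series /= big_mkord; apply: le_trans (nrm_sum _) _.
  by apply: ler_sum => k _; rewrite mul1r nrmX.
rewrite geometric_seriesE ?lt_eqF//= mul1r ler_piMl ?invr_ge0 ?(ltW y1')//.
by rewrite lerBlDr lerDl exprn_ge0 ?nrm_ge0.
Qed.

(* The fixed-point iteration of y |-> (x + y^2) / 2, whose limit y satisfies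
   (1 - y)^2 = 1 - x. *)
Fixpoint sqrt_iter x n :=
  if n is n'.+1 then 2^-1 *c: (x + sqrt_iter x n' * sqrt_iter x n') else 0.

Lemma sqrt_iter_intertwine x z c n : x * c = c * z ->
  sqrt_iter x n * c = c * sqrt_iter z n.
Proof.
move=> xc; elim: n => [|n IH] /=; first by rewrite mul0r mulr0.
rewrite -scalerAl -scalerAr; congr (_ *: _).
by rewrite mulrDl mulrDr xc -mulrA IH mulrA IH mulrA.
Qed.

Lemma sqrt_iter_star x n : star x = x -> star (sqrt_iter x n) = sqrt_iter x n.
Proof.
by move=> sx; elim: n => [|n IH] /=; rewrite ?star0// starZr starD starM sx IH.
Qed.

Lemma half2 a : 2^-1 *c: (a + a) = a.
Proof. by rewrite -{1 2}[a]scale1c -scalecDl scalecA mulVf ?scale1c// pnatr_eq0. Qed.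

(** The condition on [r] makes the ball of radius [r] stable under the iteration, which is
    [r]-Lipschitz there; a fixed point satisfies y + y = x + y^2. *)
Lemma sqrt_iter_cvg x (r : R) : 0 <= r < 1 -> nrm x + r ^+ 2 <= 2 * r ->
  exists y, [/\ cvgs (sqrt_iter x) y, nrm y <= r & (1 - y) * (1 - y) = 1 - x].
Proof.
move=> r01 xr; have /andP[r0 r1] := r01.
have hr n : nrm (sqrt_iter x n) <= r.
  elim: n => [|n IH] /=; first by rewrite nrm0.
  rewrite nrmZr ger0_norm ?invr_ge0// mulrC ler_pdivrMr// [r * 2]mulrC.
  apply: le_trans xr; apply: le_trans (nrmD _ _) _; rewrite lerD2l.
  by apply: le_trans (nrmM _ _) _; rewrite expr2; apply: ler_pM; rewrite ?nrm_ge0.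
have [|n|y xy] := @cvgs_geometric _ A (sqrt_iter x) (nrm (sqrt_iter x 1)) r.
- by rewrite r0.
- elim: n => [|n IH]; first by rewrite [sqrt_iter x 0]/= subr0 expr0 mulr1.
  set y := sqrt_iter x n.+1; set z := sqrt_iter x n.
  rewrite (_ : sqrt_iter x n.+2 - y = 2^-1 *c: (y * (y - z) + (y - z) * z)); last first.
    rewrite /y /z /= -scalerBr; congr (_ *: _); rewrite opprD addrACA subrr add0r.
    by rewrite mulrBr mulrBl addrA subrK.
  rewrite nrmZr ger0_norm ?invr_ge0// mulrC ler_pdivrMr// exprSr mulrA.
  set t := _ * r ^+ n in IH *.
  apply: le_trans (nrmD _ _) _; rewrite mulr_natr mulr2n; apply: lerD.
    by apply: le_trans (nrmM _ _) _; rewrite mulrC; apply: ler_pM; rewrite ?nrm_ge0 ?hr.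
  by apply: le_trans (nrmM _ _) _; apply: ler_pM; rewrite ?nrm_ge0 ?hr.
exists y; split => //; first exact: cvgs_le xy hr.
have yE : y = 2^-1 *c: (x + y * y).
  apply: cvgs_unique (cvgsS xy) _ => /=.
  by apply/cvgsZ/cvgsD; [exact: cvgs_cst|exact: cvgsM].
have : y + y = x + y * y.
  by rewrite {1 2}yE -scalerDr half2.
move=> h; transitivity (1 + y * y - (y + y)); first by nc.
by rewrite h; nc.
Qed.

(** Here [r] is [nrm x] itself. The root commutes with whatever commutes with [x] because it is a
    limit of polynomials in [x]. *)
Lemma sqrt_exists x : star x = x -> nrm x < 1 -> exists d e,
  [/\ star d = d, d * d = 1 - x, nrm (1 - d) <= nrm x, inverse_of d e &
      forall c, x * c = c * x -> d * c = c * d].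
Proof.
move=> sx x1; have [||y [xy yx yE]] := @sqrt_iter_cvg x (nrm x).
- by rewrite nrm_ge0.
- by rewrite mulr_natl mulr2n lerD2l expr2 ler_piMl ?nrm_ge0// ltW.
have [e ye _] := neumann (le_lt_trans yx x1).
exists (1 - y), e; split => //; last first.
- move=> c xc; rewrite mulrBl mulrBr mul1r mulr1; congr (_ - _).
  by apply: (cvgs_intertwine xy xy) => n; exact: sqrt_iter_intertwine.
- by rewrite opprB addrC subrK.
rewrite starB star1; congr (_ - _); apply: cvgs_unique (cvgs_star xy) _.
by under [X in cvgs X _]funext => n do rewrite sqrt_iter_star//.
Qed.

Lemma nrm_sqr_sa c : star c = c -> nrm (c * c) = nrm c ^+ 2.
Proof. by move=> sc; rewrite -{1}sc nrm_starM. Qed.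

(* A self-adjoint contraction c is the real part of the unitary
   c + i (1 - c^2)^(1/2). *)
Lemma dilation c : star c = c -> nrm c < 1 -> exists w d,
  [/\ unitary w, c = 2^-1 *c: (w + star w), star d = d, nrm d <= 1 &
      c * c + d * d = 1].
Proof.
move=> sc c1; have c21 : nrm (c * c) < 1.
  by rewrite nrm_sqr_sa// expr_lt1// nrm_ge0.
have [|//|d [_ [sd dE _ _ dC]]] := @sqrt_exists (c * c); first by rewrite starM sc.
have dc : d * c = c * d by apply: dC; rewrite mulrA.
pose D := 'i *: d; pose w := c + D.
have sD : star D = - D by rewrite starZ sd conjCi scaleNr.
have sw : star w = c - D by rewrite starD sc sD.
have DD : D * D = - (d * d).
  by rewrite /D -scalerAl -scalerAr scalerA mulCii scaleN1r.
have Dc : D * c = c * D by rewrite /D -scalerAl dc scalerAr.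
have cd1 : c * c + d * d = 1 by rewrite dE addrC subrK.
have uw : unitary w.
  split; rewrite sw /w.
    transitivity (c * c - D * D + (c * D - D * c)); first by nc.
    by rewrite DD Dc opprK subrr addr0.
  transitivity (c * c - D * D + (D * c - c * D)); first by nc.
  by rewrite DD Dc opprK subrr addr0.
exists w, d; split => //.
  by rewrite sw /w (_ : c + D + (c - D) = c + c) ?half2//; nc.
have -> : nrm d = nrm D by rewrite nrmZ nrm_i mul1r.
have -> : D = 2^-1 *c: (w - star w).
  by rewrite sw /w (_ : c + D - (c - D) = D + D) ?half2//; nc.
rewrite nrmZr ger0_norm ?invr_ge0// mulrC ler_pdivrMr// mul1r.
by apply: le_trans (nrmB _ _) _; rewrite nrm_star nrm_unitary//; lra.
Qed.

(** Dilating c / sqrt t writes t - c^2 as t d^2 with |d| <= 1. A bound |t - a| <= t is the form in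
    which positivity of a is used below. *)
Lemma nrm_sub_sqr c (t : R) : star c = c -> nrm c ^+ 2 < t ->
  nrm (t *c: 1 - c * c) <= t.
Proof.
move=> sc ct; have t0 : 0 < t by apply: le_lt_trans ct; rewrite exprn_ge0// nrm_ge0.
pose r := Num.sqrt t; have r0 : 0 < r by rewrite sqrtr_gt0.
have rr : r * r = t by rewrite -expr2 sqr_sqrtr// ltW.
have [||w [d [uw cE sd nd1 cd]]] := @dilation (r^-1 *c: c).
- by rewrite starZr sc.
- rewrite nrmZr gtr0_norm ?invr_gt0// mulrC ltr_pdivrMr// mul1r.
  by rewrite -(@ltr_pXn2r _ 2) ?nnegrE ?nrm_ge0 ?(ltW r0)// [r ^+ _]expr2 rr.
have -> : t *c: 1 - c * c = t *c: (d * d).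
  rewrite -cd scalerDr -scalerAl -scalerAr !scalecA.
  by rewrite -mulrA -invfM rr mulfV ?gt_eqF// scale1c; nc.
rewrite nrmZr gtr0_norm// ler_piMr ?(ltW t0)//.
by rewrite nrm_sqr_sa// exprn_ile1 ?nrm_ge0.
Qed.

Lemma nrm_dilation (w : A) : unitary w -> nrm (2^-1 *c: (w + star w)) <= 1.
Proof.
move=> uw; rewrite nrmZr ger0_norm ?invr_ge0// mulrC ler_pdivrMr// mul1r.
by apply: le_trans (nrmD _ _) _; rewrite nrm_star nrm_unitary//; lra.
Qed.

(* 1 - i h is invertible because (1 + i h) (1 - i h) = 1 + h^2 and
   |r - h^2| <= r for large r. *)
Lemma inverse_1i h : star h = h -> exists z, inverse_of (1 - 'i *: h) z.
Proof.
move=> sh; pose H := 'i *: h.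
have HH : H * H = - (h * h) by rewrite /H -scalerAl -scalerAr scalerA mulCii scaleN1r.
pose r := nrm h ^+ 2 + 1; pose x : A := (1 + r)^-1 *c: (r *c: 1 - h * h).
have r0 : 0 < r by rewrite ltr_wpDl// exprn_ge0// nrm_ge0.
have r1 : 0 < 1 + r by rewrite addr_gt0.
have hr : nrm (r *c: 1 - h * h) <= r by apply: nrm_sub_sqr => //; rewrite ltrDl.
have [|z [xz zx] _] := @neumann x.
  rewrite /x nrmZr gtr0_norm ?invr_gt0// mulrC ltr_pdivrMr//.
  by rewrite mul1r (le_lt_trans hr)// ltrDr.
have xE : (1 + r) *c: (1 - x) = 1 + h * h.
  rewrite scalerBr /x scalecA mulfV ?gt_eqF// scale1c scalecDl scale1c.
  by nc.
have e1 : (1 - H) * (1 + H) = (1 + r) *c: (1 - x).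
  by rewrite xE; transitivity (1 - H * H); [nc | rewrite HH opprK].
have e2 : (1 + H) * (1 - H) = (1 + r) *c: (1 - x).
  by rewrite xE; transitivity (1 - H * H); [nc | rewrite HH opprK].
pose y := (1 + r)^-1 *c: z.
have y1 : (1 - H) * ((1 + H) * y) = 1.
  rewrite mulrA e1 /y -scalerAl -scalerAr scalecA mulfV ?scale1c//.
  by rewrite gt_eqF.
have y2 : (y * (1 + H)) * (1 - H) = 1.
  rewrite -mulrA e2 /y -scalerAl -scalerAr scalecA mulVf ?scale1c//.
  by rewrite gt_eqF.
exists ((1 + H) * y); split => //.
suff -> : (1 + H) * y = y * (1 + H) by [].
by rewrite -[LHS]mul1r -{1}y2 -!mulrA y1 mulr1.
Qed.

(** The Cayley transform (1 + i h) (1 - i h)^-1, since z + z - 1 = (1 + i h) z. Being a relation, it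
    passes through homomorphisms without a choice of inverse. *)
Definition is_cayley h w := exists2 z, inverse_of (1 - 'i *: h) z & w = z + z - 1.

Lemma is_cayley_exists h : star h = h -> exists w, is_cayley h w.
Proof. by move=> /inverse_1i[z hz]; exists (z + z - 1), z. Qed.

Lemma is_cayley_unitary h w : star h = h -> is_cayley h w -> unitary w.
Proof.
move=> sh [z zi ->]; pose H := 'i *: h; pose z' := star z.
have sH : star (1 - H) = 1 + H by rewrite starB star1 starZ sh conjCi scaleNr opprK.
have := inverse_star zi; rewrite sH => -[h3 h4].
have [h1 h2] := zi; rewrite -/H -/z' in h1 h2 h3 h4.
have sw : star (z + z - 1) = z' + z' - 1 by rewrite !starD starN star1.
have e1 : z' * z + z' * z = z + z'.
  transitivity (z' * ((1 + H) * z + (1 - H) * z)); first by nc.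
  by rewrite mulrDr mulrA h4 h1 mul1r mulr1.
have e2 : z * z' + z * z' = z + z'.
  transitivity (z * ((1 + H) * z' + (1 - H) * z')); first by nc.
  by rewrite mulrDr h3 mulr1 mulrA h2 mul1r.
split; rewrite sw.
  transitivity ((z' * z + z' * z) + (z' * z + z' * z) - (z + z') - (z + z') + 1).
    by nc.
  by rewrite e1; nc.
transitivity ((z * z' + z * z') + (z * z' + z * z') - (z + z') - (z + z') + 1).
  by nc.
by rewrite e2; nc.
Qed.

(** Resolvent identity z - y = z (i (h - k)) y; both inverses have norm at most 1, each being half
    of 1 plus a unitary. *)
Lemma is_cayley_dist h k w v : star h = h -> star k = k ->
  is_cayley h w -> is_cayley k v -> nrm (w - v) <= 2 * nrm (h - k).
Proof.
move=> sh sk cw cv; have uw := is_cayley_unitary sh cw.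
have uv := is_cayley_unitary sk cv.
have nz (z x : A) : unitary x -> x = z + z - 1 -> nrm z <= 1.
  move=> ux xz; rewrite -(half2 z) (_ : z + z = 1 + x); last by rewrite xz; nc.
  rewrite nrmZr ger0_norm ?invr_ge0// mulrC ler_pdivrMr// mul1r.
  by apply: le_trans (nrmD _ _) _; rewrite nrm1 nrm_unitary//; lra.
move: cw cv uw uv => [z [z1 z2] ->] [y [y1 y2] ->] /nz/(_ erefl) nz1 /nz/(_ erefl) ny1.
have -> : z + z - 1 - (y + y - 1) = (z - y) + (z - y) by nc.
have -> : z - y = z * ('i *: (h - k)) * y.
  rewrite scalerBr; transitivity (z * ((1 - 'i *: k) * y) - z * (1 - 'i *: h) * y).
    by rewrite y1 z2; nc.
  by nc.
set q := _ * y; apply: le_trans (nrmD _ _) _; rewrite mulr_natl mulr2n.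
suff : nrm q <= nrm (h - k) by lra.
apply: le_trans (nrmM _ _) _; rewrite -[leRHS]mulr1; apply: ler_pM; rewrite ?nrm_ge0//.
apply: le_trans (nrmM _ _) _; rewrite -[leRHS]mul1r; apply: ler_pM; rewrite ?nrm_ge0//.
by rewrite nrmZ nrm_i mul1r.
Qed.

(** The inverse Cayley transform, available because 1 + u is invertible. Self-adjointness of h
    amounts to y + y^* = 2 for the inverse y of (1 + u) / 2, which follows from u u^* = 1. *)
Lemma unitary_near1 u : unitary u -> nrm (u - 1) < 1 ->
  exists2 h, star h = h & is_cayley h u.
Proof.
move=> [uu1 uu2] u1; pose z := 2^-1 *c: (1 + u).
have zz : z + z = 1 + u by rewrite -scalerDr half2.
have [|y [zy yz] _] := @neumann (2^-1 *c: (1 - u)).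
  rewrite nrmZr ger0_norm ?invr_ge0// nrmBC; have := nrm_ge0 (u - 1); lra.
have zE : 1 - 2^-1 *c: (1 - u) = z.
  by rewrite /z -{1}(half2 1) -scalerBr; congr (_ *: _); nc.
rewrite zE in zy yz.
have sz : star z = 2^-1 *c: (1 + star u) by rewrite starZr starD star1.
have zz' : star z + star z = 1 + star u by rewrite sz -scalerDr half2.
have [] : inverse_of (star z) (star y) by exact: inverse_star.
set z' := star z in zz' *; set y' := star y => zy' yz'.
have e1 : z * z' + z * z' = z + z'.
  have h4 : (z + z) * (z' + z') = (z + z) + (z' + z').
    rewrite zz zz'; transitivity (1 + u + star u + u * star u); first by nc.
    by rewrite uu2; nc.
  rewrite -[LHS]half2 -[RHS]half2; congr (_ *: _).
  transitivity ((z + z) * (z' + z')); first by nc.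
  by rewrite h4; nc.
have e2 : y + y' = 1 + 1.
  transitivity (y * (z + z') * y'); first by nc yz zy'.
  by rewrite -e1; nc yz zy'.
pose h := - 'i *: (1 - y); exists h.
  rewrite /h starZ rmorphN /= conjCi opprK starB star1 -/y'.
  by rewrite scaleNr -scalerN; congr (_ *: _); rewrite opprB -[y'](addKr y) e2; nc.
have hi : 'i *: h = 1 - y by rewrite /h scalerA mulrN mulCii opprK scale1r.
exists z; last by rewrite zz; nc.
by rewrite hi; split; rewrite opprB addrC subrK.
Qed.

(** The hypothesis |1 - g| <= 1 stands for g >= 0. The iteration need not converge geometrically for
    g^2, so it is run for g^2 + e^2 (1 - g^2). The difference of the two roots is the difference of
    their squares divided by their sum, and this sum has an inverse of norm at most 1 / e. *)
Lemma sqrt_approx g (e : R) : star g = g -> nrm (1 - g) <= 1 -> nrm g < 1 ->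
  0 < e < 1 -> exists2 y, nrm (1 - y - g) <= e &
    cvgs (sqrt_iter ((1 - e ^+ 2) *c: (1 - g * g))) y.
Proof.
move=> sg g1 gs /andP[e0 e1]; set d := e ^+ 2; set x := _ *c: _.
have d1 : 0 < 1 - d by rewrite /d; nra.
have gg : nrm (1 - g * g) <= 1.
  by rewrite -(scale1c 1); apply: nrm_sub_sqr; rewrite ?expr_lt1// nrm_ge0.
have nx : nrm x <= 1 - d by rewrite nrmZr gtr0_norm// ler_piMr// ltW.
have [||y [xy ny yE]] := @sqrt_iter_cvg x (1 - e).
- by apply/andP; split; lra.
- by move: nx; rewrite /d; lra.
exists y => //.
have yg : y * g = g * y.
  apply: (cvgs_intertwine xy xy) => n; apply: sqrt_iter_intertwine.
  by rewrite /x -scalerAl -scalerAr; congr (_ *: _); nc.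
have [|z [sz zs] nz] := @neumann (2^-1 *c: (y + (1 - g))).
  rewrite nrmZr ger0_norm ?invr_ge0//; have := nrmD y (1 - g); lra.
set s := _ - _ in sz zs.
have ss : s + s = 1 - y + g.
  rewrite /s; set q := _ *c: _; have qq : q + q = y + (1 - g) by rewrite -scalerDr half2.
  by transitivity (1 + 1 - (q + q)); [nc | rewrite qq; nc].
have prod : (1 - y - g) * (s + s) = d *c: (1 - g * g).
  rewrite ss; transitivity ((1 - y) * (1 - y) - g * g + (g * y - y * g)); first by nc.
  rewrite yE yg subrr addr0 /x scalecBl scale1c; nc.
have e2z : nrm z <= 2 / e.
  apply: le_trans nz _; rewrite -invf_div lef_pV2 ?posrE ?divr_gt0//; last first.
    rewrite subr_gt0 nrmZr ger0_norm ?invr_ge0//; have := nrmD y (1 - g); lra.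
  rewrite nrmZr ger0_norm ?invr_ge0//; have := nrmD y (1 - g); lra.
have : 1 - y - g = 2^-1 *c: (d *c: (1 - g * g) * z).
  by rewrite -prod mulrDr mulrDl -!mulrA sz !mulr1 half2.
move=> ->; rewrite nrmZr ger0_norm ?invr_ge0//.
have : nrm (d *c: (1 - g * g) * z) <= d * (2 / e).
  apply: le_trans (nrmM _ _) _; apply: ler_pM; rewrite ?nrm_ge0//.
  by rewrite nrmZr ger0_norm ?exprn_ge0 ?(ltW e0)// ler_piMr// exprn_ge0// ltW.
suff -> : d * (2 / e) = 2 * e by lra.
by rewrite /d; field; rewrite gt_eqF.
Qed.

(* If g c = - c h then g^2 c = c h^2, so the positive square roots of g^2 and h^2
   also intertwine and g c = c h. *)
Lemma anti_intertwine g h c : star g = g -> star h = h ->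
  nrm (1 - g) <= 1 -> nrm (1 - h) <= 1 -> nrm g < 1 -> nrm h < 1 ->
  g * c = - (c * h) -> c * h = 0.
Proof.
move=> sg sh g1 h1 gs hs gc.
have ggc : g * g * c = c * (h * h).
  transitivity (- (g * c * h)); last by rewrite gc; nc.
  by transitivity (g * (g * c)); [nc | rewrite {1}gc; nc].
suff eq : g * c - c * h = 0.
  rewrite -(half2 (c * h)); have -> : c * h + c * h = 0.
    by rewrite -[RHS]oppr0 -eq gc; nc.
  by rewrite scaler0.
apply: nrm_small_eq0 => e e0.
pose K := 2 * nrm c + 1; have K0 : 0 < K by rewrite /K; have := nrm_ge0 c; lra.
pose d := Num.min (e / K) 2^-1.
have d01 : 0 < d < 1.
  by rewrite lt_min divr_gt0//= invr_gt0 ltr0n /= gt_min; apply/orP; right; lra.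
have [y gy yc] := sqrt_approx sg g1 gs d01.
have [z hz zc] := sqrt_approx sh h1 hs d01.
have ycz : y * c = c * z.
  apply: (cvgs_intertwine yc zc) => n; apply: sqrt_iter_intertwine.
  rewrite -scalerAl -scalerAr; congr (_ *: _).
  by rewrite mulrBl mulrBr mul1r mulr1 ggc.
have -> : g * c - c * h = c * (1 - z - h) - (1 - y - g) * c.
  transitivity (g * c - c * h + (y * c - c * z)); last by nc.
  by rewrite ycz subrr addr0.
have dK : d * K <= e by rewrite -ler_pdivlMr// ge_min lexx.
have h2 : nrm (c * (1 - z - h)) <= nrm c * d.
  by apply: le_trans (nrmM _ _) _; apply: ler_pM; rewrite ?nrm_ge0.
have h3 : nrm ((1 - y - g) * c) <= d * nrm c.
  by apply: le_trans (nrmM _ _) _; apply: ler_pM; rewrite ?nrm_ge0.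
apply: le_trans (nrmB _ _) _; apply: le_trans dK; rewrite /K.
have /andP[d0 _] := d01; have := nrm_ge0 c; nra.
Qed.

(* A weak form of the positivity of c^* c. *)
Lemma star_mul_nonpos c : nrm (1 + star c * c) <= 1 -> c = 0.
Proof.
move=> c1; set c' := star c in c1 *.
pose a := 2^-1 *c: (c + c'); pose b := - 'i *: (2^-1 *c: (c - c')).
have sa : star a = a by rewrite starZr starD starK addrC.
have sb : star b = b.
  rewrite starZ rmorphN /= conjCi opprK starZr starB -/c' starK.
  by rewrite /b -(opprB c c') !scalerN scaleNr.
have aE : a + a = c + c' by rewrite -scalerDr half2.
have bE : 'i *: b + 'i *: b = c - c'.
  by rewrite /b scalerA mulrN mulCii opprK scale1r -scalerDr half2.
have bb : ('i *: b) * ('i *: b) = - (b * b).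
  by rewrite -scalerAl -scalerAr scalerA mulCii scaleN1r.
(* The classical identity c c^* + c^* c = 2 (a^2 + b^2), with a and b the real and imaginary parts
   of c: if - c^* c is positive, so is c c^*. *)
have gE : c * c' = (a * a + a * a) + (b * b + b * b) - c' * c.
  have h2 : (a + a) * (a + a) - ('i *: b + 'i *: b) * ('i *: b + 'i *: b) =
     (c * c' + c' * c) + (c * c' + c' * c) by rewrite aE bE; nc.
  have h3 : (a + a) * (a + a) - ('i *: b + 'i *: b) * ('i *: b + 'i *: b) =
     ((a * a + a * a) + (b * b + b * b)) + ((a * a + a * a) + (b * b + b * b)).
    transitivity ((a + a) * (a + a) -
      (('i *: b) * ('i *: b) + ('i *: b) * ('i *: b) +
       ('i *: b) * ('i *: b) + ('i *: b) * ('i *: b))); first by nc.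
    by rewrite bb; nc.
  have : c * c' + c' * c = (a * a + a * a) + (b * b + b * b).
    by rewrite -[LHS]half2 -h2 h3 half2.
  by move=> <-; nc.
pose rA := nrm a ^+ 2 + 1; pose rB := nrm b ^+ 2 + 1.
have hA : nrm (rA *c: 1 - a * a) <= rA by apply: nrm_sub_sqr => //; rewrite ltrDl.
have hB : nrm (rB *c: 1 - b * b) <= rB by apply: nrm_sub_sqr => //; rewrite ltrDl.
(* S adds up the bounds of the summands in [gE], so that |S - c c^*| <= S; it also exceeds
   [nrm c ^+ 2], so division by S brings both elements below norm 1. *)
pose S := rA + rA + (rB + rB) + 1 + nrm c ^+ 2.
have rA1 : 1 <= rA by rewrite lerDr exprn_ge0// nrm_ge0.
have rB1 : 1 <= rB by rewrite lerDr exprn_ge0// nrm_ge0.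
have nc2 : 0 <= nrm c ^+ 2 by rewrite exprn_ge0// nrm_ge0.
have S0 : 0 < S by rewrite /S; lra.
have hg : nrm (S *c: 1 - c * c') <= S.
  have -> : S *c: 1 - c * c' = (rA *c: 1 - a * a) + (rA *c: 1 - a * a) +
     ((rB *c: 1 - b * b) + (rB *c: 1 - b * b)) + (1 + c' * c) + nrm c ^+ 2 *c: 1.
    by rewrite gE /S !scalecDl scale1c; nc.
  rewrite /S; apply: le_trans (nrmD _ _) _; apply: lerD; last first.
    by rewrite nrm_scale1 ger0_norm.
  apply: le_trans (nrmD _ _) _; apply: lerD => //.
  apply: le_trans (nrmD _ _) _; apply: lerD; apply: le_trans (nrmD _ _) _; exact: lerD.
have hh : nrm (S *c: 1 - - (c' * c)) <= S.
  have -> : S *c: 1 - - (c' * c) = (S - 1) *c: 1 + (1 + c' * c).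
    by rewrite scalecBl scale1c; nc.
  apply: le_trans (nrmD _ _) _; rewrite nrm_scale1 ger0_norm; last by rewrite /S; lra.
  lra.
have scaled (x : A) : nrm (S *c: 1 - x) <= S -> nrm (1 - S^-1 *c: x) <= 1.
  move=> hx; have -> : 1 - S^-1 *c: x = S^-1 *c: (S *c: 1 - x).
    by rewrite scalerBr scalecA mulVf ?gt_eqF// scale1c.
  by rewrite nrmZr gtr0_norm ?invr_gt0// mulrC ler_pdivrMr// mul1r.
have small (x : A) : nrm x <= nrm c ^+ 2 -> nrm (S^-1 *c: x) < 1.
  move=> hx; rewrite nrmZr gtr0_norm ?invr_gt0// mulrC ltr_pdivrMr// mul1r /S; lra.
(* Both c c^* and - c^* c are positive, and c c^* c is at once the first times c and minus c times
   the second. *)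
have : c * (S^-1 *c: - (c' * c)) = 0.
  apply: (@anti_intertwine (S^-1 *c: (c * c'))).
  - by rewrite starZr starM starK.
  - by rewrite starZr starN starM starK.
  - exact: scaled.
  - exact: scaled.
  - by apply: small; rewrite nrm_Mstar.
  - by apply: small; rewrite nrmN nrm_starM.
  - by rewrite -scalerAl -scalerAr -scalerN; congr (_ *: _); nc.
rewrite -scalerAr mulrN => /eqP; rewrite scaler_eq0 oppr_eq0 => /orP[|/eqP ccc].
  by rewrite eq_complex /= eqxx andbT invr_eq0 gt_eqF.
have : nrm ((star (c' * c)) * (c' * c)) = 0.
  by rewrite starM starK -mulrA ccc mulr0 nrm0.
rewrite nrm_starM nrm_starM => /eqP; rewrite !expf_eq0 /= nrm_eq0 => /eqP //.
Qed.

(** Compressing 1 - t1 t1^* - t2 t2^* = b^* b by t1 gives c^* c = - x^* x with c = b t1 and x = t2^*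
    t1. As 1 - x^* x = t1^* q t1 for the projection q = 1 - t2 t2^*, it has norm at most 1 and
    [star_mul_nonpos] applies. *)
Lemma isometries_orthogonal (t1 t2 : A) : T2_relations t1 t2 -> star t1 * t2 = 0.
Proof.
move=> [i1 i2 [b bE]]; pose c := b * t1; pose x := star t2 * t1.
have cE : star c * c = - (star x * x).
  rewrite /c /x !starM starK -!mulrA (mulrA (star b)) -bE.
  transitivity (star t1 * t1 - star t1 * t1 * (star t1 * t1) - star t1 * (t2 * (star t2 * t1))).
    by nc.
  by rewrite i1; nc.
pose q := 1 - t2 * star t2.
have qq : star q * q = q.
  by rewrite /q starB star1 starM starK; nc i2.
have nq : nrm q <= 1.
  have := nrm_starM q; rewrite qq expr2 => h.
  by have := nrm_ge0 q; case: ltgtP => // q1 _; nra.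
have : c = 0.
  apply: star_mul_nonpos; rewrite cE.
  have -> : 1 - star x * x = star t1 * q * t1.
    by rewrite /x /q starM starK; nc i1.
  have n1 : nrm (star t1) = 1 by rewrite nrm_star nrm_isometry.
  apply: le_trans (nrmM _ _) _; rewrite (nrm_isometry i1) mulr1.
  by apply: le_trans (nrmM _ _) _; rewrite n1 mul1r.
move=> c0; have x0 : x = 0.
  have := nrm_starM x; rewrite -[star x * x]opprK -cE c0 mulr0 oppr0 nrm0.
  by move=> /esym/eqP; rewrite expf_eq0 /= nrm_eq0 => /eqP.
by rewrite -[LHS]starK starM starK -/x x0 star0.
Qed.

(** Polar decomposition: s is a (a^* a)^(-1/2). The form [a * z] is recorded so that orthogonality
    of another element to [a] passes to [s]. *)
Lemma perturb_isometry a (e : R) : e < 1 -> nrm (star a * a - 1) <= e ->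
  exists s z, [/\ isometry s, s = a * z & nrm (s - a) <= e].
Proof.
move=> e1 ae; have sx : star (1 - star a * a) = 1 - star a * a.
  by rewrite starB star1 starM starK.
rewrite nrmBC in ae.
have [d [z [sd dE d1 dz _]]] := sqrt_exists sx (le_lt_trans ae e1).
have [dz1 zd1] := dz.
have sz : star z = z.
  by apply: (inverse_unique _ dz); have := inverse_star dz; rewrite sd.
have daa : d * d = star a * a by rewrite dE opprB addrC subrK.
exists (a * z), z; split => //.
  rewrite /isometry starM sz -mulrA (mulrA (star a)) -daa.
  by transitivity ((z * d) * (d * z)); [nc | rewrite zd1 dz1 mulr1].
have is_ : isometry (a * z).
  rewrite /isometry starM sz -mulrA (mulrA (star a)) -daa.
  by transitivity ((z * d) * (d * z)); [nc | rewrite zd1 dz1 mulr1].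
have -> : a * z - a = a * z * (1 - d).
  by transitivity (a * z - a * (z * d)); [rewrite zd1 mulr1 | nc].
apply: le_trans (nrmM _ _) _; rewrite nrm_isometry// mul1r.
exact: le_trans d1 ae.
Qed.

Definition almost_isometries (e : R) a b :=
  [/\ nrm (star a * a - 1) <= e, nrm (star b * b - 1) <= e & nrm (star a * b) <= e].

(** Gram-Schmidt: once s is fixed, b is replaced by its part orthogonal to the range of s before it
    is normalised, so that the orthogonality is exact. *)
Lemma perturb_isometries a b (e : R) : e <= 20^-1 -> almost_isometries e a b ->
  exists s t, [/\ isometry s, isometry t, star s * t = 0,
                  nrm (s - a) <= 5 * e & nrm (t - b) <= 5 * e].
Proof.
move=> e20 [aa bb ab]; have e0 : 0 <= e := le_trans (nrm_ge0 _) ab.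
have [|s [_ [is_ _ sa]]] := perturb_isometry _ aa; first lra.
have nb : nrm b <= 2.
  have : nrm b ^+ 2 <= 1 + e.
    rewrite -nrm_starM; have := nrm_le_dist (star b * b) 1; rewrite nrm1; lra.
  by have := nrm_ge0 b; nra.
have sb : nrm (star s * b) <= 3 * e.
  have -> : star s * b = star (s - a) * b + star a * b by rewrite starB; nc.
  apply: le_trans (nrmD _ _) _.
  have := nrmM (star (s - a)) b; rewrite nrm_star.
  have := nrm_ge0 b; have := nrm_ge0 (s - a); nra.
pose c := b - s * (star s * b).
have sc : star s * c = 0 by rewrite /c; nc is_.
have cc : nrm (star c * c - 1) <= 2 * e.
  have -> : star c * c - 1 = (star b * b - 1) - star (star s * b) * (star s * b).
    by rewrite /c starB !starM !starK; nc is_.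
  apply: le_trans (nrmB _ _) _; rewrite nrm_starM.
  have := nrm_ge0 (star s * b); nra.
have [|t [z [it tE tc]]] := perturb_isometry _ cc; first lra.
exists s, t; split => //; first by rewrite tE mulrA sc mul0r.
- lra.
- have -> : t - b = (t - c) - s * (star s * b) by rewrite /c; nc.
  apply: le_trans (nrmB _ _) _.
  have := nrmM s (star s * b); rewrite (nrm_isometry is_) mul1r; lra.
Qed.

Lemma properly_infiniteP : properly_infinite A <->
  exists s t : A, [/\ isometry s, isometry t & star s * t = 0].
Proof.
split=> -[s [t [is_ it st]]]; exists s, t; split=> //.
  transitivity (star s * (s * star s * (t * star t)) * t); first by nc is_ it.
  by rewrite st mulr0 mul0r.
by transitivity (s * (star s * t) * star t); [nc | rewrite st mulr0 mul0r].
Qed.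

Lemma T2_relations_isometries (s t : A) : isometry s -> isometry t ->
  star s * t = 0 -> T2_relations s t.
Proof.
move=> is_ it st; split=> //; exists (1 - (s * star s + t * star t)).
have ts : star t * s = 0 by rewrite -[LHS]starK starM starK st star0.
by rewrite starB starD !starM !starK star1; nc is_ it st ts.
Qed.

End CStarBasics.

(** * Star-homomorphisms are contractive *)

Section Homs.
Variables (R : realType) (A B : cstarAlgType R) (f : {lrmorphism A -> B}).
Hypothesis sf : star_hom f.

Lemma hom_scale (c : R[i]) (a : A) : f (c *: a) = c *: f a.
Proof. exact: linearZ. Qed.

Lemma star_hom_isometry a : isometry a -> isometry (f a).
Proof. by move=> ia; rewrite /isometry -sf -rmorphM ia rmorph1. Qed.

Lemma star_hom_unitary a : unitary a -> unitary (f a).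
Proof. by move=> [h1 h2]; split; rewrite -sf -rmorphM ?h1 ?h2 rmorph1. Qed.

Lemma star_hom_inverse a z : inverse_of a z -> inverse_of (f a) (f z).
Proof. by move=> [h1 h2]; split; rewrite -rmorphM ?h1 ?h2 rmorph1. Qed.

Lemma star_hom_cayley (h w : A) : is_cayley h w -> is_cayley (f h) (f w).
Proof.
move=> [z hz ->]; exists (f z); last by rewrite rmorphB rmorphD rmorph1.
have e : f (1 - 'i *: h) = 1 - 'i *: f h.
  by rewrite rmorphB rmorph1; congr (_ - _); exact: hom_scale.
by rewrite -e; exact: star_hom_inverse.
Qed.

(** Homomorphisms preserve unitaries, and by [dilation] a self-adjoint element of norm less than r
    is r times the real part of a unitary. The C*-identity reduces the general case to this one. *)
Lemma star_hom_contractive a : nrm (f a) <= nrm a.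
Proof.
suff h (c : A) : star c = c -> nrm (f c) <= nrm c.
  rewrite -(@ler_pXn2r _ 2) ?nnegrE ?nrm_ge0// -!nrm_starM -sf -rmorphM h//.
  by rewrite starM starK.
move=> sc; apply/ler_addgt0Pl => e e0; set r := e + nrm c.
have r0 : 0 < r by rewrite ltr_pwDl ?nrm_ge0.
have [||w [d [uw cE _ _ _]]] := @dilation _ _ (r^-1 *c: c).
- by rewrite starZr sc.
- rewrite nrmZr gtr0_norm ?invr_gt0// mulrC ltr_pdivrMr// mul1r /r; lra.
have -> : c = r *c: (r^-1 *c: c) by rewrite scalecA mulfV ?gt_eqF// scale1c.
have fE : f (2^-1 *c: (w + star w)) = 2^-1 *c: (f w + star (f w)).
  by rewrite -sf hom_scale raddfD.
rewrite cE hom_scale fE nrmZr gtr0_norm// ler_piMr ?(ltW r0)//.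
exact/nrm_dilation/star_hom_unitary.
Qed.

Lemma star_hom_continuous : continuous f.
Proof.
move=> a; apply/continuous_nrmP => e e0; apply/nbhs_nrmP; exists e => // b.
by rewrite -raddfB; apply: le_lt_trans; exact: star_hom_contractive.
Qed.

End Homs.

(** * Algebras of bounded families *)

(* The index fam_point only serves to make 1 != 0 in the algebra of families. *)
Record family_subalgebra (R : realType) (I : Type) (A : I -> cstarAlgType R) :=
  FamilySubalgebra {
  fam_mem : set (forall i, A i);
  fam_point : I;
  fam1 : fam_mem (fun i => 1);
  famL : forall (c : R[i]) f g, fam_mem f -> fam_mem g ->
    fam_mem (fun i => c *: f i + g i);
  famM : forall f g, fam_mem f -> fam_mem g -> fam_mem (fun i => f i * g i);
  fam_star : forall f, fam_mem f -> fam_mem (fun i => star (f i));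
  fam_closed : forall f, (forall e : R, 0 < e ->
    exists2 g, fam_mem g & forall i, nrm (g i - f i) <= e) -> fam_mem f
}.

Section BoundedFamilies.
Variables (R : realType) (I : Type) (A : I -> cstarAlgType R).
Variable S : family_subalgebra A.

Definition bounded_family (f : forall i, A i) :=
  exists M : R, forall i, nrm (f i) <= M.

Record bfamily := Family {
  fam_fun :> forall i, A i;
  fam_funP : fam_mem S fam_fun;
  fam_bounded : bounded_family fam_fun
}.

HB.instance Definition _ := gen_eqMixin bfamily.
HB.instance Definition _ := gen_choiceMixin bfamily.

Lemma bfamilyP (f g : bfamily) : (forall i, f i = g i) -> f = g.
Proof.
case: f g => [f Sf bf] [g Sg bg] /= fg.
have {}fg : f = g by apply: functional_extensionality_dep.
by subst g; congr Family; exact: Prop_irrelevance.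
Qed.

Lemma fam0 : fam_mem S (fun i => 0).
Proof.
have := famL (-1) (fam1 S) (fam1 S); congr (fam_mem S _).
by apply: functional_extensionality_dep => i; rewrite scaleN1r addNr.
Qed.

Fact bounded0 : bounded_family (fun i => 0).
Proof. by exists 0 => i; rewrite nrm0. Qed.

Fact bounded1 : bounded_family (fun i => 1).
Proof. by exists 1 => i; rewrite nrm1. Qed.

Fact boundedL (c : R[i]) f g : bounded_family f -> bounded_family g ->
  bounded_family (fun i => c *: f i + g i).
Proof.
move=> [M fM] [N gN]; exists (nrm c * M + N) => i.
apply: le_trans (nrmD _ _) _; apply: lerD => //.
by rewrite nrmZ; apply: ler_wpM2l; [exact: nrm_ge0 | exact: fM].
Qed.

Fact boundedM f g : bounded_family f -> bounded_family g ->
  bounded_family (fun i => f i * g i).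
Proof.
move=> [M fM] [N gN]; exists (M * N) => i.
by apply: le_trans (nrmM _ _) _; apply: ler_pM; rewrite ?nrm_ge0.
Qed.

Fact bounded_star f : bounded_family f -> bounded_family (fun i => star (f i)).
Proof. by move=> [M fM]; exists M => i; rewrite nrm_star. Qed.

(** All linear operations come from the single closure property [famL]. *)
Definition fam_lin (c : R[i]) (f g : bfamily) :=
  Family (famL c (fam_funP f) (fam_funP g)) (boundedL c (fam_bounded f) (fam_bounded g)).
Definition fam_zero := Family fam0 bounded0.
Definition fam_one := Family (fam1 S) bounded1.
Definition fam_mul (f g : bfamily) :=
  Family (famM (fam_funP f) (fam_funP g)) (boundedM (fam_bounded f) (fam_bounded g)).
Definition fam_adj (f : bfamily) :=
  Family (fam_star (fam_funP f)) (bounded_star (fam_bounded f)).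
Definition fam_add := fam_lin 1.
Definition fam_opp (f : bfamily) := fam_lin (-1) f fam_zero.
Definition fam_scale (c : R[i]) (f : bfamily) := fam_lin c f fam_zero.

Fact fam_addA : associative fam_add.
Proof. by move=> f g h; apply: bfamilyP => i /=; rewrite !scale1r addrA. Qed.
Fact fam_addC : commutative fam_add.
Proof. by move=> f g; apply: bfamilyP => i /=; rewrite !scale1r addrC. Qed.
Fact fam_add0 : left_id fam_zero fam_add.
Proof. by move=> f; apply: bfamilyP => i /=; rewrite scale1r add0r. Qed.
Fact fam_addN : left_inverse fam_zero fam_opp fam_add.
Proof. by move=> f; apply: bfamilyP => i /=; rewrite scale1r addr0 scaleN1r addNr. Qed.

HB.instance Definition _ := GRing.isZmodule.Build bfamily fam_addA fam_addC fam_add0 fam_addN.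

Lemma fam_addE (f g : bfamily) i : (f + g) i = f i + g i.
Proof. by rewrite -[f i + g i]/(f i + g i) -[in RHS](scale1r (f i)). Qed.
Lemma fam_zeroE i : (0 : bfamily) i = 0.
Proof. by []. Qed.
Lemma fam_oppE (f : bfamily) i : (- f) i = - f i.
Proof. by rewrite -[LHS]/(-1 *: f i + 0) addr0 scaleN1r. Qed.

Fact fam_scaleA a b (f : bfamily) : fam_scale a (fam_scale b f) = fam_scale (a * b) f.
Proof. by apply: bfamilyP => i /=; rewrite !addr0 scalerA. Qed.
Fact fam_scale1 : left_id 1 fam_scale.
Proof. by move=> f; apply: bfamilyP => i /=; rewrite addr0 scale1r. Qed.
Fact fam_scaleI (c : R[i]) f i : fam_scale c f i = c *: f i.
Proof. exact: addr0. Qed.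
Fact fam_scaleDr : right_distributive fam_scale +%R.
Proof.
by move=> a f g; apply: bfamilyP => i; rewrite fam_addE !fam_scaleI fam_addE scalerDr.
Qed.
Fact fam_scaleDl f : {morph fam_scale^~ f : a b / a + b}.
Proof. by move=> a b; apply: bfamilyP => i; rewrite fam_addE /= !addr0 scalerDl. Qed.

HB.instance Definition _ := GRing.Zmodule_isLmodule.Build R[i] bfamily
  fam_scaleA fam_scale1 fam_scaleDr fam_scaleDl.

Lemma fam_scaleE (c : R[i]) (f : bfamily) i : (c *: f) i = c *: f i.
Proof. by rewrite -[LHS]/(c *: f i + 0) addr0. Qed.

Definition fam_supn (f : bfamily) : R := sup [set nrm (f i) | i in [set: I]].

Lemma fam_has_sup (f : bfamily) : has_sup [set nrm (f i) | i in [set: I]].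
Proof.
split; first by exists (nrm (f (fam_point S))), (fam_point S).
by have [M fM] := fam_bounded f; exists M => _ [i _ <-].
Qed.

Lemma fam_le_supn (f : bfamily) i : nrm (f i) <= fam_supn f.
Proof. by apply: sup_upper_bound; [exact: fam_has_sup | exists i]. Qed.

Lemma fam_supn_le (f : bfamily) M : (forall i, nrm (f i) <= M) -> fam_supn f <= M.
Proof.
move=> fM; apply: ge_sup; first by have [] := fam_has_sup f.
by move=> _ [i _ <-].
Qed.

Definition fam_norm (f : bfamily) : R[i] := (fam_supn f)%:C%C.

Fact fam_norm_triangle f g : fam_norm (f + g) <= fam_norm f + fam_norm g.
Proof.
rewrite -rmorphD lecR; apply: fam_supn_le => i; rewrite fam_addE.
by apply: le_trans (nrmD _ _) _; apply: lerD; exact: fam_le_supn.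
Qed.

Fact fam_normZ (c : R[i]) f : fam_norm (c *: f) = `|c| * fam_norm f.
Proof.
rewrite nrmE -rmorphM; congr (_%:C%C); apply/le_anti/andP; split.
  apply: fam_supn_le => i; rewrite fam_scaleE nrmZ.
  by apply: ler_wpM2l; [exact: nrm_ge0 | exact: fam_le_supn].
have [->|c0] := eqVneq c 0.
  rewrite nrm0 mul0r; apply: le_trans (fam_le_supn _ (fam_point S)); exact: nrm_ge0.
have c1 : 0 < nrm c by rewrite lt_def nrm_ge0 nrm_eq0 c0.
rewrite mulrC -ler_pdivlMr//; apply: fam_supn_le => i.
by rewrite ler_pdivlMr// mulrC -nrmZ -fam_scaleE fam_le_supn.
Qed.

Fact fam_norm0_eq0 f : fam_norm f = 0 -> f = 0.
Proof.
move=> /(congr1 (@complex.Re R)) /= f0; apply: bfamilyP => i; rewrite fam_zeroE.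
by apply: nrm0_eq0; apply/le_anti; rewrite nrm_ge0 -f0 fam_le_supn.
Qed.

HB.instance Definition _ := @Lmodule_isNormed.Build R[i] bfamily fam_norm
  fam_norm_triangle fam_normZ fam_norm0_eq0.

Lemma nrm_fam_le (f : bfamily) (M : R) : (forall i, nrm (f i) <= M) -> nrm f <= M.
Proof. exact: fam_supn_le. Qed.

Lemma le_nrm_fam (f : bfamily) i : nrm (f i) <= nrm f.
Proof. exact: fam_le_supn. Qed.

Fact fam_complete (F : set_system bfamily) : ProperFilter F -> cauchy F -> cvg F.
Proof.
move=> PF /cauchyP FC.
have near_sup (e : R) : 0 < e -> exists g : bfamily, F [set f | nrm (g - f) < e].
  move=> e0; have [|g Fg] := FC e%:C%C; first by rewrite (ltcR 0).
  by exists g; apply: filterS Fg => f; rewrite -ball_normE /= nrm_lt.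
(* A sequence with steps of order 2^-n is extracted from the filter, so that [cvgs_geometric] gives
   a limit in each coordinate, at a rate independent of the coordinate. *)
pose q : R := 2^-1.
have q0 n : 0 < q ^+ n by rewrite exprn_gt0// invr_gt0.
pose g n := projT1 (cid (near_sup _ (q0 n))).
have gP n : F [set f | nrm (g n - f) < q ^+ n] := projT2 (cid (near_sup _ (q0 n))).
have gg n m i : (n <= m)%N -> nrm (g n i - g m i) <= 2 * q ^+ n.
  move=> nm; have [f [fn fm]] := filter_ex (filterI (gP n) (gP m)).
  have h1 : nrm (g n i - f i) <= q ^+ n.
    apply: le_trans (ltW fn); rewrite -fam_oppE -fam_addE; exact: le_nrm_fam.
  have h2 : nrm (f i - g m i) <= q ^+ m.
    rewrite nrmBC; apply: le_trans (ltW fm); rewrite -fam_oppE -fam_addE; exact: le_nrm_fam.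
  have h3 : q ^+ m <= q ^+ n.
    by apply: ler_wiXn2l => //; rewrite /q; lra.
  by have := nrm_dist (g n i) (f i) (g m i); lra.
have lim_ex i : exists l, cvgs (fun n => g n i) l.
  apply: (@cvgs_geometric R (A i) _ 2 q); first by apply/andP; split; rewrite /q; lra.
  by move=> n; rewrite nrmBC; exact: gg.
pose l i := projT1 (cid (lim_ex i)).
have lP i : cvgs (fun n => g n i) (l i) := projT2 (cid (lim_ex i)).
have gl n i : nrm (g n i - l i) <= 2 * q ^+ n.
  apply/ler_addgt0Pl => e /(lP i)[N hN].
  have := hN _ (leq_maxl N n); have := gg n (maxn N n) i (leq_maxr _ _).
  by have := nrm_dist (g n i) (g (maxn N n) i) (l i); lra.
have small (e : R) : 0 < e -> exists n, q ^+ n < e.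
  move=> e0; have /cvgrPdist_lt/(_ e e0)[N _ hN] :
      (geometric 1 q : nat -> R) @ \oo --> (0 : R).
    by apply: cvg_geometric; rewrite ger0_norm /q; lra.
  exists N; have := hN N (leqnn N); rewrite /= sub0r normrN mul1r ger0_norm//.
  exact: ltW.
have Sl : fam_mem S l.
  apply: fam_closed => e e0; have [|n hn] := small (e / 2); first by rewrite divr_gt0.
  by exists (g n) => [|i]; [exact: fam_funP | have := gl n i; lra].
have bl : bounded_family l.
  exists (nrm (g 0%N) + 2) => i; have := gl 0%N i; have := le_nrm_fam (g 0%N) i.
  by have := nrm_le_dist (l i) (g 0%N i); rewrite nrmBC expr0; lra.
apply/cvg_ex; exists (Family Sl bl) => P /nbhs_nrmP[e e0 hP].
have [|n hn] := small (e / 4); first by rewrite divr_gt0.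
apply: filterS (gP n) => f fn; apply: hP.
have h : nrm (g n - Family Sl bl) <= 2 * q ^+ n.
  by apply: nrm_fam_le => i; rewrite fam_addE fam_oppE; exact: gl.
have := nrm_dist f (g n) (Family Sl bl); rewrite (nrmBC f (g n)).
by move: fn => /=; lra.
Qed.

HB.instance Definition _ := Uniform_isComplete.Build bfamily fam_complete.

Fact fam_mulA : associative fam_mul.
Proof. by move=> f g h; apply: bfamilyP => i /=; rewrite mulrA. Qed.
Fact fam_mul1x : left_id fam_one fam_mul.
Proof. by move=> f; apply: bfamilyP => i /=; rewrite mul1r. Qed.
Fact fam_mulx1 : right_id fam_one fam_mul.
Proof. by move=> f; apply: bfamilyP => i /=; rewrite mulr1. Qed.
Fact fam_mulI (f g : bfamily) i : fam_mul f g i = f i * g i.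
Proof. by []. Qed.
Fact fam_mulDl : left_distributive fam_mul +%R.
Proof.
by move=> f g h; apply: bfamilyP => i; rewrite fam_addE !fam_mulI fam_addE mulrDl.
Qed.
Fact fam_mulDr : right_distributive fam_mul +%R.
Proof.
by move=> f g h; apply: bfamilyP => i; rewrite fam_addE !fam_mulI fam_addE mulrDr.
Qed.
Fact fam_one_neq0 : fam_one != 0.
Proof.
apply/eqP => /(congr1 (fun f : bfamily => f (fam_point S))) /eqP.
by rewrite fam_zeroE /= oner_eq0.
Qed.
Fact fam_scaleAl (c : R[i]) f g : c *: fam_mul f g = fam_mul (c *: f) g.
Proof. by apply: bfamilyP => i; rewrite fam_scaleE !fam_mulI fam_scaleE scalerAl. Qed.
Fact fam_scaleAr (c : R[i]) f g : c *: fam_mul f g = fam_mul f (c *: g).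
Proof. by apply: bfamilyP => i; rewrite fam_scaleE !fam_mulI fam_scaleE scalerAr. Qed.
Fact fam_adjI (f : bfamily) i : fam_adj f i = star (f i).
Proof. by []. Qed.
Fact fam_adjK : involutive fam_adj.
Proof. by move=> f; apply: bfamilyP => i /=; rewrite starK. Qed.
Fact fam_adjD : {morph fam_adj : f g / f + g}.
Proof. by move=> f g; apply: bfamilyP => i; rewrite fam_addE !fam_adjI fam_addE starD. Qed.
Fact fam_adjZ (c : R[i]) f : fam_adj (c *: f) = c^* *: fam_adj f.
Proof. by apply: bfamilyP => i; rewrite fam_scaleE !fam_adjI fam_scaleE starZ. Qed.
Fact fam_adjM f g : fam_adj (fam_mul f g) = fam_mul (fam_adj g) (fam_adj f).
Proof. by apply: bfamilyP => i /=; rewrite starM. Qed.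
Fact fam_norm_mul (f g : bfamily) : `|fam_mul f g| <= `|f| * `|g|.
Proof.
rewrite !nrmE -rmorphM lecR; apply: nrm_fam_le => i; apply: le_trans (nrmM _ _) _.
by apply: ler_pM; rewrite ?nrm_ge0 ?le_nrm_fam.
Qed.
Fact fam_norm_star (f : bfamily) : `|fam_mul (fam_adj f) f| = `|f| ^+ 2.
Proof.
rewrite !nrmE -rmorphXn /=; congr (_%:C%C); apply/le_anti/andP; split.
  apply: nrm_fam_le => i; rewrite fam_mulI fam_adjI nrm_starM.
  by rewrite ler_pXn2r ?nnegrE ?nrm_ge0 ?le_nrm_fam.
rewrite -[leRHS]sqr_sqrtr ?nrm_ge0// ler_pXn2r ?nnegrE ?nrm_ge0 ?sqrtr_ge0//.
apply: nrm_fam_le => i; rewrite -(ler_pXn2r (_ : 0 < 2)%N) ?nnegrE ?nrm_ge0 ?sqrtr_ge0//.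
rewrite sqr_sqrtr ?nrm_ge0// -nrm_starM; exact: (le_nrm_fam (fam_mul (fam_adj f) f)).
Qed.

HB.instance Definition _ := @isCStarAlgebra.Build R bfamily fam_one fam_mul fam_adj
  fam_mulA fam_mul1x fam_mulx1 fam_mulDl fam_mulDr fam_one_neq0 fam_scaleAl
  fam_scaleAr fam_adjK fam_adjD fam_adjZ fam_adjM fam_norm_mul fam_norm_star.

Definition family_algebra : cstarAlgType R := bfamily.

Implicit Types f g : family_algebra.

Lemma fam_mulE f g i : (f * g) i = f i * g i.
Proof. by []. Qed.
Lemma fam_starE f i : (star f) i = star (f i).
Proof. by []. Qed.
End BoundedFamilies.

Section ToFamily.
Variables (R : realType) (I : Type) (A : I -> cstarAlgType R) (B : cstarAlgType R).
Variables (S : family_subalgebra A) (f : forall i, {lrmorphism B -> A i}).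
Hypothesis fS : forall b, fam_mem S (fun i => f i b).
Hypothesis fb : forall b, bounded_family (fun i => f i b).

Definition to_family b : family_algebra S := Family (fS b) (fb b).

Fact to_family_linear : linear to_family.
Proof.
by move=> c x y; apply: bfamilyP => i; rewrite fam_addE fam_scaleE /= linearP.
Qed.
Fact to_family_monoid : monoid_morphism to_family.
Proof.
by split=> [|x y]; apply: bfamilyP => i /=; rewrite ?rmorph1 ?rmorphM.
Qed.

HB.instance Definition _ :=
  GRing.isLinear.Build R[i] B (family_algebra S) _ to_family to_family_linear.
HB.instance Definition _ :=
  GRing.isMonoidMorphism.Build B (family_algebra S) to_family to_family_monoid.

Lemma to_family_star : (forall i, star_hom (f i)) -> star_hom to_family.
Proof. by move=> sf b; apply: bfamilyP => i /=; rewrite sf. Qed.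

End ToFamily.

Section Eval.
Variables (R : realType) (I : Type) (A : I -> cstarAlgType R) (S : family_subalgebra A).
Variable i : I.

Definition fam_eval (f : family_algebra S) : A i := f i.

Fact fam_eval_linear : linear fam_eval.
Proof. by move=> c f g; rewrite /fam_eval fam_addE fam_scaleE. Qed.
Fact fam_eval_monoid : monoid_morphism fam_eval.
Proof. by split. Qed.

HB.instance Definition _ := GRing.isLinear.Build R[i] (family_algebra S) (A i) _ fam_eval fam_eval_linear.
HB.instance Definition _ := GRing.isMonoidMorphism.Build (family_algebra S) (A i) fam_eval fam_eval_monoid.

End Eval.

Section Subalgebra.
Variables (R : realType) (F : cstarAlgType R) (S : set F).
Hypothesis cS : cstar_subalgebra S.

Let mem (f : unit -> F) := S (f tt).

Fact sub1 : mem (fun=> 1). Proof. by case: cS. Qed.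
Fact subL (c : R[i]) f g : mem f -> mem g -> mem (fun i => c *: f i + g i).
Proof. by case: cS => _ _ h _ _; exact: h. Qed.
Fact subM f g : mem f -> mem g -> mem (fun i => f i * g i).
Proof. by case: cS => _ _ _ h _; exact: h. Qed.
Fact sub_star f : mem f -> mem (fun i => star (f i)).
Proof. by case: cS => _ _ _ _ h; exact: h. Qed.
Fact sub_closed f : (forall e : R, 0 < e ->
  exists2 g, mem g & forall i, nrm (g i - f i) <= e) -> mem f.
Proof.
case: cS => clS _ _ _ _ h; apply: closed_nrm clS _ => e e0.
have [|g Sg /(_ tt) gf] := h (e / 2); first by rewrite divr_gt0.
by exists (g tt) => //; lra.
Qed.

(** Families over [unit] turn a subset of [F] into a [cstarAlgType], to which universal properties
    can be applied. *)
Definition subalgebra := @FamilySubalgebra R unit (fun=> F) mem tt sub1 subL subM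
  sub_star sub_closed.

End Subalgebra.

Section ImageClosure.
Variables (R : realType) (I : Type) (A : I -> cstarAlgType R) (B : cstarAlgType R).
Variables (p : forall i, {lrmorphism B -> A i}) (i0 : I).
Hypothesis sp : forall i, star_hom (p i).

(** The closure of the image of [B] in the product of the [A i]. With [p] the fibre maps over a
    closed set, it takes the place of the restriction of the algebra to that set; passing to the
    closure dispenses with showing that the image is closed. *)
Let mem (f : forall i, A i) := bounded_family f /\
  forall e : R, 0 < e -> exists b, forall i, nrm (p i b - f i) <= e.

Fact image_bounded b : bounded_family (fun i => p i b).
Proof. by exists (nrm b) => i; exact: star_hom_contractive. Qed.

Fact image_mem b : mem (fun i => p i b).
Proof.
split=> [|e e0]; first exact: image_bounded.
by exists b => i; rewrite subrr nrm0 ltW.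
Qed.

Fact img1 : mem (fun i => 1).
Proof.
have := image_mem 1; congr mem; apply: functional_extensionality_dep => i.
exact: rmorph1.
Qed.

Fact imgL (c : R[i]) f g : mem f -> mem g -> mem (fun i => c *: f i + g i).
Proof.
move=> [bf hf] [bg hg]; split=> [|e e0]; first exact: boundedL.
have c1 : 0 < nrm c + 1 by rewrite ltr_wpDl ?nrm_ge0.
have [|a ha] := hf (e / 2 / (nrm c + 1)); first by rewrite !divr_gt0.
have [|b hb] := hg (e / 2); first by rewrite divr_gt0.
exists (c *: a + b) => i; rewrite linearP.
have -> : c *: p i a + p i b - (c *: f i + g i) = c *: (p i a - f i) + (p i b - g i).
  by rewrite scalerBr; nc.
apply: le_trans (nrmD _ _) _; rewrite nrmZ.
have := ha i; rewrite ler_pdivlMr// mulrDr mulr1 mulrC.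
have := hb i; have := nrm_ge0 (p i a - f i); lra.
Qed.

Fact imgM f g : mem f -> mem g -> mem (fun i => f i * g i).
Proof.
move=> [bf hf] [bg hg]; split=> [|e e0]; first exact: boundedM.
have [[M fM] [N gN]] := (bf, bg).
pose K := `|M| + `|N| + 1; have K0 : 0 < K by rewrite ltr_wpDl ?addr_ge0.
have nM (f' : forall i, A i) (L : R) : (forall i, nrm (f' i) <= L) ->
    forall i, nrm (f' i) <= `|L|.
  by move=> h i; apply: le_trans (h i) (ler_norm _).
pose d := Num.min 1 (e / (2 * K)).
have d0 : 0 < d by rewrite lt_min ltr01 divr_gt0// mulr_gt0.
have d1 : d <= 1 by rewrite ge_min lexx.
have dK : d * (2 * K) <= e by rewrite -ler_pdivlMr ?mulr_gt0// ge_min lexx orbT.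
have [a ha] := hf _ d0; have [b hb] := hg _ d0.
exists (a * b) => i; rewrite rmorphM.
have -> : p i a * p i b - f i * g i = (p i a - f i) * p i b + f i * (p i b - g i).
  by nc.
apply: le_trans (nrmD _ _) _.
have hpb : nrm (p i b) <= K.
  have := nrm_le_dist (p i b) (g i); have := hb i; have := nM _ _ gN i.
  by have := normr_ge0 M; rewrite /K; lra.
have hf' : nrm (f i) <= K by have := nM _ _ fM i; have := normr_ge0 N; rewrite /K; lra.
have h1 : nrm ((p i a - f i) * p i b) <= d * K.
  by apply: le_trans (nrmM _ _) _; apply: ler_pM; rewrite ?nrm_ge0.
have h2 : nrm (f i * (p i b - g i)) <= K * d.
  by apply: le_trans (nrmM _ _) _; apply: ler_pM; rewrite ?nrm_ge0.
lra.
Qed.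

Fact img_star f : mem f -> mem (fun i => star (f i)).
Proof.
move=> [bf hf]; split=> [|e e0]; first exact: bounded_star.
by have [a ha] := hf _ e0; exists (star a) => i; rewrite sp -starB nrm_star.
Qed.

Fact img_closed f : (forall e : R, 0 < e ->
  exists2 g, mem g & forall i, nrm (g i - f i) <= e) -> mem f.
Proof.
move=> h; split=> [|e e0].
  have [g [[M gM] _] gf] := h _ ltr01; exists (M + 1) => i.
  have := nrm_le_dist (f i) (g i); rewrite nrmBC.
  by have := gM i; have := gf i; lra.
have e20 : 0 < e / 2 by rewrite divr_gt0.
have [g [_ hg] gf] := h _ e20; have [b hb] := hg _ e20; exists b => i.
by have := nrm_dist (p i b) (g i) (f i); have := hb i; have := gf i; lra.
Qed.

Definition image_closure := @FamilySubalgebra R I A mem i0 img1 imgL imgM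
  img_star img_closed.

Lemma image_closure_approx (f : family_algebra image_closure) (e : R) : 0 < e ->
  exists b, forall i, nrm (p i b - f i) <= e.
Proof. by move: (fam_funP f) => [_]; exact. Qed.

Definition to_image : {lrmorphism B -> family_algebra image_closure} :=
  @to_family R I A B image_closure p image_mem image_bounded.

Lemma to_imageE b i : to_image b i = p i b.
Proof. by []. Qed.

Lemma to_image_star : star_hom to_image.
Proof. exact: to_family_star. Qed.

End ImageClosure.

(** * Continuity of the algebra and matrix operations *)

Section Continuity.
Variables (R : realType) (A : cstarAlgType R) (T : topologicalType).
Implicit Types (f g : T -> A).

Lemma continuous_add f g : continuous f -> continuous g ->
  continuous (fun x => f x + g x).
Proof. by move=> cf cg x; apply: (@cvgD _ A); [exact: cf | exact: cg]. Qed.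

Lemma continuous_oppr f : continuous f -> continuous (fun x => - f x).
Proof. by move=> cf x; apply: (@cvgN _ A); exact: cf. Qed.

Lemma continuous_sub f g : continuous f -> continuous g ->
  continuous (fun x => f x - g x).
Proof. by move=> cf cg; apply/continuous_add/continuous_oppr. Qed.

Lemma continuous_mul f g : continuous f -> continuous g ->
  continuous (fun x => f x * g x).
Proof.
move=> cf cg x; apply/continuous_nrmP => e e0.
pose K := nrm (f x) + nrm (g x) + 1.
have K0 : 0 < K by rewrite /K; have := nrm_ge0 (f x); have := nrm_ge0 (g x); lra.
pose d := Num.min 1 (e / (3 * K)).
have d0 : 0 < d by rewrite lt_min ltr01 divr_gt0// mulr_gt0.
have d1 : d <= 1 by rewrite ge_min lexx.
have dK : d * (3 * K) <= e by rewrite -ler_pdivlMr ?mulr_gt0// ge_min lexx orbT.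
apply: filterS2 ((continuous_nrmP f x).1 (cf x) _ d0) ((continuous_nrmP g x).1 (cg x) _ d0).
move=> y hf hg.
have -> : f y * g y - f x * g x = (f y - f x) * g y + f x * (g y - g x) by nc.
apply: le_lt_trans (nrmD _ _) _.
have gy : nrm (g y) <= K.
  by have := nrm_le_dist (g y) (g x); have := nrm_ge0 (f x); rewrite /K; lra.
have h1 : nrm ((f y - f x) * g y) <= d * K.
  by apply: le_trans (nrmM _ _) _; apply: ler_pM; rewrite ?nrm_ge0// ltW.
have h2 : nrm (f x * (g y - g x)) <= K * d.
  apply: le_trans (nrmM _ _) _; apply: ler_pM; rewrite ?nrm_ge0 ?(ltW hg)//.
  by rewrite /K; have := nrm_ge0 (g x); lra.
nra.
Qed.

Lemma continuous_star f : continuous f -> continuous (fun x => star (f x)).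
Proof.
move=> cf x; apply/continuous_nrmP => e e0.
apply: filterS ((continuous_nrmP f x).1 (cf x) _ e0) => y.
by rewrite -starB nrm_star.
Qed.

Lemma continuous_scale (c : T -> R) f : continuous c -> continuous f ->
  continuous (fun x => c x *c: f x).
Proof.
move=> cc cf.
have -> : (fun x => c x *c: f x) = (fun x => (c x *c: 1) * f x).
  by apply/funext => x; rewrite -scalerAl mul1r.
apply: continuous_mul => // x; apply/continuous_nrmP => e e0.
have /cvgrPdist_lt/(_ e e0) : c @ x --> c x := cc x.
apply: filterS => y.
by rewrite -scalecBl nrm_scale1 distrC.
Qed.

Lemma continuous_sum I (r : seq I) (F : I -> T -> A) :
  (forall i, continuous (F i)) -> continuous (fun x => \sum_(i <- r) F i x).
Proof.
move=> cF; elim: r => [|i r IH].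
  have -> : (fun x => \sum_(i <- [::]) F i x) = (fun=> 0).
    by apply/funext => x; rewrite big_nil.
  exact: cst_continuous.
have -> : (fun x => \sum_(j <- i :: r) F j x) = (fun x => F i x + \sum_(j <- r) F j x).
  by apply/funext => x; rewrite big_cons.
exact: continuous_add.
Qed.

Lemma continuous_mxP m n (f : T -> 'M[A]_(m, n)) :
  continuous f <-> forall i j, continuous (fun x => f x i j).
Proof.
split=> [cf i j x P Px|cf x P [Q Qx QP]].
  apply: (cf x [set M | P (M i j)]).
  exists (fun i' j' => if (i' == i) && (j' == j) then P else setT) => [i' j'|M h].
    by case: ifP => [/andP[/eqP-> /eqP->]//|_]; exact: filterT.
  by have := h i j; rewrite !eqxx.
have : \forall y \near x, forall i j, Q i j (f y i j).
  apply: filter_forall => i; apply: filter_forall => j; exact: (cf i j x _ (Qx i j)).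
by apply: filterS => y h; apply: QP.
Qed.

Lemma continuous_mulmx m n k (f : T -> 'M[A]_(m, n)) (g : T -> 'M[A]_(n, k)) :
  continuous f -> continuous g -> continuous (fun x => f x *m g x).
Proof.
move=> /continuous_mxP cf /continuous_mxP cg; apply/continuous_mxP => i j.
have -> : (fun x => (f x *m g x) i j) = (fun x => \sum_k f x i k * g x k j).
  by apply/funext => x; rewrite mxE.
by apply: continuous_sum => l; exact: continuous_mul.
Qed.

Lemma continuous_mxstar n (f : T -> 'M[A]_n) :
  continuous f -> continuous (fun x => mxstar (f x)).
Proof.
move=> /continuous_mxP cf; apply/continuous_mxP => i j.
have -> : (fun x => mxstar (f x) i j) = (fun x => star (f x j i)).
  by apply/funext => x; rewrite !mxE.
exact: continuous_star.
Qed.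

End Continuity.

(** * Unitaries in the component of the unit *)

Section Component.
Variables (R : realType) (A : cstarAlgType R).
Implicit Types u v w : A.

Lemma unitary1 : unitary (1 : A).
Proof. by split; rewrite star1 mulr1. Qed.

Lemma unitary_mul u v : unitary u -> unitary v -> unitary (u * v).
Proof.
move=> [u1 u2] [v1 v2]; split; rewrite starM.
  by transitivity (star v * (star u * u) * v); [nc | rewrite u1 mulr1].
by transitivity (u * (v * star v) * star u); [nc | rewrite v2 mulr1].
Qed.

Lemma unitary_star u : unitary u -> unitary (star u).
Proof. by move=> [h1 h2]; split; rewrite starK. Qed.

Inductive cayley_product : A -> Prop :=
| CayleyOne : cayley_product 1
| CayleyMul h w v : star h = h -> is_cayley h w -> cayley_product v ->
    cayley_product (w * v).

Lemma cayley_product_unitary v : cayley_product v -> unitary v.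
Proof.
elim=> [|h w {}v sh hw _ uv]; first exact: unitary1.
by apply: unitary_mul uv; exact: is_cayley_unitary hw.
Qed.

(** v is v w^* times w, and v w^* is a Cayley transform because it is near 1. *)
Lemma cayley_product_near v w : unitary v -> cayley_product w -> nrm (v - w) < 1 ->
  cayley_product v.
Proof.
move=> uv cw vw; have uw := cayley_product_unitary cw; have [w1 w2] := uw.
have [||h sh hc] := @unitary_near1 _ _ (v * star w).
- by apply: unitary_mul => //; exact: unitary_star.
- have -> : v * star w - 1 = (v - w) * star w by rewrite mulrBl w2.
  apply: le_lt_trans (nrmM _ _) _.
  by rewrite (nrm_unitary (unitary_star uw)) mulr1.
have -> : v = v * star w * w by rewrite -mulrA w1 mulr1.
exact: CayleyMul hc cw.
Qed.

(** By [cayley_product_near] the Cayley products contain every unitary at distance less than 1 from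
    one of them, hence are open and closed in the unitary group. *)
Lemma connected_component_cayley u :
  connected_component (@unitary R A) 1 u -> cayley_product u.
Proof.
move=> [C [C1 CU cC] Cu].
pose nb (G : set A) := [set v | exists2 w, G w & nrm (v - w) < 1].
have onb G : open (nb G).
  apply: openP_nrm => v [w Gw vw]; exists (1 - nrm (v - w)); first by rewrite subr_gt0.
  by move=> v' v'v; exists w => //; have := nrm_dist v' v w; lra.
have nbs (G : set A) v : G v -> nb G v by move=> Gv; exists v; rewrite ?subrr ?nrm0.
suff eqC : C `&` cayley_product = C by move: Cu; rewrite -eqC => -[].
apply: cC.
- by exists 1; split=> //; exact: CayleyOne.
- exists (nb cayley_product) => //; apply/seteqP; split=> v [Cv h]; split=> //.
    exact: nbs.
  by case: h => w cw vw; exact: cayley_product_near (CU _ Cv) cw vw.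
(* Closedness comes from the same distance argument, applied to the complement. *)
- exists (~` nb (C `&` ~` cayley_product)); first exact/open_closedC.
  apply/seteqP; split=> v [Cv h]; split=> //.
    move=> [w [Cw nw] vw]; apply: nw; apply: cayley_product_near h _; first exact: CU.
    by rewrite nrmBC.
  by apply: contrapT => nh; apply: h; apply: nbs; split.
Qed.

Lemma homotopic_component v : unitary v -> homotopic_in R (@unitary R A) v 1 ->
  connected_component (@unitary R A) 1 v.
Proof.
move=> uv [g [cg gU g0 g1]]; exists (g @` `[0, 1]%classic).
  split.
  - by exists 1 => //=; rewrite in_itv /= ler01 lexx.
  - by move=> _ [t t01 <-]; apply: gU.
  - by apply: connected_continuous_connected cg; exact: segment_connected.
by exists 0 => //=; rewrite in_itv /= ler01 lexx.
Qed.

End Component.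

(** * Existence of the unitary [u] *)

Section ExistsUnitary.
Variables (R : realType) (A : cstarAlgType R).
Implicit Types a b c d s t u : A.

(* The partial isometry from 1 - s1 s1^* to 1 - t1 t1^* comes from absorbing each
   of these two projections into the other. *)
Definition exchange s1 s2 t1 t2 :=
  t1 * star s1 + t2 * (1 - s1 * star s1 - s2 * star s2) +
  (1 - t1 * star t1 - t2 * star t2) * star s2 +
  t2 * s1 * star t2 * star s2 + t2 * s2 * star t1 * star s2.

Lemma exchange_star s1 s2 t1 t2 : star (exchange s1 s2 t1 t2) = exchange t1 t2 s1 s2.
Proof.
by rewrite /exchange !(starD, starN, starM, starK, star1); nc.
Qed.

Lemma exchange_isometry s1 s2 t1 t2 :
  isometry s1 -> isometry s2 -> star s1 * s2 = 0 ->
  isometry t1 -> isometry t2 -> star t1 * t2 = 0 ->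
  star (exchange s1 s2 t1 t2) * exchange s1 s2 t1 t2 = 1.
Proof.
move=> i1 i2 s12 k1 k2 t12.
have s21 : star s2 * s1 = 0 by rewrite -[LHS]starK starM starK s12 star0.
have t21 : star t2 * t1 = 0 by rewrite -[LHS]starK starM starK t12 star0.
by rewrite exchange_star /exchange; nc i1 i2 s12 s21 k1 k2 t12 t21.
Qed.

Lemma exchange_mul s1 s2 t1 t2 : isometry s1 -> isometry s2 -> star s1 * s2 = 0 ->
  exchange s1 s2 t1 t2 * s1 = t1.
Proof.
move=> i1 i2 s12; have s21 : star s2 * s1 = 0.
  by rewrite -[LHS]starK starM starK s12 star0.
by rewrite /exchange; nc i1 i2 s12 s21.
Qed.

(** The shape [1 + 1] is that of [K1_eq] for a unitary stabilised once. *)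
Definition mx2 a b c d : 'M[A]_(1 + 1) := block_mx a%:M b%:M c%:M d%:M.

Lemma mxstar2 a b c d : mxstar (mx2 a b c d) = mx2 (star a) (star c) (star b) (star d).
Proof.
have h (x : A) : (map_mx star (x%:M : 'M[A]_1))^T = (star x)%:M.
  by apply/matrixP => i j; rewrite !mxE !ord1 !mulr1n.
by rewrite /mxstar /mx2 map_block_mx tr_block_mx !h.
Qed.

Lemma mulmx2 a b c d a' b' c' d' : mx2 a b c d *m mx2 a' b' c' d' =
  mx2 (a * a' + b * c') (a * b' + b * d') (c * a' + d * c') (c * b' + d * d').
Proof. by rewrite /mx2 mulmx_block -!scalar_mxM -!raddfD. Qed.

Lemma mx2_1 : 1%:M = mx2 1 0 0 1.
Proof. by rewrite /mx2 !raddf0 -scalar_mx_block. Qed.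

Lemma continuous_mx2 (T : topologicalType) (a b c d : T -> A) :
  continuous a -> continuous b -> continuous c -> continuous d ->
  continuous (fun x => mx2 (a x) (b x) (c x) (d x)).
Proof.
move=> ca cb cc cd; apply/continuous_mxP => i j; rewrite /mx2.
case: (splitP i) => i' ii'; case: (splitP j) => j' jj'.
- have -> : i = lshift 1 i' by apply: val_inj.
  have -> : j = lshift 1 j' by apply: val_inj.
  suff -> : (fun x => block_mx (a x)%:M (b x)%:M (c x)%:M (d x)%:M
    (lshift 1 i') (lshift 1 j')) = a by [].
  by apply/funext => x; rewrite block_mxEul mxE !ord1 mulr1n.
- have -> : i = lshift 1 i' by apply: val_inj.
  have -> : j = rshift 1 j' by apply: val_inj.
  suff -> : (fun x => block_mx (a x)%:M (b x)%:M (c x)%:M (d x)%:M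
    (lshift 1 i') (rshift 1 j')) = b by [].
  by apply/funext => x; rewrite block_mxEur mxE !ord1 mulr1n.
- have -> : i = rshift 1 i' by apply: val_inj.
  have -> : j = lshift 1 j' by apply: val_inj.
  suff -> : (fun x => block_mx (a x)%:M (b x)%:M (c x)%:M (d x)%:M
    (rshift 1 i') (lshift 1 j')) = c by [].
  by apply/funext => x; rewrite block_mxEdl mxE !ord1 mulr1n.
- have -> : i = rshift 1 i' by apply: val_inj.
  have -> : j = rshift 1 j' by apply: val_inj.
  suff -> : (fun x => block_mx (a x)%:M (b x)%:M (c x)%:M (d x)%:M
    (rshift 1 i') (rshift 1 j')) = d by [].
  by apply/funext => x; rewrite block_mxEdr mxE !ord1 mulr1n.
Qed.

(* For b = (1 - z) / 2 with |z| = 1 this is p + z (1 - p), where 2 p - 1 is the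
   self-adjoint unitary [[1 - s s^*, s], [s^*, 0]]. *)
Definition reflection_path s (b : R[i]) :=
  mx2 (1 - b *: (s * star s)) (b *: s) (b *: star s) (1 - b *: 1).

Lemma reflection_path_star s (b : R[i]) :
  mxstar (reflection_path s b) = reflection_path s b^*.
Proof.
by rewrite /reflection_path mxstar2 !(starB, starZ, starM, starK, star1).
Qed.

Lemma mulZZ (b c : R[i]) a d : (b *: a) * (c *: d) = (b * c) *: (a * d).
Proof. by rewrite -scalerAl -scalerAr scalerA. Qed.

Lemma reflection_path_mul s (b : R[i]) : isometry s -> b + b^* = 2 * b * b^* ->
  reflection_path s b^* *m reflection_path s b = 1%:M.
Proof.
move=> is_ bb; rewrite mx2_1 /reflection_path mulmx2; set b' := b^*.
have {}bb (a : A) : (b' * b) *: a + (b' * b) *: a = b *: a + b' *: a.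
  rewrite -[LHS]scalerDl -[RHS]scalerDl; congr (_ *: _).
  by rewrite [RHS]bb -[LHS]mulr2n -[LHS]mulr_natl [b' * b]mulrC mulrA.
have sss : s * star s * s = s by nc is_.
have sss' : star s * (s * star s) = star s by nc is_.
have ssss : s * star s * (s * star s) = s * star s by nc is_.
set p := s * star s in sss sss' ssss *.
congr mx2.
- transitivity (1 - b *: p - b' *: p + ((b' *: p) * (b *: p) + (b' *: s) * (b *: star s))).
    by nc.
  by rewrite !mulZZ ssss -/p bb; nc.
- transitivity (b *: s + b' *: s - ((b' *: p) * (b *: s) + (b' *: s) * (b *: 1))); first by nc.
  by rewrite !mulZZ sss mulr1 bb; nc.
- transitivity (b *: star s + b' *: star s -
    ((b' *: star s) * (b *: p) + (b' *: 1) * (b *: star s))); first by nc.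
  by rewrite !mulZZ sss' mul1r bb; nc.
- transitivity (1 - b *: 1 - b' *: 1 + ((b' *: star s) * (b *: s) + (b' *: 1) * (b *: 1))).
    by nc.
  by rewrite !mulZZ is_ mulr1 bb; nc.
Qed.

Lemma unitary_mx_mul n (u v : 'M[A]_n) : unitary_mx u -> unitary_mx v ->
  unitary_mx (u *m v).
Proof.
have sM (x y : 'M[A]_n) : mxstar (x *m y) = mxstar y *m mxstar x.
  apply/matrixP => i j; rewrite !mxE star_sum; apply: eq_bigr => k _.
  by rewrite starM !mxE.
move=> [u1 u2] [v1 v2]; split; rewrite sM.
  by rewrite mulmxA -(mulmxA (mxstar v)) u1 mulmx1.
by rewrite mulmxA -(mulmxA u) v2 mulmx1.
Qed.

Lemma unitary_mx_star n (u : 'M[A]_n) : unitary_mx u -> unitary_mx (mxstar u).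
Proof.
have sK : mxstar (mxstar u) = u by apply/matrixP => i j; rewrite !mxE starK.
by move=> [u1 u2]; split; rewrite sK.
Qed.

Lemma reflection_path_unitary s (b : R[i]) : isometry s -> b + b^* = 2 * b * b^* ->
  unitary_mx (reflection_path s b).
Proof.
move=> is_ bb; split; rewrite reflection_path_star; first exact: reflection_path_mul.
rewrite -{1}[b]conjCK; apply: reflection_path_mul => //.
by rewrite conjCK addrC bb mulrAC.
Qed.

(** With 1 - t = cos a this is cos a e^(- i a), that is (1 + e^(- 2 i a)) / 2: the half circle of
    centre 1/2 from 1 to 0, on which 1 - 2 b has modulus 1. *)
Definition circle_path (t : R) : R[i] :=
  ((1 - t) ^+ 2)%:C%C - 'i * ((1 - t) * Num.sqrt (1 - (1 - t) ^+ 2))%:C%C.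

Lemma circle_pathP (t : R) : t \in `[0, 1] ->
  circle_path t + (circle_path t)^* = 2 * circle_path t * (circle_path t)^*.
Proof.
rewrite in_itv /= => /andP[t0 t1].
rewrite /circle_path; set c := 1 - t; set q := Num.sqrt _.
have cq : q ^+ 2 = 1 - c ^+ 2 by rewrite sqr_sqrtr// /c; nra.
set x : R[i] := (c ^+ 2)%:C%C; set y : R[i] := (c * q)%:C%C.
have -> : (x - 'i * y)^* = x - - 'i * y.
  by rewrite rmorphB rmorphM /= conjCi; congr (_ - _ * _); rewrite conj_Creal// complex_real.
have -> : 2 * (x - 'i * y) * (x - - 'i * y) = 2 * (x ^+ 2 - 'i ^+ 2 * y ^+ 2) by ring.
rewrite sqrCi mulN1r opprK.
have -> : x ^+ 2 + y ^+ 2 = x.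
  rewrite /x /y -!rmorphXn -rmorphD; congr (_%:C%C) => /=.
  transitivity (c ^+ 2 * (c ^+ 2 + q ^+ 2)); first by ring.
  by rewrite cq; ring.
ring.
Qed.

Lemma continuous_circle_path (a : A) : continuous (fun t : R => circle_path t *: a).
Proof.
have -> : (fun t : R => circle_path t *: a) =
    (fun t : R => ((1 - t) ^+ 2) *c: a -
       ((1 - t) * Num.sqrt (1 - (1 - t) ^+ 2)) *c: ('i *: a)).
  by apply/funext => t; rewrite /circle_path scalerBl scalerA mulrC.
have c1 : continuous (fun t : R => 1 - t : R).
  by move=> t; apply: cvgB; [exact: cvg_cst | exact: cvg_id].
have c2 : continuous (fun t : R => (1 - t) ^+ 2 : R).
  have -> : (fun t : R => (1 - t) ^+ 2) = (fun t : R => (1 - t) * (1 - t)).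
    by apply/funext => t; rewrite expr2.
  by move=> t; apply: cvgM; exact: c1.
apply: continuous_sub; apply: continuous_scale => //; try exact: cst_continuous.
move=> t; apply: cvgM; first exact: c1.
apply: continuous_comp; last exact: sqrt_continuous.
by apply: cvgB; [exact: cvg_cst | exact: c2].
Qed.

(** Stabilised once, the unitary is the commutator of X = diag(u, 1) and W 0. Since W joins W 0 to 1
    through unitaries, the commutators X W X^* W^* join it to 1. *)
Lemma K1_trivial_commutator u s : unitary u -> isometry s ->
  K1_trivial (u * (1 - s * star s + s * star u * star s)).
Proof.
move=> uu is_; exists 1%N; have [u1 u2] := uu.
pose X := mx2 u 0 0 1.
have uX : unitary_mx X.
  rewrite /X; split; rewrite mxstar2 mulmx2 star1 star0 mx2_1 ?(u1, u2) !(mulr0, mul0r);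
  by rewrite !(addr0, add0r, mulr1).
(* The second factor is the flip at t = 0, so W 0 is [[s, 1 - s s^*], [0, s^*]]; conjugation by it
   carries diag(u^*, 1) to diag(1 - s s^* + s u^* s^*, 1). *)
pose W (t : R) := reflection_path s (circle_path t) *m reflection_path 1 (circle_path t).
have i1 : isometry (1 : A) by rewrite /isometry star1 mulr1.
exists (fun t : R => X *m W t *m mxstar X *m mxstar (W t)); split.
- apply: continuous_subspaceT.
  have cr (v : A) : continuous (fun t : R => reflection_path v (circle_path t)).
    apply: continuous_mx2; try exact: continuous_circle_path;
    by apply: continuous_sub; [exact: cst_continuous | exact: continuous_circle_path].
  have cW : continuous W by apply: continuous_mulmx; exact: cr.
  apply: continuous_mulmx; last exact: continuous_mxstar.
  apply: continuous_mulmx; last exact: cst_continuous.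
  by apply: continuous_mulmx => //; exact: cst_continuous.
- move=> t t01.
  have uW : unitary_mx (W t).
    by apply: unitary_mx_mul; apply: reflection_path_unitary => //; exact: circle_pathP.
  apply: unitary_mx_mul; last exact: unitary_mx_star.
  by apply: unitary_mx_mul; [exact: unitary_mx_mul | exact: unitary_mx_star].
- have -> : W 0 = mx2 s (1 - s * star s) 0 (star s).
    rewrite /W; have -> : circle_path 0 = 1.
      by rewrite /circle_path subr0 expr1n subrr sqrtr0 mulr0 mulr0 subr0.
    rewrite /reflection_path mulmx2 !scale1r star1 mulr1 subrr.
    by congr mx2; nc is_.
  rewrite /X !mxstar2 !mulmx2 -/(mx2 _ _ _ _) star0 star1 starK starB star1 starM starK.
  transitivity (mx2 (u * (1 - s * star s + s * star u * star s)) 0 0 1).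
    by congr mx2; nc is_ u1 u2.
  by rewrite /mx2 !raddf0.
- have -> : W 1 = 1%:M.
    rewrite /W; have -> : circle_path 1 = 0.
      by rewrite /circle_path subrr expr0n mul0r mulr0 subr0.
    by rewrite /reflection_path mulmx2 mx2_1 !scale0r; congr mx2; nc.
  have h1 : mxstar (1%:M : 'M[A]_(1 + 1)) = 1%:M by rewrite mx2_1 mxstar2 star0 star1.
  by rewrite h1 !mulmx1; case: uX => _ ->; rewrite -scalar_mx_block.
Qed.

Lemma exists_admissible_unitary s1 s2 t1 t2 :
  isometry s1 -> isometry s2 -> star s1 * s2 = 0 ->
  isometry t1 -> isometry t2 -> star t1 * t2 = 0 ->
  exists u, [/\ unitary u, K1_trivial u & t1 = u * s1].
Proof.
move=> i1 i2 s12 k1 k2 t12; pose w := exchange s1 s2 t1 t2.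
have uw : unitary w.
  split; first exact: exchange_isometry.
  by have := exchange_isometry k1 k2 t12 i1 i2 s12; rewrite -exchange_star starK.
have ws : w * s1 = t1 by exact: exchange_mul.
have [w1 w2] := uw; clearbody w.
exists (w * (1 - s2 * star s2 + s2 * star w * star s2)); split.
- apply: unitary_mul => //; split;
  rewrite !(starD, starN, starM, starK, star1); nc i2 w1 w2.
- exact: K1_trivial_commutator.
- have s21 : star s2 * s1 = 0 by rewrite -[LHS]starK starM starK s12 star0.
  by rewrite -[LHS]ws; nc s21.
Qed.

End ExistsUnitary.

(** * C(X)-algebras *)

Section HomLemmas.
Variables (R : realType) (A B : cstarAlgType R) (f : {lrmorphism A -> B}).

Lemma hom_mul a b : f (a * b) = f a * f b. Proof. exact: rmorphM. Qed.
Lemma hom_one : f 1 = 1. Proof. exact: rmorph1. Qed.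
Lemma hom_add a b : f (a + b) = f a + f b. Proof. exact: rmorphD. Qed.
Lemma hom_sub a b : f (a - b) = f a - f b. Proof. exact: rmorphB. Qed.

End HomLemmas.

Section FiniteCover.
Variable X : topologicalType.

Lemma compact_seq_cover (U : X -> set X) : compact [set: X] ->
  (forall x, nbhs x (U x)) -> exists s : seq X, forall y, exists2 x, x \in s & U x y.
Proof.
move=> /compact_near_coveringP cX hU.
(* The filter of lists directed by inclusion: what holds eventually along it holds for some finite
   list. *)
pose F : set_system (seq X) :=
  [set S : set (seq X) | exists s0 : seq X, forall s : seq X, {subset s0 <= s} -> S s].
have FF : Filter F.
  split=> [|P Q [s hs] [t ht]|P Q PQ [s hs]]; first by exists [::].
    exists (s ++ t) => r hr; split.
      by apply: hs => x xs; apply: hr; rewrite mem_cat xs.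
    by apply: ht => x xt; apply: hr; rewrite mem_cat xt orbT.
  by exists s => t /hs /PQ.
have [|s hs] := cX _ F (fun s y => exists2 x, x \in s & U x y) FF.
  move=> x _; exists (U x, [set s : seq X | x \in s]) => /=.
    by split=> //; exists [:: x] => s hs; apply: hs; rewrite inE.
  by move=> [y s] /= [Uy xs]; exists x.
by exists s => y; have [x xs Uxy] := hs s (fun _ => id) y I; exists x.
Qed.

End FiniteCover.

Section RealFunctions.
Variables (R : realType) (X : topologicalType).
Implicit Types f g : X -> R.

Lemma continuous_realC f : continuous f -> continuous (fun x => (f x)%:C%C : R[i]^o).
Proof.
move=> cf x; apply/continuous_nrmP => e e0.
have /cvgrPdist_lt/(_ e e0) : f @ x --> f x := cf x.
by apply: filterS => y; rewrite -rmorphB nrm_real distrC.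
Qed.

Lemma continuousD_real f g : continuous f -> continuous g -> continuous (fun x => f x + g x).
Proof. by move=> cf cg x; apply: cvgD; [exact: cf | exact: cg]. Qed.

Lemma continuousB_real f g : continuous f -> continuous g -> continuous (fun x => f x - g x).
Proof. by move=> cf cg x; apply: cvgB; [exact: cf | exact: cg]. Qed.

Lemma continuousM_real f g : continuous f -> continuous g -> continuous (fun x => f x * g x).
Proof. by move=> cf cg x; apply: cvgM; [exact: cf | exact: cg]. Qed.

Lemma continuousX_real f n : continuous f -> continuous (fun x => f x ^+ n).
Proof.
move=> cf; elim: n => [|n IH].
  have -> : (fun x => f x ^+ 0) = (fun=> 1) by apply/funext => x; rewrite expr0.
  exact: cst_continuous.
have -> : (fun x => f x ^+ n.+1) = (fun x => f x * f x ^+ n).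
  by apply/funext => x; rewrite exprS.
exact: continuousM_real.
Qed.

Lemma continuous_sqrt_real f : continuous f -> continuous (fun x => Num.sqrt (f x)).
Proof. by move=> cf x; apply: continuous_comp; [exact: cf | exact: sqrt_continuous]. Qed.

Lemma continuous_max_real f g : continuous f -> continuous g ->
  continuous (fun x => Num.max (f x) (g x)).
Proof. by move=> cf cg x; apply: continuous_max; [exact: cf | exact: cg]. Qed.

Lemma continuous_sum_real I (r : seq I) (F : I -> X -> R) :
  (forall i, continuous (F i)) -> continuous (fun x => \sum_(i <- r) F i x).
Proof.
move=> cF; elim: r => [|i r IH].
  have -> : (fun x => \sum_(i <- [::]) F i x) = (fun=> 0).
    by apply/funext => x; rewrite big_nil.
  exact: cst_continuous.
have -> : (fun x => \sum_(j <- i :: r) F j x) = (fun x => F i x + \sum_(j <- r) F j x).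
  by apply/funext => x; rewrite big_cons.
exact: continuousD_real.
Qed.

Lemma open_lt_real f (c : R) : continuous f -> open [set x | f x < c].
Proof.
move=> cf; apply: (@open_comp _ _ f [set y | y < c]); last exact: open_lt.
by move=> x _; exact: cf.
Qed.

Lemma closed_le_real f (c : R) : continuous f -> closed [set x | f x <= c].
Proof.
move=> cf; apply: (@preimage_closed _ _ f [set y | y <= c]); last exact: closed_le.
by move=> x _; exact: cf.
Qed.

Lemma urysohn_function (C0 C1 : set X) : compact [set: X] -> hausdorff_space X ->
  closed C0 -> closed C1 -> C0 `&` C1 = set0 ->
  exists h : X -> R, [/\ continuous h, forall x, 0 <= h x <= 1,
    forall x, C0 x -> h x = 0 & forall x, C1 x -> h x = 1].
Proof.
move=> cX hX c0 c1 c01.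
have nX : normal_space X by exact: compact_normal.
have /(@uniform_separatorP _ R) [h [ch h01 h0 h1]] : uniform_separator C0 C1.
  exact: ((@normal_separatorP R X).1 nX).
exists h; split=> // x.
- by have := h01 (h x); rewrite /= in_itv /=; apply; exists x.
- by move=> Cx; apply: h0; exists x.
- by move=> Cx; apply: h1; exists x.
Qed.

(** Bernoulli: if t / r = 1 + d with d > 0, the powers (1 + d)^(2^j) exceed every K. *)
Lemma pow_le_bound (t r K : R) : 0 <= t -> 0 < r ->
  (forall j, t ^+ (2 ^ j) <= K * r ^+ (2 ^ j)) -> t <= r.
Proof.
move=> t0 r0 h; rewrite leNgt; apply/negP => rt.
pose d := t / r - 1; have d0 : 0 < d by rewrite subr_gt0 ltr_pdivlMr// mul1r.
have bern n : 1 + d *+ n <= (1 + d) ^+ n.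
  elim: n => [|n IH]; first by rewrite mulr0n addr0 expr0.
  rewrite exprS mulrSr; have := mulrn_wge0 n (ltW d0); nra.
have hd n : (1 + d) ^+ (2 ^ n) <= K.
  have -> : 1 + d = t / r by rewrite /d addrC subrK.
  by rewrite expr_div_n ler_pdivrMr ?exprn_gt0.
have [n hn] : exists n, K < d *+ n.
  have := archi_boundP (ltW (_ : 0 < `|K| / d + 1)).
  rewrite ltr_wpDl ?divr_ge0 ?(ltW d0)// => /(_ isT) hn.
  exists (Num.bound (`|K| / d + 1)); rewrite -mulr_natr mulrC.
  apply: le_lt_trans (ler_norm K) _; rewrite -ltr_pdivrMr//.
  by apply: lt_trans hn; rewrite ltrDl.
have n2 : (n <= 2 ^ n)%N by exact: ltnW (ltn_expl n _).
have := hd n; have := bern (2 ^ n)%N; have : d *+ n <= d *+ (2 ^ n).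
  by rewrite ler_pMn2l.
lra.
Qed.

End RealFunctions.

Section CentralFunctions.
Variables (R : realType) (X : topologicalType) (A : cstarAlgType R).
Variable theta : continuousType X R[i]^o -> A.
Hypothesis cxA : CX_algebra theta.
Implicit Types (f g : X -> R).

Lemma thetaE (g h : continuousType X R[i]^o) : (forall x, g x = h x) -> theta g = theta h.
Proof.
by move=> gh; congr theta; apply/continuousEP.
Qed.

(* Total in f, so that terms carry no continuity proofs. *)
Definition central f : A :=
  if pselect (continuous f) is left cf then theta (mkcts (continuous_realC cf)) else 0.

Lemma centralP f (g : continuousType X R[i]^o) : continuous f ->
  (forall x, g x = (f x)%:C%C) -> central f = theta g.
Proof.
move=> cf gf; rewrite /central; case: pselect => // cf'.
by apply: thetaE => x; rewrite gf.
Qed.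

Lemma central1 : central (fun=> 1) = 1.
Proof.
have c1 : continuous (fun _ : X => 1 : R) by exact: cst_continuous.
rewrite (centralP (g := mkcts (continuous_realC c1)))//.
by case: cxA => _ _ h _ _; exact: h.
Qed.

Lemma centralD f g : continuous f -> continuous g ->
  central (fun x => f x + g x) = central f + central g.
Proof.
move=> cf cg; have cfg := continuousD_real cf cg.
rewrite (centralP (g := mkcts (continuous_realC cfg)))//.
rewrite (centralP (g := mkcts (continuous_realC cf)))//.
rewrite (centralP (g := mkcts (continuous_realC cg)))//.
case: cxA => h _ _ _ _; rewrite (h 1 (mkcts (continuous_realC cf))
   (mkcts (continuous_realC cg))) ?scale1r// => x /=.
by rewrite /mkcts rmorphD mul1r.
Qed.

Lemma centralM f g : continuous f -> continuous g ->
  central (fun x => f x * g x) = central f * central g.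
Proof.
move=> cf cg; have cfg := continuousM_real cf cg.
rewrite (centralP (g := mkcts (continuous_realC cfg)))//.
rewrite (centralP (g := mkcts (continuous_realC cf)))//.
rewrite (centralP (g := mkcts (continuous_realC cg)))//.
by case: cxA => _ h _ _ _; apply: h => x /=; rewrite /mkcts rmorphM.
Qed.

Lemma central_star f : continuous f -> star (central f) = central f.
Proof.
move=> cf; rewrite (centralP (g := mkcts (continuous_realC cf)))//.
case: cxA => _ _ _ h _; rewrite -(h (mkcts (continuous_realC cf)) (mkcts (continuous_realC cf)))// => x.
by rewrite /= /mkcts conj_Creal// complex_real.
Qed.

Lemma central_comm f a : continuous f -> central f * a = a * central f.
Proof.
by move=> cf; rewrite (centralP (g := mkcts (continuous_realC cf)))//; case: cxA.
Qed.

Lemma central_cst (r : R) : central (fun=> r) = r *c: 1.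
Proof.
have cr (q : R) : continuous (fun _ : X => q) by exact: cst_continuous.
rewrite (centralP (g := mkcts (continuous_realC (cr r))))//.
have z0 : theta (mkcts (continuous_realC (cr 0))) = 0.
  case: cxA => h _ _ _ _; have := h (-1) (mkcts (continuous_realC (cr 0)))
    (mkcts (continuous_realC (cr 0))) (mkcts (continuous_realC (cr 0))).
  rewrite scaleN1r addNr; apply => x; by rewrite /= /mkcts mulN1r addNr.
case: cxA => h _ h1 _ _; rewrite (h r%:C%C (mkcts (continuous_realC (cr 1)))
    (mkcts (continuous_realC (cr 0)))) ?z0 ?addr0 ?h1//.
by move=> x; rewrite /= /mkcts mulr1 addr0.
Qed.

Lemma centralZ (r : R) f : continuous f -> central (fun x => r * f x) = r *c: central f.
Proof.
move=> cf; rewrite (centralM (f := fun=> r))//; last exact: cst_continuous.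
by rewrite central_cst -scalerAl mul1r.
Qed.

Lemma centralB f g : continuous f -> continuous g ->
  central (fun x => f x - g x) = central f - central g.
Proof.
move=> cf cg; have -> : (fun x => f x - g x) = (fun x => f x + (-1) * g x).
  by apply/funext => x; rewrite mulN1r.
have cN : continuous (fun x => -1 * g x) by apply: continuousM_real => //; exact: cst_continuous.
by rewrite centralD// centralZ// rmorphN1 scaleN1r.
Qed.

Lemma centralX f n : continuous f -> central (fun x => f x ^+ n) = central f ^+ n.
Proof.
move=> cf; elim: n => [|n IH].
  rewrite expr0 -central1; congr central; by apply/funext => x; rewrite expr0.
rewrite exprS -IH -centralM//; last exact: continuousX_real.
by congr central; apply/funext => x; rewrite exprS.
Qed.

Lemma central_sum I (r : seq I) (F : I -> X -> R) : (forall i, continuous (F i)) ->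
  central (fun x => \sum_(i <- r) F i x) = \sum_(i <- r) central (F i).
Proof.
move=> cF; elim: r => [|i r IH].
  rewrite big_nil -(scale0r (1 : A)) -(central_cst 0); congr central.
  by apply/funext => x; rewrite big_nil.
rewrite big_cons -IH -centralD//; last exact: continuous_sum_real.
by congr central; apply/funext => x; rewrite big_cons.
Qed.

(** [central f] is the real part of z = f + i sqrt (K^2 - f^2), and z^* z = K^2. *)
Lemma nrm_central f (K : R) : continuous f -> (forall x, `|f x| <= K) ->
  0 <= K -> nrm (central f) <= K.
Proof.
move=> cf fK K0; pose q x := Num.sqrt (K ^+ 2 - f x * f x).
have cff : continuous (fun x => f x * f x) by exact: continuousM_real.
have cK : continuous (fun x => K ^+ 2 - f x * f x).
  by apply: continuousB_real => //; exact: cst_continuous.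
have cq : continuous q by exact: continuous_sqrt_real.
pose a := central f; pose b := central q; pose z := a + 'i *: b.
have sa : star a = a by exact: central_star.
have sb : star b = b by exact: central_star.
have ab : a * b = b * a by exact: central_comm.
have sz : star z = a - 'i *: b by rewrite starD starZ sa sb conjCi scaleNr.
have zz : star z * z = K ^+ 2 *c: 1.
  rewrite sz; transitivity (a * a - ('i *: b) * ('i *: b) + (a * ('i *: b) - ('i *: b) * a)).
    by rewrite /z; nc.
  rewrite -!scalerAl -!scalerAr ab subrr addr0 scalerA mulCii scaleN1r opprK.
  rewrite -centralM// -(centralM cq cq) -centralD//; last exact: continuousM_real.
  rewrite -central_cst; congr central; apply/funext => x.
  have -> : q x * q x = K ^+ 2 - f x * f x; last by rewrite addrC subrK.
  rewrite -expr2 sqr_sqrtr//.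
  by rewrite subr_ge0 -expr2 -[f x ^+ 2]real_normK ?num_real// ler_pXn2r ?nnegrE.
have nz : nrm z <= K.
  by rewrite -(ler_pXn2r (_ : 0 < 2)%N) ?nnegrE ?nrm_ge0// -nrm_starM zz nrm_scale1 ger0_norm ?exprn_ge0.
have -> : central f = 2^-1 *c: (z + star z).
  by rewrite sz /z -/a -[LHS]half2; congr (_ *: _); nc.
rewrite nrmZr ger0_norm ?invr_ge0//; have := nrmD z (star z); rewrite nrm_star; lra.
Qed.

(** The function g is complex-valued; the C*-identity leads back to the real function f^2 |g|^2. *)
Lemma nrm_central_theta f (g : continuousType X R[i]^o) (K : R) : continuous f ->
  (forall x, `|f x| * nrm (g x : R[i]) <= K) -> 0 <= K -> nrm (central f * theta g) <= K.
Proof.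
move=> cf fg K0.
have cn : continuous (fun x => nrm (g x : R[i]) : R).
  by move=> x; apply: (continuous_comp (@cts_fun _ _ g x)); exact: (@nrm_continuous R R[i]^o).
have cnn : continuous (fun x => nrm (g x : R[i]) * nrm (g x : R[i]) : R).
  exact: continuousM_real.
have cc : continuous (fun x => (g x : R[i])^* : R[i]^o).
  move=> x; apply/continuous_nrmP => e e0.
  have := (continuous_nrmP _ _).1 (@cts_fun _ _ g x) _ e0; apply: filterS => y.
  by rewrite -rmorphB nrm_conjc.
have tt : star (theta g) * theta g = central (fun x => nrm (g x : R[i]) * nrm (g x : R[i])).
  rewrite (centralP (g := mkcts (continuous_realC cnn)))//.
  case: cxA => _ hM _ hS _; rewrite -(hS g (mkcts cc))//; apply/esym/hM => x.
  by rewrite /= /mkcts rmorphM /= -nrmE -expr2 normCK mulrC.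
have cff : continuous (fun x => f x * f x) by exact: continuousM_real.
rewrite -(ler_pXn2r (_ : 0 < 2)%N) ?nnegrE ?nrm_ge0// -nrm_starM.
have -> : star (central f * theta g) * (central f * theta g) =
    central (fun x => f x * f x * (nrm (g x : R[i]) * nrm (g x : R[i]))).
  rewrite centralM// centralM// -tt starM central_star//.
  rewrite -(central_comm (star (theta g)) cf) !mulrA.
  by rewrite -(mulrA (central f) (star (theta g))) -(central_comm (star (theta g)) cf) !mulrA.
apply: nrm_central; rewrite ?exprn_ge0//; first exact: continuousM_real.
move=> x; rewrite mulrACA normrM -expr2 ler_pXn2r ?nnegrE// normrM.
by rewrite (ger0_norm (nrm_ge0 _)).
Qed.

End CentralFunctions.

(** * Fibre norms and the norm of a C(X)-algebra *)

Section Fibres.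
Variables (R : realType) (X : topologicalType) (A : cstarAlgType R).
Variable theta : continuousType X R[i]^o -> A.
Variables (Ax : X -> cstarAlgType R) (p : forall x, {lrmorphism A -> Ax x}).
Hypothesis cxA : CX_algebra theta.
Hypothesis pA : forall x, is_fibre theta x (p x).
Local Notation central := (central theta).

Lemma fibre_star x : star_hom (p x). Proof. by case: (pA x). Qed.

Lemma fibre_surj x b : exists a, p x a = b. Proof. by case: (pA x). Qed.

Lemma fibre_ker x a : p x a = 0 <-> fibre_ideal theta x a. Proof. by case: (pA x). Qed.

Lemma nrm_fibre_starM x a : nrm (p x (star a * a)) = nrm (p x a) ^+ 2.
Proof. by rewrite hom_mul fibre_star nrm_starM. Qed.

Lemma fibre_central x (f : X -> R) : continuous f -> p x (central f) = f x *c: 1.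
Proof.
move=> cf.
have c1 : continuous (fun _ : X => f x) by exact: cst_continuous.
have cd := continuousB_real cf c1.
suff : p x (central (fun y => f y - f x)) = 0.
  rewrite (centralB cxA)// (central_cst cxA) hom_sub => /eqP; rewrite subr_eq0 => /eqP ->.
  by rewrite (hom_scale (p x)) hom_one.
apply/fibre_ker; apply: subset_closure.
exists 1%N, (fun=> 1), (fun=> central (fun y => f y - f x)); split; last first.
  by rewrite big_ord1 scale1r.
move=> _; exists (mkcts (continuous_realC cd)), 1; split.
  by rewrite /= /mkcts subrr.
by rewrite mulr1; exact: centralP.
Qed.

Definition bump x (f : X -> R) :=
  [/\ continuous f, forall y, 0 <= f y <= 1 & f x = 1].

Lemma bumpM x f g : bump x f -> bump x g -> bump x (fun y => f y * g y).
Proof.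
move=> [cf f01 fx] [cg g01 gx]; split; first exact: continuousM_real.
  move=> y; have /andP[f0 f1] := f01 y; have /andP[g0 g1] := g01 y.
  by rewrite mulr_ge0//= mulr_ile1.
by rewrite fx gx mulr1.
Qed.

Lemma nrm_bump x f : bump x f -> nrm (central f) <= 1.
Proof.
move=> [cf f01 fx]; apply: nrm_central => // y; have /andP[f0 f1] := f01 y.
by rewrite ger0_norm.
Qed.

Lemma nrm_bump_mul x f a : bump x f -> nrm (central f * a) <= nrm a.
Proof.
move=> bf; apply: le_trans (nrmM _ _) _.
by rewrite ler_piMl ?nrm_ge0 ?(nrm_bump bf).
Qed.

(** The property is stable under sums, by multiplying bumps, and under closure, as bumps are
    contractive. For a generator [theta g * b] with g x = 0 the bump is cut off where |g| is not
    small. *)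
Lemma fibre_ideal_bump x a (d : R) : p x a = 0 -> 0 < d ->
  exists2 f, bump x f & nrm (central f * a) <= d.
Proof.
move=> /fibre_ker ia d0.
pose P b := forall d : R, 0 < d -> exists2 f, bump x f & nrm (central f * b) <= d.
have P0 : P 0.
  move=> e e0; exists (fun=> 1).
    by split=> //; [exact: cst_continuous | rewrite ler01 lexx].
  by rewrite mulr0 nrm0 ltW.
have PD b c : P b -> P c -> P (b + c).
  move=> hb hc e e0; have e20 : 0 < e / 2 by rewrite divr_gt0.
  have [f bf fb] := hb _ e20; have [g bg gc] := hc _ e20.
  have [[cf _ _] [cg _ _]] := (bf, bg).
  exists (fun y => f y * g y); first exact: bumpM.
  rewrite (centralM cxA)// mulrDr; apply: le_trans (nrmD _ _) _.
  have h1 : nrm (central f * central g * b) <= e / 2.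
    apply: le_trans fb; rewrite (central_comm cxA _ cf) -mulrA.
    exact: nrm_bump_mul bg.
  have h2 : nrm (central f * central g * c) <= e / 2.
    by rewrite -mulrA; apply: le_trans gc; exact: nrm_bump_mul bf.
  lra.
have PZ (z : R[i]) (g : continuousType X R[i]^o) b : g x = 0 -> P (z *: (theta g * b)).
  (* The bump f vanishes where K |g| >= 1, so |f g| <= 1 / K; K exceeds [nrm z * nrm b / e], and the
     added 1 keeps it positive. *)
  move=> gx e e0; pose K := (nrm z * nrm b + 1) / e.
  have K0 : 0 < K by rewrite divr_gt0// ltr_wpDl// mulr_ge0 ?nrm_ge0.
  have cn : continuous (fun y => nrm (g y : R[i]) : R).
    by move=> y; apply: (continuous_comp (@cts_fun _ _ g y)); exact: (@nrm_continuous R R[i]^o).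
  pose f y := Num.max 0 (1 - K * nrm (g y : R[i])).
  have cf : continuous f.
    apply: continuous_max_real; first exact: cst_continuous.
    apply: continuousB_real; first exact: cst_continuous.
    by apply: continuousM_real => //; exact: cst_continuous.
  have f01 y : 0 <= f y <= 1.
    rewrite /f le_max lexx /= ge_max ler01 /= lerBlDr lerDl.
    by rewrite mulr_ge0 ?nrm_ge0 ?(ltW K0).
  exists f; first by split=> //; rewrite /f gx nrm0 mulr0 subr0; apply: max_r.
  rewrite -scalerAr nrmZ mulrA.
  have h : nrm (central f * theta g) <= K^-1.
    apply: nrm_central_theta => //; last by rewrite invr_ge0 ltW.
    move=> y; have /andP[f0 f1] := f01 y; rewrite ger0_norm//.
    have [gy|gy] := lerP (K * nrm (g y : R[i])) 1.
      have h : nrm (g y : R[i]) <= K^-1 by rewrite -[K^-1]mul1r ler_pdivlMr// mulrC.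
      by apply: le_trans h; rewrite ler_piMl ?nrm_ge0.
    by rewrite /f max_l ?mul0r ?invr_ge0 ?(ltW K0)//; lra.
  apply: le_trans (_ : nrm z * (K^-1 * nrm b) <= e).
    apply: ler_wpM2l; first exact: nrm_ge0.
    by apply: le_trans (nrmM _ _) _; apply: ler_wpM2r => //; exact: nrm_ge0.
  have -> : nrm z * (K^-1 * nrm b) = nrm z * nrm b / K by field; rewrite gt_eqF.
  rewrite ler_pdivrMr//; have -> : e * K = nrm z * nrm b + 1 by rewrite /K; field; rewrite gt_eqF.
  by rewrite lerDl.
have d20 : 0 < d / 2 by rewrite divr_gt0.
have [b [n [c [v [hv bE]]]] ba] := (closure_nrmP _ _).1 ia _ d20.
have Pb : P b.
  rewrite bE; elim/big_ind: _ => // i _.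
  by have [g [a' [gx ->]]] := hv i; exact: PZ.
have [f bf fb] := Pb _ d20; exists f => //.
have -> : central f * a = central f * b - central f * (b - a) by nc.
apply: le_trans (nrmB _ _) _; have := nrm_bump_mul (b - a) bf; lra.
Qed.

(* Dilate p(a^* a) / c^2 to a unitary of the fibre: a lift of it is unitary up to
   the fibre ideal, hence of norm at most 2 after multiplication by a bump. *)
Lemma fibre_norm_bump x a (c : R) : nrm (p x a) < c ->
  exists2 f, bump x f & nrm (central f * a) <= 2 * c.
Proof.
move=> ac; have c0 : 0 < c by apply: le_lt_trans ac; exact: nrm_ge0.
pose h := (c ^+ 2)^-1 *c: (star a * a).
have c20 : 0 < c ^+ 2 by rewrite exprn_gt0.
have [||w [d [uw hE _ _ _]]] := @dilation _ _ (p x h).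
- by rewrite -fibre_star starZr starM starK.
- rewrite hom_scale nrmZr gtr0_norm ?invr_gt0// mulrC ltr_pdivrMr// mul1r.
  by rewrite nrm_fibre_starM ltr_pXn2r ?nnegrE ?nrm_ge0// ltW.
have [z zw] := fibre_surj w.
pose e1 := star z * z - 1; pose e2 := 2^-1 *c: (z + star z) - h.
have p1 : p x e1 = 0.
  by rewrite hom_sub hom_one hom_mul fibre_star zw; case: uw => -> _; rewrite subrr.
have p2 : p x e2 = 0.
  by rewrite hom_sub hom_scale hom_add fibre_star zw hE subrr.
have [f1 b1 h1] := fibre_ideal_bump p1 ltr01.
have [f2 b2 h2] := fibre_ideal_bump p2 ltr01.
exists (fun y => f1 y * f2 y); first exact: bumpM.
set f := fun y => _; have bf : bump x f by exact: bumpM.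
have [[cf1 _ _] [cf2 _ _]] := (b1, b2); have [cf _ _] := bf.
pose t := central f; have st : star t = t by exact: central_star.
have tE : t = central f1 * central f2 by exact: centralM.
have nt : nrm t <= 1 by exact: nrm_bump bf.
have t1 : nrm (t * e1) <= 1.
  by rewrite tE (central_comm cxA _ cf1) -mulrA; apply: le_trans h1; exact: nrm_bump_mul b2.
have t2 : nrm (t * e2) <= 1.
  by rewrite tE -mulrA; apply: le_trans h2; exact: nrm_bump_mul b1.
have ct (y : A) : t * y = y * t by exact: central_comm.
have tz : nrm (t * z) <= 3 / 2.
  have : nrm (t * z) ^+ 2 <= 2.
    rewrite -nrm_starM starM st.
    have -> : star z * t * (t * z) = t * (t * e1) + t * t.
      rewrite /e1 -(ct (star z)) !mulrA -(mulrA t (star z) t) -(ct (star z)) ; nc.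
    apply: le_trans (nrmD _ _) _.
    have := nrmM t (t * e1); have := nrmM t t; have := nrm_ge0 t.
    have := nrm_ge0 (t * e1); nra.
  by have := nrm_ge0 (t * z); nra.
have th : nrm (t * h) <= 3.
  have -> : t * h = 2^-1 *c: (t * z + t * star z) - t * e2.
    by rewrite /e2 -mulrDr scalerAr; nc.
  have tz' : nrm (t * star z) = nrm (t * z) by rewrite ct -st -starM nrm_star st.
  apply: le_trans (nrmB _ _) _; rewrite nrmZr ger0_norm ?invr_ge0//.
  have := nrmD (t * z) (t * star z); lra.
rewrite -(ler_pXn2r (_ : 0 < 2)%N) ?nnegrE ?nrm_ge0 ?mulr_ge0 ?(ltW c0)//.
rewrite -nrm_starM starM st.
have -> : star a * t * (t * a) = c ^+ 2 *c: (t * (t * h)).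
  rewrite /h -!scalerAr scalecA mulfV ?gt_eqF// scale1c -(ct (star a)) !mulrA.
  by rewrite -(mulrA t (star a) t) -(ct (star a)) !mulrA.
rewrite nrmZr gtr0_norm// exprMn mulrC; apply: ler_pM; rewrite ?nrm_ge0 ?(ltW c20)//.
apply: le_trans (nrmM _ _) _; have := nrm_ge0 t; have := nrm_ge0 (t * h); nra.
Qed.

Hypothesis cX : compact [set: X].

(** A partition of unity would cost a factor, the number of bumps. For h self-adjoint and m = 2^j,
    h^m is the sum of the (f x h)^m divided by g, the sum of the (f x)^m, and g >= 2^-m; so |h|^m is
    at most [size s] times (4 c')^m, and letting m grow removes [size s]. The factor 2 that remains
    is harmless where the lemma is applied. *)
Lemma sup_fibre_norm a (c : R) : 0 <= c -> (forall x, nrm (p x a) <= c) -> nrm a <= 2 * c.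
Proof.
suff sah (h : A) (c' : R) : star h = h -> 0 < c' -> (forall x, nrm (p x h) < c') ->
    nrm h <= 4 * c'.
  move=> c0 hc; apply/ler_addgt0Pl => e e0.
  have e20 : 0 < c + e / 2 by rewrite ltr_wpDl// divr_gt0.
  have := sah (star a * a) ((c + e / 2) ^+ 2); rewrite starM starK exprn_gt0// nrm_starM.
  move=> /(_ erefl isT) hh.
  have : nrm a ^+ 2 <= 4 * (c + e / 2) ^+ 2.
    apply: hh => x; rewrite nrm_fibre_starM ltr_pXn2r ?nnegrE ?nrm_ge0 ?(ltW e20)//.
    by have := hc x; lra.
  rewrite (_ : 4 * (c + e / 2) ^+ 2 = (2 * c + e) ^+ 2); last by field.
  by rewrite ler_pXn2r ?nnegrE ?nrm_ge0//; lra.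
move=> sh c0 hc.
have fx_ex x : exists f, bump x f /\ nrm (central f * h) <= 2 * c'.
  by have [f bf hf] := fibre_norm_bump (hc x); exists f.
pose f x := projT1 (cid (fx_ex x)).
have fP x : bump x (f x) /\ nrm (central (f x) * h) <= 2 * c' := projT2 (cid (fx_ex x)).
have cf x : continuous (f x) by case: (fP x) => -[].
have f01 x y : 0 <= f x y <= 1 by case: (fP x) => -[].
have [|s hs] := @compact_seq_cover X (fun x => [set y | 2^-1 < f x y]) cX.
  move=> x; apply: open_nbhs_nbhs; split; last first.
    by case: (fP x) => -[_ _ fxx] _; rewrite /mkset fxx; lra.
  have -> : [set y | 2^-1 < f x y] = [set y | - f x y < - 2^-1].
    by apply/seteqP; split => y /=; rewrite ltrN2.
  apply: open_lt_real => y; apply: cvgN; exact: cf.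
apply: (@pow_le_bound _ _ _ (size s)%:R); rewrite ?nrm_ge0 ?mulr_gt0// => j.
set m := (2 ^ j)%N; rewrite -nrm_sa_pow2// -/m.
pose g y := \sum_(x <- s) f x y ^+ m.
have cg : continuous g by apply: continuous_sum_real => x; exact: continuousX_real.
have gy y : 2^-1 ^+ m <= g y.
  have [x xs fxy] := hs y; rewrite /g (big_rem x)//=.
  apply: le_trans (_ : f x y ^+ m <= _).
    by rewrite lerXn2r ?nnegrE ?invr_ge0 ?(ltW fxy)//; have /andP[] := f01 x y.
  rewrite lerDl sumr_ge0// => x' _; rewrite exprn_ge0//; by have /andP[] := f01 x' y.
have g0 y : 0 < g y by apply: lt_le_trans (gy y); rewrite exprn_gt0// invr_gt0.
have cgi : continuous (fun y => (g y)^-1).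
  by move=> y; apply: cvgV; [rewrite gt_eqF | exact: cg].
have -> : h ^+ m = central (fun y => (g y)^-1) * \sum_(x <- s) (central (f x) * h) ^+ m.
  have -> : \sum_(x <- s) (central (f x) * h) ^+ m = central g * h ^+ m.
    rewrite (central_sum cxA); last by move=> x; exact: continuousX_real.
    rewrite mulr_suml; apply: eq_bigr => x _.
    by rewrite exprMn_comm ?(centralX cxA)//; exact: central_comm.
  rewrite mulrA -(centralM cxA)// (_ : (fun y => _) = fun=> 1) ?(central1 cxA) ?mul1r//.
  by apply/funext => y; rewrite mulVf// gt_eqF.
apply: le_trans (nrmM _ _) _.
have h1 : nrm (central (fun y => (g y)^-1)) <= 2 ^+ m.
  apply: nrm_central => //.
  move=> y; rewrite ger0_norm ?invr_ge0 ?(ltW (g0 y))//.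
  by rewrite -[2 ^+ m]invrK lef_pV2 ?posrE ?invr_gt0 ?exprn_gt0// -exprVn.
have h2 : nrm (\sum_(x <- s) (central (f x) * h) ^+ m) <= (size s)%:R * (2 * c') ^+ m.
  elim: (s) => [|x s' IH]; first by rewrite big_nil nrm0 mul0r.
  rewrite big_cons /= -natr1 mulrDl mul1r addrC; apply: le_trans (nrmD _ _) _.
  apply: lerD => //; apply: le_trans (nrmX _ _) _.
  by rewrite lerXn2r ?nnegrE ?nrm_ge0 ?mulr_ge0 ?(ltW c0)//; case: (fP x).
apply: le_trans (_ : 2 ^+ m * ((size s)%:R * (2 * c') ^+ m) <= _).
  by apply: ler_pM; rewrite ?nrm_ge0.
by rewrite mulrCA -exprMn mulrA (_ : 2 * 2 = 4)// -natrM.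
Qed.

End Fibres.

(** * Pairs of almost isometries *)

Section AlmostIsometries.
Variables (R : realType) (B : cstarAlgType R).
Implicit Types a b s t x y : B.

Lemma near_isometries s t a b (d : R) : isometry s -> isometry t -> star s * t = 0 ->
  nrm (a - s) <= d -> nrm (b - t) <= d -> d <= 1 -> almost_isometries (3 * d) a b.
Proof.
move=> is_ it st sa tb d1; have ns := nrm_isometry is_; have nt := nrm_isometry it.
have est x y u v : nrm u = 1 -> nrm v = 1 -> nrm (x - u) <= d -> nrm (y - v) <= d ->
    nrm (star x * y - star u * v) <= 3 * d.
  move=> nu nv xu yv.
  have -> : star x * y - star u * v = star (x - u) * y + star u * (y - v).
    by rewrite starB; nc.
  have h1 := nrmM (star (x - u)) y; have h2 := nrmM (star u) (y - v).
  rewrite !nrm_star nu in h1 h2; apply: le_trans (nrmD _ _) _.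
  have := nrm_le_dist y v; have := nrm_ge0 (x - u); have := nrm_ge0 y; nra.
split; last by rewrite -[star a * b]subr0 -st; exact: est.
  by rewrite -is_; exact: est.
by rewrite -it; exact: est.
Qed.

Lemma almost_isometries_nrm (e : R) a b : e <= 1 -> almost_isometries e a b ->
  nrm a <= 2 /\ nrm b <= 2.
Proof.
move=> e1 [aa bb _]; have h x : nrm (star x * x - 1) <= e -> nrm x <= 2.
  move=> hx; have : nrm x ^+ 2 <= 2.
    rewrite -nrm_starM; have := nrm_le_dist (star x * x) 1; rewrite nrm1; lra.
  by have := nrm_ge0 x; nra.
by split; exact: h.
Qed.

(* With x1, x2 and y1, y2 almost isometries with almost orthogonal ranges and s
   close to x1 and y1, the elements s^2 and k1 x2 + k2 s y2 are again such a pair;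
   only one of the two pairs is needed where k1 or k2 vanishes. *)
Lemma combine_isometries (k1 k2 e : R) s x1 x2 y1 y2 :
  0 <= k1 -> 0 <= k2 -> k1 ^+ 2 + k2 ^+ 2 = 1 -> 0 < e -> 100 * (100 * e) <= 1 ->
  (k1 = 0 \/ almost_isometries (2 * e) x1 x2 /\ nrm (s - x1) <= 13 * e) ->
  (k2 = 0 \/ almost_isometries (2 * e) y1 y2 /\ nrm (s - y1) <= 13 * e) ->
  almost_isometries 20^-1 (s * s) (k1 *c: x2 + s * (k2 *c: y2)).
Proof.
move=> k10 k20 k12 e0 e1 hx hy.
have e21 : 2 * e <= 1 by lra.
have near x z : almost_isometries (2 * e) x z -> nrm (s - x) <= 13 * e ->
    nrm (star s * s - 1) <= 70 * e /\ nrm (star s * z) <= 28 * e.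
  move=> xz sx; have [nx nz] := almost_isometries_nrm e21 xz; have [h1 _ h3] := xz.
  have ns : nrm s <= 3 by have := nrm_le_dist s x; lra.
  split.
    have -> : star s * s - 1 = star (s - x) * s + star x * (s - x) + (star x * x - 1).
      by rewrite starB; nc.
    apply: le_trans (nrmD _ _) _; have := nrmD (star (s - x) * s) (star x * (s - x)).
    have := nrmM (star (s - x)) s; have := nrmM (star x) (s - x); rewrite !nrm_star.
    have := nrm_ge0 (s - x); have := nrm_ge0 x; have := nrm_ge0 s; nra.
  have -> : star s * z = star (s - x) * z + star x * z by rewrite starB; nc.
  apply: le_trans (nrmD _ _) _; have := nrmM (star (s - x)) z; rewrite nrm_star.
  have := nrm_ge0 (s - x); have := nrm_ge0 z; nra.
(* k1 and k2 do not both vanish, so s is close to x1 or to y1. *)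
have ss : nrm (star s * s - 1) <= 70 * e.
  case: hx => [k1z|[hx /(near _ _ hx)[]//]].
  case: hy => [k2z|[hy /(near _ _ hy)[]//]].
  by move: k12; rewrite k1z k2z expr0n addr0 => /eqP; rewrite eq_sym oner_eq0.
have ns : nrm s <= 2.
  have : nrm s ^+ 2 <= 2.
    rewrite -nrm_starM; have := nrm_le_dist (star s * s) 1; rewrite nrm1; lra.
  by have := nrm_ge0 s; nra.
have k11 : k1 <= 1 by nra.
have k21 : k2 <= 1 by nra.
pose u := k1 *c: x2; pose v := k2 *c: y2.
have [su uu] : nrm (star s * u) <= 28 * e /\ nrm (star u * u - k1 ^+ 2 *c: 1) <= 2 * e.
  rewrite /u starZr -scalerAr -scalerAl -scalerAr scalecA -expr2 -scalerBr !nrmZr.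
  rewrite !ger0_norm ?exprn_ge0//.
  case: hx => [->|[hx sx]]; first by rewrite expr0n !mul0r !mulr_ge0 ?(ltW e0).
  have [_ h] := near _ _ hx sx; have [_ h' _] := hx.
  have := nrm_ge0 (star s * x2); have := nrm_ge0 (star x2 * x2 - 1); nra.
have [sv vv nv] : [/\ nrm (star s * v) <= 28 * e,
    nrm (star v * v - k2 ^+ 2 *c: 1) <= 2 * e & nrm v <= 2].
  rewrite /v starZr -scalerAr -scalerAl -scalerAr scalecA -expr2 -scalerBr !nrmZr.
  rewrite !ger0_norm ?exprn_ge0//.
  case: hy => [->|[hy sy]]; first by rewrite expr0n !mul0r !mulr_ge0 ?(ltW e0).
  have [_ h] := near _ _ hy sy; have [_ h' _] := hy.
  have [_ ny] := almost_isometries_nrm e21 hy.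
  have := nrm_ge0 (star s * y2); have := nrm_ge0 (star y2 * y2 - 1); have := nrm_ge0 y2.
  by move=> *; split; nra.
split.
- have -> : star (s * s) * (s * s) - 1 = star s * (star s * s - 1) * s + (star s * s - 1).
    by rewrite starM; nc.
  apply: le_trans (nrmD _ _) _; have := nrmM (star s * (star s * s - 1)) s.
  have := nrmM (star s) (star s * s - 1); rewrite nrm_star.
  have := nrm_ge0 s; have := nrm_ge0 (star s * s - 1).
  have := nrm_ge0 (star s * (star s * s - 1)); nra.
- have -> : star (u + s * v) * (u + s * v) - 1 =
     (star u * u - k1 ^+ 2 *c: 1) + (star v * v - k2 ^+ 2 *c: 1) +
     star v * (star s * s - 1) * v + star (star s * u) * v + star v * (star s * u).
    (* 1 is split so that each squared weight is subtracted from its own term u^* u or v^* v. *)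
    have e3 : (1 : B) = k1 ^+ 2 *c: 1 + k2 ^+ 2 *c: 1 by rewrite -scalecDl k12 scale1c.
    by rewrite {1}e3 starD !starM starK; nc.
  have h1 := nrmM (star v * (star s * s - 1)) v.
  have h2 := nrmM (star v) (star s * s - 1).
  have h3 := nrmM (star (star s * u)) v; have h4 := nrmM (star v) (star s * u).
  rewrite !nrm_star in h1 h2 h3 h4.
  apply: le_trans (nrmD _ _) _; apply: le_trans (lerD (nrmD _ _) (lexx _)) _.
  apply: le_trans (lerD (lerD (nrmD _ _) (lexx _)) (lexx _)) _.
  apply: le_trans (lerD (lerD (lerD (nrmD _ _) (lexx _)) (lexx _)) (lexx _)) _.
  have nv0 := nrm_ge0 v; have nss := nrm_ge0 (star s * s - 1).
  have nsu := nrm_ge0 (star s * u); have n5 := nrm_ge0 (star v * (star s * s - 1)).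
  have h5 : nrm (star v * (star s * s - 1)) <= 140 * e by nra.
  have h6 : nrm (star v * (star s * s - 1) * v) <= 280 * e by nra.
  have h7 : nrm (star (star s * u) * v) <= 56 * e by nra.
  have h8 : nrm (star v * (star s * u)) <= 56 * e by nra.
  lra.
- have -> : star (s * s) * (u + s * v) =
     star s * (star s * u) + star s * (star s * s - 1) * v + star s * v.
    by rewrite starM; nc.
  have h1 := nrmM (star s) (star s * u); have h2 := nrmM (star s * (star s * s - 1)) v.
  have h3 := nrmM (star s) (star s * s - 1); rewrite !nrm_star in h1 h2 h3.
  apply: le_trans (nrmD _ _) _; apply: le_trans (lerD (nrmD _ _) (lexx _)) _.
  have ns0 := nrm_ge0 s; have nss := nrm_ge0 (star s * s - 1).
  have nsu := nrm_ge0 (star s * u); have nv0 := nrm_ge0 v.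
  have n5 := nrm_ge0 (star s * (star s * s - 1)).
  have h5 : nrm (star s * (star s * s - 1)) <= 140 * e by nra.
  have h6 : nrm (star s * (star s * s - 1) * v) <= 280 * e by nra.
  have h7 : nrm (star s * (star s * u)) <= 56 * e by nra.
  lra.
Qed.

End AlmostIsometries.

(** * Approximate lifts of unitaries *)

Section Lifting.
Variables (R : realType) (I : Type) (B : I -> cstarAlgType R) (A F : cstarAlgType R).
Variables (p : forall i, {lrmorphism A -> B i}) (i0 : I).
Hypothesis sp : forall i, star_hom (p i).
Local Notation D := (family_algebra (image_closure i0 sp)).
Local Notation q := (to_image i0 sp).
Variable phi : {lrmorphism F -> D}.
Hypothesis sphi : star_hom phi.

(** The self-adjoint element behind each factor is approximated by a symmetrised element of A, and
    the Cayley transform is Lipschitz by [is_cayley_dist]. The errors add up along the product, and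
    the lift is a true unitary. *)
Lemma cayley_product_lift v (e : R) : cayley_product v -> 0 < e ->
  exists2 z : A, unitary z & nrm (q z - phi v) <= e.
Proof.
have sq : star_hom q by exact: to_image_star.
move=> cv; elim: cv e => [e e0|h w {}v sh hw cv IH e e0].
  by exists 1; [exact: unitary1 | rewrite !hom_one subrr nrm0 ltW].
have [z uz zv] := IH (e / 2) (divr_gt0 e0 (ltr0n R 2)).
have e40 : 0 < e / 4 by rewrite divr_gt0.
have [a ha] := image_closure_approx (phi h) e40.
have {}ha : nrm (q a - phi h) <= e / 4.
  by apply: nrm_fam_le => i; rewrite fam_addE fam_oppE; exact: ha.
pose k := 2^-1 *c: (a + star a).
have sk : star k = k by rewrite starZr starD starK addrC.
have hk : nrm (q k - phi h) <= e / 4.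
  have -> : q k - phi h = 2^-1 *c: ((q a - phi h) + star (q a - phi h)).
    rewrite /k hom_scale hom_add sq starB -sphi sh -[X in _ - X]half2 -scalerBr.
    by congr (_ *: _); nc.
  rewrite nrmZr ger0_norm ?invr_ge0//.
  have := nrmD (q a - phi h) (star (q a - phi h)); rewrite nrm_star; lra.
have [w' kw] := is_cayley_exists sk.
have ww : nrm (q w' - phi w) <= e / 2.
  have := @is_cayley_dist _ _ (q k) (phi h) (q w') (phi w).
  rewrite -sq -sphi sk sh => /(_ erefl erefl (star_hom_cayley q kw) (star_hom_cayley phi hw)).
  lra.
have uw : unitary w' by exact: is_cayley_unitary kw.
exists (w' * z); first exact: unitary_mul.
have -> : q (w' * z) - phi (w * v) = (q w' - phi w) * q z + phi w * (q z - phi v).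
  by rewrite !hom_mul; nc.
have n1 : nrm (q z) = 1 by apply: nrm_unitary; exact: star_hom_unitary.
have n2 : nrm (phi w) = 1.
  by apply: nrm_unitary; apply: star_hom_unitary => //; exact: is_cayley_unitary hw.
have := nrmD ((q w' - phi w) * q z) (phi w * (q z - phi v)).
have := nrmM (q w' - phi w) (q z); have := nrmM (phi w) (q z - phi v).
rewrite n1 n2; lra.
Qed.

End Lifting.

(** * Gluing isometries *)

Section Gluing.
Variables (R : realType) (T2 F : cstarAlgType R) (s1 s2 : T2).
Variables (j0 j1 : {lrmorphism T2 -> F}) (u : F).
Hypothesis T2P : is_T2 s1 s2.
Hypothesis FP : is_full_free_product j0 j1.
Hypothesis cu : cayley_product u.
Hypothesis us : j1 s1 = u * j0 s1.

Variables (X : topologicalType) (A : cstarAlgType R).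
Variable theta : continuousType X R[i]^o -> A.
Variables (Ax : X -> cstarAlgType R) (p : forall x, {lrmorphism A -> Ax x}).
Hypothesis cX : compact [set: X].
Hypothesis hX : hausdorff_space X.
Hypothesis cxA : CX_algebra theta.
Hypothesis pA : forall x, is_fibre theta x (p x).
Hypothesis cnorm : forall a, continuous (fun x => `|p x a| : R[i]^o).
Local Notation central := (central theta).

Definition almost_on (V : set X) (e : R) (a b : A) :=
  forall y, V y -> almost_isometries e (p y a) (p y b).

Lemma fibre_nrm_continuous a : continuous (fun x => nrm (p x a)).
Proof.
move=> x; apply/cvgrPdist_lt => e e0.
have := (@continuous_nrmP _ X R[i]^o _ x).1 (@cnorm a x) _ e0; apply: filterS => y.
by rewrite /= !nrmE -rmorphB nrm_real distrC.
Qed.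

Lemma restrict_star (V : set X) (i : {y | V y}) : star_hom (p (sval i)).
Proof. exact: (fibre_star pA). Qed.

(** Over V the pair is perturbed to genuine isometries in the closure of the image of A, and these
    are approximated by elements of A as closely as desired. *)
Lemma almost_on_improve (V : set X) y a b (e : R) : V y -> almost_on V 20^-1 a b ->
  0 < e -> exists a' b', almost_on V e a' b'.
Proof.
move=> Vy ab e0.
pose pV (i : {y | V y}) := p (sval i); pose i0 := exist V y Vy.
pose q := @to_image R _ _ A pV i0 (@restrict_star V).
have sq : star_hom q by exact: to_image_star.
have qab : almost_isometries 20^-1 (q a) (q b).
  split; rewrite -!sq -!hom_mul -?(hom_one q) -?hom_sub; apply: nrm_fam_le => -[z Vz];
  rewrite to_imageE /pV /=; have [h1 h2 h3] := ab z Vz.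
  - by rewrite hom_sub hom_one hom_mul (fibre_star pA).
  - by rewrite hom_sub hom_one hom_mul (fibre_star pA).
  - by rewrite hom_mul (fibre_star pA).
have [|s [t [is_ it st _ _]]] := perturb_isometries _ qab; first by [].
pose d := Num.min 1 (e / 3); have d0 : 0 < d by rewrite lt_min ltr01 divr_gt0.
have [a' ha] := image_closure_approx s d0; have [b' hb] := image_closure_approx t d0.
exists a', b' => z Vz; pose i := exist V z Vz.
have ev : star_hom (@fam_eval _ _ _ (image_closure i0 (@restrict_star V)) i) by [].
have [h1 h2 h3] : almost_isometries (3 * d) (p z a') (p z b').
  apply: (@near_isometries _ _ (fam_eval i s) (fam_eval i t)).
  - exact: star_hom_isometry.
  - exact: star_hom_isometry.
  - by rewrite -ev -hom_mul st rmorph0.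
  - exact: (ha i).
  - exact: (hb i).
  - by rewrite ge_min lexx.
have d3 : 3 * d <= e by rewrite mulrC -ler_pdivlMr// ge_min lexx orbT.
by split; apply: le_trans d3.
Qed.

Lemma glue_unitary (V : set X) (a1 a2 b1 b2 : A) (e : R) :
  0 < e -> e <= 20^-1 -> almost_on V e a1 a2 -> almost_on V e b1 b2 ->
  exists2 z, unitary z & forall y, V y -> nrm (p y (z * a1 - b1)) <= 11 * e.
Proof.
move=> e0 e20 aP bP.
(* [image_closure] requires a point of V. *)
have [[y Vy]|V0] := pselect (exists y, V y); last first.
  by exists 1; [exact: unitary1 | move=> y Vy; case: V0; exists y].
pose pV (i : {y | V y}) := p (sval i); pose i0 := exist V y Vy.
pose q := @to_image R _ _ A pV i0 (@restrict_star V).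
have sq : star_hom q by exact: to_image_star.
have almost_q a b : almost_on V e a b -> almost_isometries e (q a) (q b).
  move=> ab.
  split; rewrite -!sq -!hom_mul -?(hom_one q) -?hom_sub; apply: nrm_fam_le => -[x Vx];
  rewrite to_imageE /pV /=; have [h1 h2 h3] := ab x Vx.
  - by rewrite hom_sub hom_one hom_mul (fibre_star pA).
  - by rewrite hom_sub hom_one hom_mul (fibre_star pA).
  - by rewrite hom_mul (fibre_star pA).
have [S1 [S2 [iS1 iS2 S12 Sa _]]] := perturb_isometries e20 (almost_q _ _ aP).
have [Y1 [Y2 [iY1 iY2 Y12 Yb _]]] := perturb_isometries e20 (almost_q _ _ bP).
have [_ _ univ] := T2P.
have [f0 [sf0 f01 _]] := univ _ _ _ (T2_relations_isometries iS1 iS2 S12).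
have [f1 [sf1 f11 _]] := univ _ _ _ (T2_relations_isometries iY1 iY2 Y12).
have [sj0 sj1 /(_ _ f0 f1 sf0 sf1) [phi [[sphi phi0 phi1] _]]] := FP.
have uS : phi u * S1 = Y1.
  by rewrite -f01 -phi0 /= -hom_mul -us -[RHS]f11 -phi1.
have [z uz zu] := cayley_product_lift sphi cu e0.
exists z => // x Vx; pose i := exist V x Vx.
have : nrm (q (z * a1 - b1)) <= 11 * e.
  (* The three terms are bounded by 5 e, e and 5 e. *)
  have -> : q (z * a1 - b1) = q z * (q a1 - S1) + (q z - phi u) * S1 + (Y1 - q b1).
    by rewrite -uS hom_sub hom_mul; nc.
  have nz : nrm (q z) = 1 by apply: nrm_unitary; exact: star_hom_unitary.
  have := nrmD (q z * (q a1 - S1) + (q z - phi u) * S1) (Y1 - q b1).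
  have := nrmD (q z * (q a1 - S1)) ((q z - phi u) * S1).
  have := nrmM (q z) (q a1 - S1); have := nrmM (q z - phi u) S1.
  rewrite nz (nrm_isometry iS1) (nrmBC (q a1)) mulr1 mul1r.
  move: Sa Yb zu; rewrite -/q => Sa Yb zu h1 h2 h3 h4.
  by move: (nrm _) (nrm _) (nrm _) (nrm _) (nrm _) (nrm _) (nrm _) Sa Yb zu h1 h2 h3 h4 => *; lra.
apply: le_trans; exact: (le_nrm_fam (q (z * a1 - b1)) i).
Qed.

Definition good (V : set X) := exists a b, almost_on V 20^-1 a b.

Lemma good_set0 : good set0.
Proof. by exists 0, 0. Qed.

Lemma good_improve (V : set X) (e : R) : good V -> 0 < e ->
  exists a b, almost_on V e a b.
Proof.
move=> [a [b ab]] e0; have [[y Vy]|V0] := pselect (exists y, V y).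
  exact: almost_on_improve Vy ab e0.
by exists a, b => y Vy; case: V0; exists y.
Qed.

Lemma open_almost (a b c : A) (e d : R) :
  open [set y | [/\ nrm (p y (star a * a - 1)) < e, nrm (p y (star b * b - 1)) < e,
     nrm (p y (star a * b)) < e & nrm (p y c) < d]].
Proof.
have oN := open_lt_real _ (@fibre_nrm_continuous _).
have -> : [set y | [/\ nrm (p y (star a * a - 1)) < e, nrm (p y (star b * b - 1)) < e,
     nrm (p y (star a * b)) < e & nrm (p y c) < d]] =
   [set y | nrm (p y (star a * a - 1)) < e] `&` [set y | nrm (p y (star b * b - 1)) < e]
   `&` [set y | nrm (p y (star a * b)) < e] `&` [set y | nrm (p y c) < d].
  by apply/seteqP; split=> y; [case=> *; do !split | case=> -[[]]].
by do !apply: openI; exact: oN.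
Qed.

Lemma almostE y a b (e : R) : almost_isometries e (p y a) (p y b) <->
  [/\ nrm (p y (star a * a - 1)) <= e, nrm (p y (star b * b - 1)) <= e &
     nrm (p y (star a * b)) <= e].
Proof.
by rewrite /almost_isometries -!(fibre_star pA) -!hom_mul -!(hom_one (p y)) -!hom_sub.
Qed.

Lemma good_setU (V1 V2 : set X) : closed V1 -> closed V2 -> good V1 -> good V2 ->
  good (V1 `|` V2).
Proof.
have clD (V W : set X) : closed V -> open W -> closed (V `\` W).
  by move=> cV oW; rewrite setDE; apply: closedI => //; exact: open_closedC.
(* The errors in [combine_isometries] add up to less than 400 e, which is below 1/20 for this e. *)
move=> cV1 cV2 g1 g2; pose e : R := (100 * 100)^-1.
have e0 : 0 < e by rewrite invr_gt0 mulr_gt0.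
have e1 : 100 * (100 * e) <= 1.
  by rewrite mulrA /e mulfV// mulf_neq0// pnatr_eq0.
have e20 : e <= 20^-1 by lra.
have [a1 [a2 ha]] := good_improve g1 e0.
have [b1 [b2 hb]] := good_improve g2 e0.
have [||z uz zab] := @glue_unitary (V1 `&` V2) a1 a2 b1 b2 e e0 e20.
- by move=> y [/ha].
- by move=> y [_ /hb].
have [z1 z2] := uz.
pose x1 := z * a1; pose x2 := z * a2.
have hx : almost_on V1 e x1 x2.
  have e11 : star x1 * x1 = star a1 * a1 by rewrite /x1 starM; nc z1.
  have e22 : star x2 * x2 = star a2 * a2 by rewrite /x2 starM; nc z1.
  have e12 : star x1 * x2 = star a1 * a2 by rewrite /x1 /x2 starM; nc z1.
  by move=> y /ha; rewrite !almostE e11 e22 e12.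
(* Relaxing 11 e to a strict 12 e gives an open set containing the intersection. A point outside O
   lies in at most one of V1 and V2, and there h makes s equal to the corresponding first
   isometry. *)
pose O := [set y | nrm (p y (x1 - b1)) < 12 * e].
have oO : open O by apply: open_lt_real; exact: fibre_nrm_continuous.
have VO y : V1 y -> V2 y -> O y.
  by move=> V1y V2y; have := zab y (conj V1y V2y); rewrite /O /= /x1; lra.
have [|||h [ch h01 h0 h1]] := @urysohn_function R X (V2 `\` O) (V1 `\` O) cX hX.
- exact: clD.
- exact: clD.
- by rewrite -subset0 => y [[V2y nO] [V1y _]]; apply: nO; exact: VO.
have ch' : continuous (fun y => 1 - h y).
  by apply: continuousB_real => //; exact: cst_continuous.
pose s := central h * x1 + central (fun y => 1 - h y) * b1.
have hc : central (fun y => 1 - h y) = 1 - central h.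
  by rewrite (centralB cxA) ?(central1 cxA)//; exact: cst_continuous.
have pc g c y : continuous g -> p y (central g * c) = g y *c: p y c.
  by move=> cg; rewrite hom_mul (fibre_central cxA pA)// -scalerAl mul1r.
have s1E y : p y (s - x1) = (1 - h y) *c: p y (b1 - x1).
  by rewrite -(pc (fun y => 1 - h y))// hc; congr (p y _); rewrite /s hc; nc.
have s2E y : p y (s - b1) = h y *c: p y (x1 - b1).
  by rewrite -(pc h)//; congr (p y _); rewrite /s hc; nc.
have sx y : V1 y -> nrm (p y (s - x1)) <= 12 * e.
  move=> V1y; rewrite s1E nrmZr; have [yO|nyO] := pselect (O y); last first.
    by rewrite h1// subrr normr0 mul0r mulr_ge0// ltW.
  have /andP[hy0 hy1] := h01 y; rewrite ger0_norm ?subr_ge0// hom_sub nrmBC -hom_sub.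
  by move: yO; rewrite /O /=; have := nrm_ge0 (p y (x1 - b1)); nra.
have sy y : V2 y -> nrm (p y (s - b1)) <= 12 * e.
  move=> V2y; rewrite s2E nrmZr; have [yO|nyO] := pselect (O y); last first.
    by rewrite h0// normr0 mul0r mulr_ge0// ltW.
  have /andP[hy0 hy1] := h01 y; rewrite ger0_norm//.
  by move: yO; rewrite /O /=; have := nrm_ge0 (p y (x1 - b1)); nra.
(* O1 is an open set containing V1 on which the pair x1, x2 is still good and s is near x1; O2 plays
   this role for V2. At a point of V2 outside O1 the function k below is 0, and at a point of V1
   outside O2 it is 1, so a pair that fails has weight 0. *)
pose O1 := [set y | [/\ nrm (p y (star x1 * x1 - 1)) < 2 * e,
  nrm (p y (star x2 * x2 - 1)) < 2 * e, nrm (p y (star x1 * x2)) < 2 * e &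
  nrm (p y (s - x1)) < 13 * e]].
pose O2 := [set y | [/\ nrm (p y (star b1 * b1 - 1)) < 2 * e,
  nrm (p y (star b2 * b2 - 1)) < 2 * e, nrm (p y (star b1 * b2)) < 2 * e &
  nrm (p y (s - b1)) < 13 * e]].
have e2 : e < 2 * e by lra.
have e13 : 12 * e < 13 * e by lra.
have VO1 y : V1 y -> O1 y.
  move=> V1y; have [? ? ?] := (almostE _ _ _ _).1 (hx y V1y); have ? := sx y V1y.
  by split; apply: le_lt_trans e2 || apply: le_lt_trans e13.
have VO2 y : V2 y -> O2 y.
  move=> V2y; have [? ? ?] := (almostE _ _ _ _).1 (hb y V2y); have ? := sy y V2y.
  by split; apply: le_lt_trans e2 || apply: le_lt_trans e13.
have [|||k [ck k01 k0 k1]] := @urysohn_function R X (V2 `\` O1) (V1 `\` O2) cX hX.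
- by apply: clD => //; exact: open_almost.
- by apply: clD => //; exact: open_almost.
- by rewrite -subset0 => y [[V2y nO] [V1y _]]; apply: nO; exact: VO1.
pose k1' y := Num.sqrt (k y); pose k2' y := Num.sqrt (1 - k y).
have ck1 : continuous k1' by exact: continuous_sqrt_real.
have ck2 : continuous k2'.
  by apply: continuous_sqrt_real; apply: continuousB_real => //; exact: cst_continuous.
exists (s * s), (central k1' * x2 + s * (central k2' * b2)) => y Vy.
have -> : p y (central k1' * x2 + s * (central k2' * b2)) =
   k1' y *c: p y x2 + p y s * (k2' y *c: p y b2).
  by rewrite hom_add !hom_mul !(fibre_central cxA pA)// -!scalerAl !mul1r.
have /andP[ky0 ky1] := k01 y.
rewrite hom_mul; apply: (@combine_isometries _ _ _ _ e _ (p y x1) _ (p y b1)) => //.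
- exact: sqrtr_ge0.
- exact: sqrtr_ge0.
- by rewrite !sqr_sqrtr ?subr_ge0// addrC subrK.
- have [yO1|nO1] := pselect (O1 y).
    right; case: yO1 => h1' h2' h3' h4'; rewrite -hom_sub; split; last exact: ltW.
    by apply/almostE; split; exact: ltW.
  left; rewrite /k1' k0 ?sqrtr0//; split=> //.
  by case: Vy => // /VO1.
- have [yO2|nO2] := pselect (O2 y).
    right; case: yO2 => h1' h2' h3' h4'; rewrite -hom_sub; split; last exact: ltW.
    by apply/almostE; split; exact: ltW.
  left; rewrite /k2' k1 ?subrr ?sqrtr0//; split=> //.
  by case: Vy => // /VO2.
Qed.

Hypothesis pinf : forall x, properly_infinite (Ax x).

Lemma good_local (x : X) : exists V : set X, [/\ closed V, good V & nbhs x V].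
Proof.
have [s [t [is_ it st]]] := (properly_infiniteP _).1 (pinf x).
have [a pa] := fibre_surj pA s; have [b pb] := fibre_surj pA t.
pose N c := [set y | nrm (p y c) <= 20^-1].
have cN c : closed (N c) by apply: closed_le_real; exact: fibre_nrm_continuous.
have nN c : p x c = 0 -> nbhs x (N c).
  move=> pc; apply: filterS (_ : nbhs x [set y | nrm (p y c) < 20^-1]).
    by move=> y /=; exact: ltW.
  apply: open_nbhs_nbhs; split; first by apply: open_lt_real; exact: fibre_nrm_continuous.
  by rewrite /= pc nrm0 invr_gt0.
exists (N (star a * a - 1) `&` N (star b * b - 1) `&` N (star a * b)); split.
- by do !apply: closedI.
- by exists a, b => y [[h1 h2] h3]; apply/almostE.
- apply: filterI; first apply: filterI; apply: nN.
  + by rewrite hom_sub hom_one hom_mul (fibre_star pA) pa is_ subrr.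
  + by rewrite hom_sub hom_one hom_mul (fibre_star pA) pb it subrr.
  + by rewrite hom_mul (fibre_star pA) pa pb st.
Qed.

Lemma glued_properly_infinite : properly_infinite A.
Proof.
pose V x := projT1 (cid (good_local x)).
have VP x : [/\ closed (V x), good (V x) & nbhs x (V x)] := projT2 (cid (good_local x)).
have [|l hl] := compact_seq_cover cX (U := V); first by move=> x; case: (VP x).
have gs : good [set y | exists2 x, x \in l & V x y].
  suff [] : good [set y | exists2 x, x \in l & V x y] /\
            closed [set y | exists2 x, x \in l & V x y] by [].
  elim: (l) => [|x l' [IHg IHc]].
    have -> : [set y | exists2 x, x \in [::] & V x y] = set0.
      by rewrite -subset0 => y [].
    by split; [exact: good_set0 | exact: closed0].
  have -> : [set y | exists2 x', x' \in x :: l' & V x' y] =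
            V x `|` [set y | exists2 x, x \in l' & V x y].
    apply/seteqP; split=> y.
      by move=> [x' +]; rewrite inE => /orP[/eqP->|x'l] Vy; [left | right; exists x'].
    move=> [Vy|[x' x'l Vy]]; first by exists x; rewrite ?inE ?eqxx.
    by exists x' => //; rewrite inE x'l orbT.
  by have [cx gx _] := VP x; split; [exact: good_setU | exact: closedU].
(* [sup_fibre_norm] doubles a bound, hence 1/40 for the threshold 1/20 in A. *)
have [|a [b ab]] := @good_improve _ 40^-1 gs; first by rewrite invr_gt0.
have {}ab y := (almostE _ _ _ _).1 (ab y (hl y)).
have n40 : (0 : R) <= 40^-1 by rewrite invr_ge0.
have [|s [t [is_ it st _ _]]] := @perturb_isometries _ _ a b 20^-1 (lexx _).
  have h40 : 2 * 40^-1 <= 20^-1 :> R by lra.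
  split; apply: le_trans h40; apply: (sup_fibre_norm cxA pA cX) => // y;
  by case: (ab y).
by apply/properly_infiniteP; exists s, t.
Qed.

End Gluing.

(** * The unit interval and separability *)

Section UnitInterval.
Variable R : realType.

Definition unit_interval := {x : R | 0 <= x <= 1}.

Fact unit_interval0 : 0 <= (0 : R) <= 1. Proof. by rewrite lexx ler01. Qed.

HB.instance Definition _ := Choice.on unit_interval.

Definition interval_space := initial_topology (fun x : unit_interval => sval x).

HB.instance Definition _ := PseudoMetric.on interval_space.
HB.instance Definition _ := isPointed.Build interval_space (exist _ 0 unit_interval0).

Definition icoord (x : interval_space) : R := sval (x : unit_interval).

Lemma icoord_continuous : continuous icoord.
Proof. exact: initial_continuous. Qed.

Lemma icoordP x : 0 <= icoord x <= 1.
Proof. exact: (svalP (x : unit_interval)). Qed.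

Lemma icoord_inj : injective icoord.
Proof. by move=> x y xy; apply: val_inj. Qed.

Definition clamp (t : R) : R := Num.max 0 (Num.min 1 t).

Fact clampP t : 0 <= clamp t <= 1.
Proof. by rewrite /clamp le_max lexx /= ge_max ler01 ge_min lexx. Qed.

Lemma clamp_id t : 0 <= t <= 1 -> clamp t = t.
Proof. by move=> /andP[t0 t1]; rewrite /clamp (min_idPr t1) (max_idPr t0). Qed.

Lemma clamp_le0 t : t <= 0 -> clamp t = 0.
Proof.
move=> t0; have t1 : t <= 1 by lra.
by rewrite /clamp (min_idPr t1); apply/max_idPl.
Qed.

Lemma clamp_ge1 t : 1 <= t -> clamp t = 1.
Proof. by move=> t1; rewrite /clamp (min_idPl t1); apply/max_idPr. Qed.

Lemma clamp_continuous : continuous clamp.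
Proof.
apply: continuous_max_real; first exact: cst_continuous.
by move=> x; apply: continuous_min; [exact: cvg_cst | exact: cvg_id].
Qed.

Definition to_interval (t : R) : interval_space := exist _ (clamp t) (clampP t).

Lemma icoord_to_interval t : icoord (to_interval t) = clamp t. Proof. by []. Qed.

Lemma to_interval_coord x : to_interval (icoord x) = x.
Proof. by apply: icoord_inj; rewrite icoord_to_interval clamp_id ?icoordP. Qed.

Lemma to_interval_continuous : continuous to_interval.
Proof. by apply: continuous_comp_initial; exact: clamp_continuous. Qed.

Lemma interval_space_compact : compact [set: interval_space].
Proof.
have -> : [set: interval_space] = to_interval @` `[0, 1]%classic.
  apply/seteqP; split=> // x _; exists (icoord x); last exact: to_interval_coord.
  by rewrite /= in_itv /= icoordP.
apply: continuous_compact; last exact: segment_compact.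
exact/continuous_subspaceT/to_interval_continuous.
Qed.

Lemma interval_space_hausdorff : hausdorff_space interval_space.
Proof.
move=> x y xy; apply: icoord_inj.
have : @hausdorff_space R by exact: Rhausdorff.
apply=> P Q xP yQ.
have [z [zP zQ]] := xy _ _ (icoord_continuous xP) (icoord_continuous yQ).
by exists (icoord z).
Qed.

Lemma interval_space_second_countable : @second_countable interval_space.
Proof. exact: (@compact_second_countable R interval_space interval_space_compact). Qed.

Section Functions.
Variable A : cstarAlgType R.
Implicit Types f : R -> A.

(** Functions on [0, 1] are encoded as functions on the line that are constant on either side, so
    that plain continuity and suprema over the line apply to them. *)
Definition clamped f :=
  [/\ continuous f, forall t, t <= 0 -> f t = f 0 & forall t, 1 <= t -> f t = f 1].

Lemma clamped_clamp f t : clamped f -> f t = f (clamp t).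
Proof.
move=> [_ f0 f1]; have [t0|t0] := lerP t 0; first by rewrite clamp_le0// f0.
have [t1|t1] := lerP 1 t; first by rewrite clamp_ge1// f1.
by rewrite clamp_id// (ltW t0) (ltW t1).
Qed.

Lemma clamped_bounded f : clamped f -> bounded_family (A := fun=> A) f.
Proof.
move=> cf; have [cont _ _] := cf.
have cn : continuous (fun t => nrm (f t)).
  by move=> t; apply: continuous_comp; [exact: cont | exact: nrm_continuous].
have [c _ hc] := @EVT_max R _ 0 1 ler01 (continuous_subspaceT cn).
by exists (nrm (f c)) => t; rewrite clamped_clamp//; apply: hc; rewrite in_itv /= clampP.
Qed.

Lemma clamped_uniform f (e : R) : clamped f -> 0 < e -> exists2 d, 0 < d &
  forall t t', 0 <= t <= 1 -> `|t' - t| < d -> nrm (f t' - f t) <= e.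
Proof.
move=> cf e0; have [cont _ _] := cf; have e20 : 0 < e / 2 by rewrite divr_gt0.
(* The estimate holds on a ball of twice the radius used for the cover, so that t' stays in it when
   t lies in the smaller ball. *)
have dx (x : interval_space) : exists d : R, 0 < d /\
    forall t, `|t - icoord x| < d + d -> nrm (f t - f (icoord x)) < e / 2.
  have /nbhs_ballP[d /= d0 hd] := (continuous_nrmP f (icoord x)).1 (cont _) _ e20.
  exists (d / 2); split=> [|t]; first by rewrite divr_gt0.
  by move=> td; apply: hd; rewrite /ball /= distrC; move: td; lra.
pose D x := projT1 (cid (dx x)).
have DP x : 0 < D x /\ forall t, `|t - icoord x| < D x + D x ->
  nrm (f t - f (icoord x)) < e / 2 := projT2 (cid (dx x)).
have [|s hs] := compact_seq_cover (U := fun x => [set y | `|icoord y - icoord x| < D x])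
    interval_space_compact.
  move=> x; have [d0 _] := DP x.
  have /cvgrPdist_lt/(_ _ d0) := @icoord_continuous x.
  by apply: filterS => y; rewrite distrC.
have [d d0 hd] : exists2 d, 0 < d & forall x, x \in s -> d <= D x.
  elim: (s) => [|x s' [d d0 hd]]; first by exists 1.
  exists (Num.min d (D x)); first by rewrite lt_min d0; case: (DP x).
  move=> y; rewrite inE => /orP[/eqP->|/hd]; first by rewrite ge_min lexx orbT.
  by move=> h; rewrite ge_min h.
exists d => // t t' t01 tt'; have [x xs] := hs (to_interval t).
rewrite /mkset icoord_to_interval clamp_id// => tx; have [Dx0 hx] := DP x.
have h1 := hx t; have h2 := hx t'; have dx' := hd x xs.
have := nrm_dist (f t') (f (icoord x)) (f t); rewrite (nrmBC (f (icoord x))).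
have := h1 _; have := h2 _.
have a1 : `|t - icoord x| < D x + D x by lra.
have a2 : `|t' - icoord x| < D x + D x.
  by have := ler_distD t t' (icoord x); lra.
by have := h1 a1; have := h2 a2; lra.
Qed.

End Functions.
End UnitInterval.

Section Separable.
Variables (R : realType) (A : cstarAlgType R) (g : nat -> A).

Definition qi (q : rat * rat) : R[i] := Complex (ratr q.1) (ratr q.2).

(** Noncommutative polynomials in the [g n] and their adjoints, with coefficients in Q(i). Coding
    them by trees over a countable type makes their range countable at once. *)
Fixpoint star_poly (t : GenTree.tree (nat + rat * rat)) : A :=
  match t with
  | GenTree.Leaf (inl n) => g n
  | GenTree.Leaf (inr q) => qi q *: 1
  | GenTree.Node 0 [:: a; b] => star_poly a + star_poly b
  | GenTree.Node 1 [:: a; b] => star_poly a * star_poly b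
  | GenTree.Node 2 [:: a] => star (star_poly a)
  | _ => 0
  end.

Lemma star_poly_countable : countable (range star_poly).
Proof.
apply: (sub_countable (card_image_le _ _)); exact: countableP.
Qed.

Lemma qi_dense (c : R[i]) (e : R) : 0 < e -> exists q, nrm (qi q - c) < e.
Proof.
move=> e0; case: c => x y.
have [|q1] := @rat_in_itvoo R (x - e / 2) (x + e / 2); first lra.
rewrite in_itv /= => /andP[a1 a2].
have [|q2] := @rat_in_itvoo R (y - e / 2) (y + e / 2); first lra.
rewrite in_itv /= => /andP[b1 b2]; exists (q1, q2).
rewrite -(ltr_pXn2r (_ : 0 < 2)%N) ?nnegrE ?nrm_ge0 ?(ltW e0)// nrm_sqr /=.
nra.
Qed.

Lemma star_poly_closure : cstar_subalgebra (closure (range star_poly)).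
Proof.
have D a b : closure (range star_poly) a -> closure (range star_poly) b ->
    closure (range star_poly) (a + b).
  move=> /closure_nrmP ha /closure_nrmP hb; apply/closure_nrmP => e e0.
  have e20 : 0 < e / 2 by rewrite divr_gt0.
  have [_ [s _ <-] sa] := ha _ e20; have [_ [t _ <-] tb] := hb _ e20.
  exists (star_poly (GenTree.Node 0 [:: s; t])); first by eexists.
  have -> : star_poly (GenTree.Node 0 [:: s; t]) - (a + b) =
     (star_poly s - a) + (star_poly t - b) by rewrite /=; nc.
  by apply: le_lt_trans (nrmD _ _) _; lra.
have M a b : closure (range star_poly) a -> closure (range star_poly) b ->
    closure (range star_poly) (a * b).
  move=> /closure_nrmP ha /closure_nrmP hb; apply/closure_nrmP => e e0.
  pose K := nrm a + nrm b + 1.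
  have K0 : 0 < K by rewrite /K; have := nrm_ge0 a; have := nrm_ge0 b; lra.
  pose d := Num.min 1 (e / (3 * K)).
  have d0 : 0 < d by rewrite lt_min ltr01 divr_gt0// mulr_gt0.
  have d1 : d <= 1 by rewrite ge_min lexx.
  have dK : d * (3 * K) <= e by rewrite -ler_pdivlMr ?mulr_gt0// ge_min lexx orbT.
  have [_ [s _ <-] sa] := ha _ d0; have [_ [t _ <-] tb] := hb _ d0.
  exists (star_poly (GenTree.Node 1 [:: s; t])); first by eexists.
  have -> : star_poly (GenTree.Node 1 [:: s; t]) - a * b =
     (star_poly s - a) * star_poly t + a * (star_poly t - b) by rewrite /=; nc.
  apply: le_lt_trans (nrmD _ _) _.
  have ht : nrm (star_poly t) <= K.
    by have := nrm_le_dist (star_poly t) b; have := nrm_ge0 a; rewrite /K; lra.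
  have h1 : nrm ((star_poly s - a) * star_poly t) <= d * K.
    by apply: le_trans (nrmM _ _) _; apply: ler_pM; rewrite ?nrm_ge0// ltW.
  have h2 : nrm (a * (star_poly t - b)) <= K * d.
    apply: le_trans (nrmM _ _) _; apply: ler_pM; rewrite ?nrm_ge0 ?(ltW tb)//.
    by rewrite /K; have := nrm_ge0 b; lra.
  nra.
have Q (c : R[i]) : closure (range star_poly) (c *: 1).
  apply/closure_nrmP => e e0; have [q hq] := qi_dense c e0.
  exists (qi q *: 1); first by exists (GenTree.Leaf (inr q)).
  by rewrite -scalerBl nrmZ nrm1 mulr1.
split.
- exact: closed_closure.
- by rewrite -(scale1r (1 : A)); exact: Q.
- move=> c a b ha hb; apply: D => //.
  by rewrite -(mul1r a) scalerAl; apply: M => //; exact: Q.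
- exact: M.
- move=> a /closure_nrmP ha; apply/closure_nrmP => e e0.
  have [_ [s _ <-] sa] := ha _ e0.
  exists (star_poly (GenTree.Node 2 [:: s])); first by eexists.
  by rewrite /= -starB nrm_star.
Qed.

Lemma star_poly_gen n : closure (range star_poly) (g n).
Proof. by apply: subset_closure; exists (GenTree.Leaf (inl n)). Qed.

Lemma dense_closure (V : normedModType R[i]) (Q : set V) : closure Q = setT -> dense Q.
Proof.
move=> cQ O [x Ox] oO; have : closure Q x by rewrite cQ.
by move=> /(_ O) []; [apply: open_nbhs_nbhs | move=> y [Qy Oy]; exists y].
Qed.

End Separable.

(** * Separability of the free product *)

Section FreeProductSeparable.
Variables (R : realType) (T2 F : cstarAlgType R) (s1 s2 : T2).
Variables (j0 j1 : {lrmorphism T2 -> F}).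
Hypothesis T2P : is_T2 s1 s2.
Hypothesis FP : is_full_free_product j0 j1.

(** The universal property, applied to j0 and j1 with values in S, gives a map from F to S; followed
    by the inclusion it is an endomorphism of F extending j0 and j1, which uniqueness identifies
    with the identity. *)
Lemma free_product_generated (S : set F) : cstar_subalgebra S ->
  (forall t, S (j0 t)) -> (forall t, S (j1 t)) -> S = setT.
Proof.
move=> cS S0 S1; have [sj0 sj1 univ] := FP.
pose B := family_algebra (subalgebra cS).
have bd (j : {lrmorphism T2 -> F}) b : bounded_family (A := fun _ : unit => F) (fun _ => j b).
  by exists (nrm (j b)).
pose f0 : {lrmorphism T2 -> B} := @to_family _ unit _ _ (subalgebra cS) (fun _ => j0) S0 (bd j0).
pose f1 : {lrmorphism T2 -> B} := @to_family _ unit _ _ (subalgebra cS) (fun _ => j1) S1 (bd j1).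
have sf0 : star_hom f0 by exact: to_family_star.
have sf1 : star_hom f1 by exact: to_family_star.
have [phi [[sphi phi0 phi1] _]] := univ B f0 f1 sf0 sf1.
pose iota : {lrmorphism B -> F} := @fam_eval _ unit _ (subalgebra cS) tt.
pose psi : {lrmorphism F -> F} := iota \o phi.
have [f [_ uf]] := univ F j0 j1 sj0 sj1.
have psiE : psi =1 f.
  apply: uf; split.
  - by move=> a; rewrite /psi /= sphi.
  - by move=> a; have /= := congr1 iota (phi0 a).
  - by move=> a; have /= := congr1 iota (phi1 a).
have idE : (idfun : {lrmorphism F -> F}) =1 f by apply: uf; split.
apply/seteqP; split=> // a _.
have -> : a = psi a by rewrite psiE -idE.
exact: (fam_funP (phi a)).
Qed.

(** Needed because (c) speaks of separable algebras. The t for which [j t] lies in the closure form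
    a subalgebra containing s1 and s2, hence are all of T2. *)
Lemma free_product_separable : separable F.
Proof.
have [sj0 sj1 univ] := FP; have [_ gen _] := T2P.
pose g n := nth 0 [:: j0 s1; j0 s2; j1 s1; j1 s2] n.
exists (range (star_poly g)); first exact: star_poly_countable.
apply: dense_closure; have cS := star_poly_closure g.
have [clS S1 SL SM SS] := cS.
have jS (j : {lrmorphism T2 -> F}) : star_hom j -> closure (range (star_poly g)) (j s1) ->
    closure (range (star_poly g)) (j s2) -> forall t, closure (range (star_poly g)) (j t).
  move=> sj h1 h2 t; have := gen [set t | closure (range (star_poly g)) (j t)].
  move=> h; rewrite -[closure _ _]/([set t | closure (range (star_poly g)) (j t)] t).
  rewrite h//; last by move=> _ [->|->].
  split=> /=.
  - by apply: preimage_closed => // x _; exact: star_hom_continuous.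
  - by rewrite rmorph1.
  - by move=> c a b ha hb; rewrite linearP; exact: SL.
  - by move=> a b ha hb; rewrite rmorphM; exact: SM.
  - by move=> a ha; rewrite sj; exact: SS.
apply: free_product_generated => //; apply: jS => //.
- by rewrite (_ : j0 s1 = g 0%N)//; exact: star_poly_gen.
- by rewrite (_ : j0 s2 = g 1%N)//; exact: star_poly_gen.
- by rewrite (_ : j1 s1 = g 2%N)//; exact: star_poly_gen.
- by rewrite (_ : j1 s2 = g 3%N)//; exact: star_poly_gen.
Qed.

End FreeProductSeparable.

(** * The mapping torus of Ad v *)

Section MappingTorus.
Variables (R : realType) (F : cstarAlgType R) (v : F).
Hypothesis uv : unitary v.
Local Notation X := (interval_space R).

(* Sections over the circle R/Z of the bundle with fibre F and monodromy Ad v. *)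
Definition twisted (f : R -> F) := clamped f /\ f 0 = v * f 1 * star v.

Let vv1 : star v * v = 1. Proof. by case: uv. Qed.
Let vv2 : v * star v = 1. Proof. by case: uv. Qed.

Lemma twisted1 : twisted (fun=> 1).
Proof.
split; last by rewrite mulr1 vv2.
by split=> //; exact: cst_continuous.
Qed.

Lemma continuous_scalec (T : topologicalType) (c : R[i]) (f : T -> F) :
  continuous f -> continuous (fun t => c *: f t).
Proof.
move=> cf; have -> : (fun t => c *: f t) = (fun t => (c *: 1) * f t).
  by apply/funext => t; rewrite -scalerAl mul1r.
by apply: continuous_mul => //; exact: cst_continuous.
Qed.

Lemma twistedL (c : R[i]) f g : twisted f -> twisted g -> twisted (fun t => c *: f t + g t).
Proof.
move=> [[cf f0 f1] ff] [[cg g0 g1] gg]; split.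
  split=> [|t t0|t t1]; first by apply: continuous_add => //; exact: continuous_scalec.
    by rewrite f0// g0.
  by rewrite f1// g1.
by rewrite {1}ff {1}gg mulrDr mulrDl -scalerAr -scalerAl.
Qed.

Lemma twistedM f g : twisted f -> twisted g -> twisted (fun t => f t * g t).
Proof.
move=> [[cf f0 f1] ff] [[cg g0 g1] gg]; split.
  split=> [|t t0|t t1]; first exact: continuous_mul.
    by rewrite f0// g0.
  by rewrite f1// g1.
by rewrite {1}ff {1}gg; nc vv1.
Qed.

Lemma twisted_star f : twisted f -> twisted (fun t => star (f t)).
Proof.
move=> [[cf f0 f1] ff]; split.
  split=> [|t t0|t t1]; first exact: continuous_star.
    by rewrite f0.
  by rewrite f1.
by rewrite {1}ff !starM starK mulrA.
Qed.

Lemma twisted_closed f : (forall e : R, 0 < e ->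
  exists2 g, twisted g & forall t, nrm (g t - f t) <= e) -> twisted f.
Proof.
move=> h; have eq t s : (forall g, twisted g -> g t = g s) -> f t = f s.
  move=> gts; apply/eqP; rewrite -subr_eq0; apply/eqP/nrm_small_eq0 => e e0.
  have [|g tg gf] := h (e / 2); first by rewrite divr_gt0.
  have e1 := nrm_dist (f t) (g t) (f s); have e2 : nrm (g t - f s) <= e / 2 by rewrite (gts g tg) gf.
  move: e1; rewrite (nrmBC (f t) (g t)).
  have := gf t; lra.
split.
  split=> [x|t t0|t t1]; last 2 first.
  - by apply: eq => g [[_ g0 _] _]; exact: g0.
  - by apply: eq => g [[_ _ g1] _]; exact: g1.
  apply/continuous_nrmP => e e0.
  have e30 : 0 < e / 3 by rewrite divr_gt0.
  have [g [[cg _ _] _] gf] := h _ e30.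
  apply: filterS ((continuous_nrmP _ _).1 (cg x) _ e30) => y gyx.
  have := nrm_dist (f y) (g y) (f x); have := nrm_dist (g y) (g x) (f x).
  have := gf x; have := gf y; rewrite (nrmBC (f y) (g y)); lra.
apply/eqP; rewrite -subr_eq0; apply/eqP/nrm_small_eq0 => e e0.
have [|g [_ gg] gf] := h (e / 2); first by rewrite divr_gt0.
have -> : f 0 - v * f 1 * star v = v * (g 1 - f 1) * star v - (g 0 - f 0).
  by rewrite gg; nc.
apply: le_trans (nrmB _ _) _.
have nv := nrm_unitary uv; have nv' := nrm_unitary (unitary_star uv).
have := nrmM (v * (g 1 - f 1)) (star v); have := nrmM v (g 1 - f 1).
rewrite nv nv' mul1r mulr1; have := gf 0; have := gf 1; lra.
Qed.

Definition torus_subalgebra := @FamilySubalgebra R R (fun=> F) twisted 0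
  twisted1 twistedL twistedM twisted_star twisted_closed.

Definition torus := family_algebra torus_subalgebra.

Definition mk_torus f (tf : twisted f) : torus :=
  @Family _ _ _ torus_subalgebra f tf (clamped_bounded tf.1).

Lemma torusP (f g : torus) : (forall t, f t = g t) -> f = g.
Proof. exact: (@bfamilyP _ _ _ torus_subalgebra). Qed.

Lemma torus_twisted (f : torus) : twisted f. Proof. exact: (@fam_funP _ _ _ torus_subalgebra f). Qed.

Lemma torus_continuous (f : torus) : continuous f.
Proof. by have [[]] := torus_twisted f. Qed.

Lemma scalar_twisted (h : R -> R[i]^o) : continuous h ->
  (forall t, t <= 0 -> h t = h 0) -> (forall t, 1 <= t -> h t = h 1) -> h 0 = h 1 ->
  twisted (fun t => h t *: 1).
Proof.
move=> ch h0 h1 h01; split; last first.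
  by rewrite h01 -scalerAr -scalerAl mulr1 vv2.
split=> [|t /h0->//|t /h1->//] x; apply/continuous_nrmP => e e0.
apply: filterS ((continuous_nrmP _ _).1 (ch x) _ e0) => y.
by rewrite -scalerBl nrmZ nrm1 mulr1.
Qed.

(* The circle is folded onto [0, 1] along t ~ 1 - t, by t |-> |2 t - 1|. *)
Definition fold_pt (b : bool) (x : R) : R := if b then (1 + x) / 2 else (1 - x) / 2.
Definition fold_map (t : R) : X := to_interval `|t + t - 1|.

Lemma fold_map_continuous : continuous fold_map.
Proof.
move=> t; apply: continuous_comp; last exact: to_interval_continuous.
apply: continuous_comp; last exact: norm_continuous.
by apply: cvgB; [apply: cvgD; exact: cvg_id | exact: cvg_cst].
Qed.

Lemma fold_map_pt b (x : X) : fold_map (fold_pt b (icoord x)) = x.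
Proof.
have /andP[x0 x1] := icoordP x.
rewrite /fold_map -[RHS]to_interval_coord; congr to_interval.
case: b; rewrite /fold_pt.
  by rewrite (_ : _ + _ - 1 = icoord x) ?ger0_norm//; field.
by rewrite (_ : _ + _ - 1 = - icoord x) ?normrN ?ger0_norm//; field.
Qed.

Lemma fold_map_end t : 1 <= `|t + t - 1| -> fold_map t = to_interval 1.
Proof.
move=> h; apply: icoord_inj; rewrite !icoord_to_interval clamp_ge1//.
by rewrite clamp_id// ler01 lexx.
Qed.

Lemma fold_map_clamp t : fold_map t = fold_map (clamp t).
Proof.
have [t0|t0] := lerP t 0.
  by rewrite clamp_le0// !fold_map_end ?ler0_norm//; lra.
have [t1|t1] := lerP 1 t.
  by rewrite clamp_ge1// !fold_map_end ?ger0_norm//; lra.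
by rewrite clamp_id// (ltW t0) (ltW t1).
Qed.

Fact theta_twisted (h : continuousType X R[i]^o) :
  twisted (fun t => (h (fold_map t) : R[i]) *: 1).
Proof.
have e0 t : t <= 0 -> fold_map t = to_interval 1.
  by move=> t0; apply: fold_map_end; rewrite ler0_norm; lra.
have e1 t : 1 <= t -> fold_map t = to_interval 1.
  by move=> t0; apply: fold_map_end; rewrite ger0_norm; lra.
apply: (@scalar_twisted (fun t => h (fold_map t))).
- by move=> t; apply: continuous_comp; [exact: fold_map_continuous | exact: cts_fun].
- by move=> t t0; rewrite !e0.
- by move=> t t1; rewrite !e1.
- by rewrite e0// e1.
Qed.

Definition torus_theta h : torus := mk_torus (theta_twisted h).

Lemma torus_CX_algebra : CX_algebra torus_theta.
Proof.
split=> [c f g h hE|f g h hE|e eE|f h hE|f a]; apply: torusP => t.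
- by rewrite fam_addE fam_scaleE /= hE scalerDl scalerA.
- by rewrite fam_mulE /= hE -scalerAl mul1r scalerA.
- by rewrite /= eE scale1r.
- by rewrite fam_starE /= hE starZ star1.
- by rewrite !fam_mulE /= -scalerAl -scalerAr mul1r mulr1.
Qed.

Section Fibre.
Variable x : X.

(** The points over x are (1 + x) / 2 and (1 - x) / 2. They coincide at x = 0; at x = 1 they are 1
    and 0, which the monodromy identifies; in between the fibre is F x F. *)
Definition fibre_mem (g : bool -> F) :=
  (icoord x = 0 -> g true = g false) /\ (icoord x = 1 -> g false = v * g true * star v).

Fact fibre_mem1 : fibre_mem (fun=> 1).
Proof. by split=> // _; rewrite mulr1 vv2. Qed.
Fact fibre_memL (c : R[i]) f g : fibre_mem f -> fibre_mem g ->
  fibre_mem (fun i => c *: f i + g i).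
Proof.
move=> [f0 f1] [g0 g1]; split=> [h|h]; first by rewrite f0// g0.
by rewrite f1// g1// mulrDr mulrDl -scalerAr -scalerAl.
Qed.
Fact fibre_memM f g : fibre_mem f -> fibre_mem g -> fibre_mem (fun i => f i * g i).
Proof.
move=> [f0 f1] [g0 g1]; split=> [h|h]; first by rewrite f0// g0.
by rewrite f1// g1//; nc vv1.
Qed.
Fact fibre_mem_star f : fibre_mem f -> fibre_mem (fun i => star (f i)).
Proof.
move=> [f0 f1]; split=> [h|h]; first by rewrite f0.
by rewrite f1// !starM starK mulrA.
Qed.
Fact fibre_mem_closed f : (forall e : R, 0 < e ->
  exists2 g, fibre_mem g & forall i, nrm (g i - f i) <= e) -> fibre_mem f.
Proof.
move=> h; split=> hx; apply/eqP; rewrite -subr_eq0; apply/eqP/nrm_small_eq0 => e e0.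
  have [|g [g0 _] gf] := h (e / 2); first by rewrite divr_gt0.
  have e2 : nrm (g true - f false) <= e / 2 by rewrite (g0 hx) gf.
  have := nrm_dist (f true) (g true) (f false); rewrite (nrmBC (f true) (g true)).
  have := gf true; lra.
have [|g [_ gg] gf] := h (e / 2); first by rewrite divr_gt0.
have -> : f false - v * f true * star v =
    v * (g true - f true) * star v - (g false - f false).
  by rewrite (gg hx); nc.
apply: le_trans (nrmB _ _) _.
have nv := nrm_unitary uv; have nv' := nrm_unitary (unitary_star uv).
have := nrmM (v * (g true - f true)) (star v); have := nrmM v (g true - f true).
rewrite nv nv' mul1r mulr1; have := gf true; have := gf false; lra.
Qed.

Definition torus_fibre := family_algebra (@FamilySubalgebra R bool (fun=> F) fibre_mem
  true fibre_mem1 fibre_memL fibre_memM fibre_mem_star fibre_mem_closed).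

Lemma torus_fibreP (g h : torus_fibre) : (forall b, g b = h b) -> g = h.
Proof. exact: bfamilyP. Qed.

Lemma bool_bounded (g : bool -> F) : bounded_family g.
Proof.
exists (nrm (g true) + nrm (g false)) => -[]; rewrite ?lerDl ?lerDr nrm_ge0 //.
Qed.

Definition mk_fibre (g : bool -> F) (hg : fibre_mem g) : torus_fibre :=
  @Family _ _ _ (@FamilySubalgebra R bool (fun=> F) fibre_mem
  true fibre_mem1 fibre_memL fibre_memM fibre_mem_star fibre_mem_closed) g hg (bool_bounded g).

Fact torus_fibre_mem (f : torus) : fibre_mem (fun b => f (fold_pt b (icoord x))).
Proof.
have [[_ f0 f1] ff] := torus_twisted f; split=> ->; rewrite /fold_pt.
  by rewrite addr0 subr0.
by rewrite subrr mul0r ff; congr (_ * f _ * _); field.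
Qed.

Definition torus_eval : {lrmorphism torus -> torus_fibre} :=
  @to_family R bool (fun=> F) torus (@FamilySubalgebra R bool (fun=> F) fibre_mem
  true fibre_mem1 fibre_memL fibre_memM fibre_mem_star fibre_mem_closed)
  (fun b => @fam_eval R R (fun=> F) torus_subalgebra (fold_pt b (icoord x)))
  torus_fibre_mem (fun f => bool_bounded _).

Lemma torus_evalE f b : torus_eval f b = f (fold_pt b (icoord x)).
Proof. by []. Qed.

Lemma torus_eval_star : star_hom torus_eval.
Proof. exact: to_family_star. Qed.

Lemma nrm_torus_eval f :
  nrm (torus_eval f) = Num.max (nrm (f (fold_pt true (icoord x))))
                               (nrm (f (fold_pt false (icoord x)))).
Proof.
apply/le_anti/andP; split.
  by apply: nrm_fam_le => -[]; rewrite torus_evalE le_max lexx ?orbT.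
rewrite ge_max; apply/andP; split.
  exact: (le_nrm_fam (torus_eval f) true).
exact: (le_nrm_fam (torus_eval f) false).
Qed.

(** For x = 1 the two points are the ends of [0, 1], and linear interpolation satisfies the twist.
    Otherwise the section is made to vanish at both ends, where the twist is then trivial. *)
Lemma torus_eval_surj (g : torus_fibre) : exists f, torus_eval f = g.
Proof.
have [g0 g1] : fibre_mem g := fam_funP g; have /andP[x0 x1] := icoordP x.
suff [f tf fE] : exists2 f, twisted f & forall b, f (fold_pt b (icoord x)) = g b.
  by exists (mk_torus tf); apply: torus_fibreP => b; rewrite torus_evalE; exact: fE.
have cc := @clamp_continuous R.
have cs (h : R -> R) (a : F) : continuous h -> continuous (fun t => h (clamp t) *c: a).
  move=> ch; apply: continuous_scale; last exact: cst_continuous.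
  by move=> t; apply: continuous_comp; [exact: cc | exact: ch].
have c0 : clamp 0 = 0 :> R by rewrite clamp_le0.
have c1 : clamp 1 = 1 :> R by rewrite clamp_ge1.
have cl (k : R -> F) : continuous k -> clamped (fun t => k (clamp t)).
  move=> ck; split=> [t|t t0|t t1]; last 2 first.
  - by rewrite clamp_le0// c0.
  - by rewrite clamp_ge1// c1.
  by apply: continuous_comp; [exact: cc | exact: ck].
have cp (h : R -> R) (a : F) : continuous h -> continuous (fun t => h t *c: a).
  by move=> ch; apply: continuous_scale => //; exact: cst_continuous.
have cid : continuous (id : R -> R) by move=> t; exact: cvg_id.
have c1m : continuous (fun t : R => 1 - t) by apply: continuousB_real => //; exact: cst_continuous.
have cf b : clamp (fold_pt b (icoord x)) = fold_pt b (icoord x).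
  by rewrite clamp_id//; case: b; rewrite /fold_pt; apply/andP; split; lra.
have [xe1|xn1] := eqVneq (icoord x) 1.
  pose k (t : R) := t *c: g true + (1 - t) *c: g false.
  exists (fun t => k (clamp t)).
    split; last by rewrite c0 c1 /k subr0 subrr !scale1c !scale0r add0r addr0 g1.
    by apply: cl; apply: continuous_add; exact: cp.
  move=> b; rewrite cf /k /fold_pt xe1; case: b.
    by rewrite (_ : (1 + 1) / 2 = 1 :> R) ?subrr ?scale1c ?scale0r ?addr0//; field.
  by rewrite subrr mul0r subr0 scale1c scale0r add0r.
(* At both points over x it equals 1 - x^2, by which [k] divides. *)
pose b0 (t : R) : R := 4 * t * (1 - t).
have cb0 : continuous b0.
  apply: continuousM_real => //; apply: continuousM_real => //; exact: cst_continuous.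
have x2 : 1 - icoord x ^+ 2 != 0.
  rewrite subr_eq0 eq_sym sqrf_eq1 negb_or xn1 /=; apply/eqP => h; move: x0; rewrite h; lra.
(* Lagrange weights for the two points; at x = 0 these coincide and each takes weight 1/2. *)
pose w (b : bool) (t : R) : R := if icoord x == 0 then 2^-1 else
   (if b then icoord x + (t + t - 1) else icoord x - (t + t - 1)) / (2 * icoord x).
have cw b : continuous (w b).
  rewrite /w; case: (icoord x == 0); first exact: cst_continuous.
  apply: continuousM_real; last exact: cst_continuous.
  have ct : continuous (fun t : R => t + t - 1).
    by apply: continuousB_real; [exact: continuousD_real | exact: cst_continuous].
  by case: b; [apply: continuousD_real | apply: continuousB_real] => //; exact: cst_continuous.
pose k (t : R) := (b0 t / (1 - icoord x ^+ 2)) *c: (w true t *c: g true + w false t *c: g false).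
exists (fun t => k (clamp t)).
  split; last first.
    rewrite c0 c1 /k /b0 subrr !(mulr0, mul0r) !scale0r; nc.
  apply: cl; apply: continuous_scale.
    by apply: continuousM_real => //; exact: cst_continuous.
  by apply: continuous_add; apply: cp; exact: cw.
have b0E b : b0 (fold_pt b (icoord x)) = 1 - icoord x ^+ 2.
  by rewrite /b0 /fold_pt; case: b; field.
move=> b; rewrite cf /k b0E mulfV// scale1c.
have [xe0|xn0] := eqVneq (icoord x) 0.
  rewrite /w xe0 eqxx -scalerDr -(half2 (g b)); congr (_ *: _).
  by rewrite -(g0 xe0); case: b; rewrite ?(g0 xe0).
rewrite /w (negPf xn0); case: b; rewrite /fold_pt.
  rewrite (_ : _ / _ = 1 :> R); last by field.
  rewrite (_ : (icoord x - _) / _ = 0 :> R); last by field.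
  by rewrite scale1c scale0r addr0.
rewrite (_ : (icoord x + _) / _ = 0 :> R); last by field.
rewrite (_ : (icoord x - _) / _ = 1 :> R); last by field.
by rewrite scale1c scale0r add0r.
Qed.

Lemma torus_eval_ker f : torus_eval f = 0 <-> fibre_ideal torus_theta x f.
Proof.
split=> [f0|/closure_nrmP hf]; last first.
  apply/eqP; rewrite -nrm_eq0; apply/eqP/le_anti; rewrite nrm_ge0 andbT.
  apply/ler_addgt0Pl => e e0; rewrite addr0; have [b [n [c [w [hw bE]]]] bf] := hf e e0.
  have b0 : torus_eval b = 0.
    rewrite bE rmorph_sum big1// => i _; have [h [a [hx ->]]] := hw i.
    apply: (eq_trans (hom_scale torus_eval _ _)).
    suff -> : torus_eval (torus_theta h * a) = 0 by rewrite scaler0.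
    by apply: torus_fibreP => b'; rewrite torus_evalE fam_mulE /= fold_map_pt hx scale0r mul0r.
  have := star_hom_contractive torus_eval_star (b - f).
  by rewrite hom_sub b0 sub0r nrmN; lra.
have fz b : f (fold_pt b (icoord x)) = 0 by rewrite -torus_evalE f0.
apply/closure_nrmP => e e0; have e20 : 0 < e / 2 by rewrite divr_gt0.
have [d d0 hd] : exists2 d : R, 0 < d &
    forall b t, `|t - fold_pt b (icoord x)| < d -> nrm (f t) < e / 2.
  have hb b := (continuous_nrmP f _).1 (@torus_continuous f (fold_pt b (icoord x))) _ e20.
  have /nbhs_ballP[d1 /= d10 h1] := hb true; have /nbhs_ballP[d2 /= d20 h2] := hb false.
  exists (Num.min d1 d2); first by rewrite lt_min d10.
  move=> b t; rewrite lt_min => /andP[t1 t2].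
  rewrite -[f t]subr0 -(fz b); case: b t1 t2 => t1 t2.
    by apply: h1; rewrite /ball /= distrC.
  by apply: h2; rewrite /ball /= distrC.
(* The cut-off vanishes at x and is 1 from distance d on, so its product with f differs from f only
   near the points over x, where f is small. *)
pose h (y : X) : R := clamp (`|icoord y - icoord x| / d).
have ch : continuous h.
  have c0 : continuous (fun y : X => `|icoord y - icoord x| / d).
    apply: continuousM_real; last exact: cst_continuous.
    have c1 : continuous (fun y : X => icoord y - icoord x).
      by apply: continuousB_real; [exact: icoord_continuous | exact: cst_continuous].
    by move=> y; exact: (continuous_comp (c1 y) (@norm_continuous R R _)).
  by move=> y; exact: continuous_comp (c0 y) (@clamp_continuous R _).
pose H : continuousType X R[i]^o := mkcts (continuous_realC ch).
exists (torus_theta H * f).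
  exists 1%N, (fun=> 1), (fun=> torus_theta H * f); split; last by rewrite big_ord1 scale1r.
  move=> _; exists H, f; split=> //.
  by rewrite /H /= /mkcts /h subrr normr0 mul0r clamp_le0.
apply: le_lt_trans (_ : e / 2 < e); last by lra.
apply: nrm_fam_le => t.
have tE : (torus_theta H * f - f) t = (h (fold_map t) - 1) *c: f t.
  rewrite fam_addE fam_oppE fam_mulE /= -scalerAl mul1r.
  by rewrite rmorphB scalerBl scale1c.
rewrite tE nrmZr.
have /andP[h0 h1] := clampP (`|icoord (fold_map t) - icoord x| / d).
rewrite -/(h (fold_map t)) in h0 h1.
suff [hE|ft] : h (fold_map t) = 1 \/ nrm (f t) <= e / 2.
- by rewrite hE subrr normr0 mul0r ltW.
- by apply: le_trans (ler_piMl (nrm_ge0 _) _) ft; rewrite ler0_norm; lra.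
have [xd|xd] := lerP d `|icoord (fold_map t) - icoord x|.
  by left; rewrite /h clamp_ge1// ler_pdivlMr// mul1r.
right; have ct := clamped_clamp t (torus_twisted f).1; rewrite ct.
rewrite fold_map_clamp in xd.
have /andP[t0 t1] := clampP t; set s := clamp t in t0 t1 xd *.
move: xd; rewrite icoord_to_interval clamp_id; last first.
  by rewrite normr_ge0 /= ler_norml; lra.
(* The sign of 2 s - 1 tells which of the two points over x is close to s. *)
have [s2|s2] := lerP 0 (s + s - 1).
  by rewrite (ger0_norm s2) => xd; apply/ltW/(hd true); rewrite /fold_pt; move: xd; rewrite !ltr_norml; lra.
by rewrite (ltr0_norm s2) => xd; apply/ltW/(hd false); rewrite /fold_pt; move: xd; rewrite !ltr_norml; lra.
Qed.

End Fibre.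
End MappingTorus.

(** * Separability and proper infiniteness of the mapping torus *)

Section Separability.
Variables (R : realType).

(** One element is picked in each nonempty [P k]. The approximants by which such sets are described
    need not belong to A. *)
Lemma separable_countable_cover (A : cstarAlgType R) (K : countType) (P : K -> A -> Prop) :
  (forall a (e : R), 0 < e -> exists k, P k a /\ forall b, P k b -> nrm (b - a) < e) ->
  separable A.
Proof.
move=> hP; pose pick k := if pselect (exists b, P k b) is left h then projT1 (cid h) else 0.
exists (range pick).
  by apply: (sub_countable (card_image_le _ _)); exact: countableP.
apply: dense_closure; apply/seteqP; split=> // a _; apply/closure_nrmP => e e0.
have [k [ka kb]] := hP a e e0; exists (pick k); first by exists k.
apply: kb; rewrite /pick; case: pselect => [h|[]]; first exact: (projT2 (cid h)).
by exists a.
Qed.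

Lemma separable_seq (A : cstarAlgType R) : separable A ->
  exists d : nat -> A, forall a (e : R), 0 < e -> exists n, nrm (d n - a) < e.
Proof.
move=> [D /countable_injP[f fI] dD].
pose d n := if pselect (exists2 a, D a & f a = n) is left h then projT1 (cid2 h) else 0.
exists d => a e e0.
have : closure D a.
  move=> B; rewrite nbhsE => -[U [oU Ua] UB].
  have [|b [Ub Db]] := dD U _ oU; first by exists a.
  by exists b; split=> //; exact: UB.
move=> /closure_nrmP/(_ e e0)[b Db ba]; exists (f b); rewrite /d; case: pselect; last first.
  by case; exists b.
by move=> h; case: (cid2 h) => c Dc /= cb; rewrite (fI c b) ?inE.
Qed.

End Separability.

Section Torus.
Variables (R : realType) (F : cstarAlgType R) (v : F).
Hypothesis uv : unitary v.
Local Notation torus := (torus uv).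

Lemma torus_separable : separable F -> separable torus.
Proof.
move=> /separable_seq[d dP].
(* For k = (m, N, l): f stays within 1 / (m + 1) of the step function whose steps have length 1 / (N
   + 1) and whose values are the [d n] with n listed in l. *)
pose P (k : nat * nat * seq nat) (f : torus) := forall t : R, 0 <= t <= 1 ->
  nrm (f t - d (nth 0%N k.2 (Num.truncn (t * k.1.2.+1%:R)))) <= k.1.1.+1%:R^-1.
apply: (@separable_countable_cover _ _ _ P) => f e e0.
have e40 : 0 < e / 4 by rewrite divr_gt0.
have [m me] : exists m : nat, m.+1%:R^-1 < e / 4.
  exists (Num.truncn (e / 4)^-1); rewrite invf_plt ?posrE ?ltr0Sn//.
  by rewrite truncnS_gt.
have m0 : 0 < m.+1%:R^-1 :> R by rewrite invr_gt0 ltr0Sn.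
have m20 : 0 < m.+1%:R^-1 / 2 :> R by rewrite divr_gt0.
have [c c0 hc] : exists2 c : R, 0 < c & forall t t' : R, 0 <= t <= 1 -> `|t' - t| < c ->
  nrm (f t' - f t) <= m.+1%:R^-1 / 2 := clamped_uniform (torus_twisted f).1 m20.
have [N Nc] : exists N : nat, N.+1%:R^-1 < c.
  exists (Num.truncn c^-1); rewrite invf_plt ?posrE ?ltr0Sn//.
  by rewrite truncnS_gt.
have N0 : 0 < N.+1%:R :> R by rewrite ltr0Sn.
have dx a : {n | nrm (d n - a) < m.+1%:R^-1 / 2} by apply: cid; exact: dP.
(* The indices run up to N + 1, which is the step of t = 1. *)
pose l := [seq projT1 (dx (f (k%:R / N.+1%:R))) | k <- iota 0 N.+2].
have fP : P (m, N, l) f.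
  move=> t /andP[t0 t1] /=.
  have tN0 : 0 <= t * N.+1%:R by rewrite mulr_ge0// ltW.
  have /andP[k1 k2] := truncn_itv tN0; set k := Num.truncn _ in k1 k2 *.
  have kN : (k < N.+2)%N.
    rewrite -(ltr_nat R); apply: le_lt_trans k1 _.
    by apply: le_lt_trans (_ : N.+1%:R < _); rewrite ?ltr_nat// ler_piMl// ltW.
  rewrite (nth_map 0%N) ?size_iota// nth_iota// add0n.
  set a := f (_ / _); have := projT2 (dx a); set n := projT1 (dx a) => /= na.
  apply: le_trans (nrm_dist _ a _) _; rewrite (nrmBC a) [leRHS]splitr.
  apply: lerD; last exact: ltW.
  rewrite nrmBC; apply: hc; first by rewrite t0.
  apply: le_lt_trans Nc; rewrite ler0_norm.
    by rewrite opprB lerBlDr -[X in X + _]mul1r -mulrDl -(natrD _ 1) add1n ler_pdivlMr// ltW.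
  by rewrite subr_le0 ler_pdivrMr.
exists (m, N, l); split=> // g gP.
apply: le_lt_trans (_ : e / 2 < e); last by lra.
apply: nrm_fam_le => t; rewrite fam_addE fam_oppE.
rewrite (clamped_clamp t (torus_twisted g).1) (clamped_clamp t (torus_twisted f).1).
have := gP _ (clampP t); set a := d _; have := fP _ (clampP t); rewrite -/a.
move: (clamp t) => t'; rewrite /= => h1 h2.
apply: le_trans (nrm_dist _ a _) _; rewrite (nrmBC a); apply: le_trans (lerD h2 h1) _.
by apply: le_trans (lerD (ltW me) (ltW me)) _; lra.
Qed.

Lemma torus_fibre_properly_infinite (x : interval_space R) :
  properly_infinite F -> properly_infinite (torus_fibre uv x).
Proof.
move=> /properly_infiniteP[s [t [is_ it st]]]; apply/properly_infiniteP.
have [vv vv'] := uv.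
(* The twist at x = 1 forces v a v^* in the second coordinate; elsewhere the constant pair will
   do. *)
pose g (a : F) (b : bool) := if b then a else if icoord x == 1 then v * a * star v else a.
have gP a : fibre_mem v x (g a).
  rewrite /fibre_mem /g; split=> ->; last by rewrite eqxx.
  by rewrite eq_sym oner_eq0.
exists (mk_fibre uv (gP s)), (mk_fibre uv (gP t)); split; apply: torus_fibreP => b;
  rewrite fam_mulE fam_starE /= /g; case: b => //; case: ifP => // _.
- by rewrite !starM starK; nc vv' vv is_.
- by rewrite !starM starK; nc vv' vv it.
- by rewrite !starM starK; nc vv' vv st.
Qed.

Lemma continuous_nrm_torus_eval (f : torus) :
  continuous (fun x : interval_space R => `|torus_eval uv x f| : R[i]^o).
Proof.
have -> : (fun x => `|torus_eval uv x f| : R[i]^o) =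
  (fun x => (nrm (torus_eval uv x f))%:C%C : R[i]^o) by apply/funext => x; rewrite nrmE.
apply: continuous_realC.
have -> : (fun x => nrm (torus_eval uv x f)) = (fun x => Num.max
    (nrm (f (fold_pt true (icoord x)))) (nrm (f (fold_pt false (icoord x))))).
  by apply/funext => x; rewrite nrm_torus_eval.
have cn b : continuous (fun x : interval_space R => nrm (f (fold_pt b (icoord x)))).
  have cf : continuous (fun x : interval_space R => fold_pt b (icoord x)).
    have ci := @icoord_continuous R.
    by case: b; rewrite /fold_pt; apply: continuousM_real;
      try exact: cst_continuous; [apply: continuousD_real | apply: continuousB_real];
      try exact: cst_continuous.
  move=> x; have cfx := continuous_comp (cf x) (@torus_continuous _ _ _ uv f _).
  exact: (continuous_comp cfx (@nrm_continuous R F _)).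
exact: continuous_max_real.
Qed.

Lemma torus_properly_infinite : separable F -> properly_infinite F ->
  properly_infinite_fibres_property R -> properly_infinite torus.
Proof.
move=> sF pF; apply.
- exact: interval_space_compact.
- exact: interval_space_hausdorff.
- exact: interval_space_second_countable.
- exact: torus_CX_algebra.
- exact: torus_separable.
- move=> x; split; [exact: torus_eval_star | exact: torus_eval_surj | exact: torus_eval_ker].
- exact: continuous_nrm_torus_eval.
- by move=> x; exact: torus_fibre_properly_infinite.
Qed.

End Torus.

(** * K_1-injectivity *)

Section Corner.
Variables (R : realType) (F : cstarAlgType R) (n : nat) (d : 'I_n -> F).
Hypothesis dd : forall i j, star (d i) * d j = (i == j)%:R.
Implicit Types m : 'M[F]_n.

(** The sum of the d_i m_ij d_j^*: a star-homomorphism from M_n(F) to F, taking the unit to a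
    projection, through which homotopies of matrices become homotopies in F. *)
Definition corner m : F := ((\row_j d j) *m m *m (\col_j star (d j))) 0 0.

Lemma corner_mul m m' : corner m * corner m' = corner (m *m m').
Proof.
pose r := \row_j d j; pose c := \col_j star (d j).
have cr : c *m r = 1%:M.
  by apply/matrixP => i j; rewrite !mxE big_ord1 !mxE dd.
transitivity (((r *m m *m c) *m (r *m m' *m c)) 0 0).
  by rewrite [RHS]mxE big_ord1.
congr (_ 0 0); transitivity (r *m m *m (c *m r) *m m' *m c); first by rewrite !mulmxA.
by rewrite cr mulmx1 !mulmxA.
Qed.

Lemma corner_star m : star (corner m) = corner (mxstar m).
Proof.
rewrite /corner !mxE star_sum.
under eq_bigr => i _.
  rewrite !mxE starM starK star_sum mulr_sumr.
  under eq_bigr => j _ do rewrite !mxE starM mulrA.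
  over.
rewrite exchange_big; apply: eq_bigr => j _ /=; rewrite !mxE mulr_suml.
by apply: eq_bigr => i _; rewrite !mxE.
Qed.

Lemma corner_unitary m : unitary_mx m -> unitary (corner m + 1 - corner 1%:M).
Proof.
move=> [m1 m2]; set c := corner m; set e := corner 1%:M.
have sc : star c * c = e by rewrite corner_star corner_mul m1.
have cs : c * star c = e by rewrite corner_star corner_mul m2.
have ce : c * e = c by rewrite corner_mul mulmx1.
have ec : e * c = c by rewrite corner_mul mul1mx.
have ee : e * e = e by rewrite corner_mul mulmx1.
have se : star e = e by rewrite -[in LHS]sc starM starK sc.
have sce : star c * e = star c by rewrite -{1}se -starM ec.
have esc : e * star c = star c by rewrite -{1}se -starM ce.
rewrite /unitary /mkset starB starD star1 se; split.
  transitivity (star c * c + star c - star c * e + c + 1 - e - e * c - e + e * e).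
    by nc.
  by rewrite sc sce ec ee; nc.
transitivity (c * star c + c - c * e + star c + 1 - e - e * star c - e + e * e).
  by nc.
by rewrite cs ce esc ee; nc.
Qed.

Lemma continuous_corner (T : topologicalType) (g : T -> 'M[F]_n) :
  continuous g -> continuous (fun t => corner (g t)).
Proof.
move=> cg; have cc p q (x : 'M[F]_(p, q)) : continuous (fun _ : T => x) by exact: cst_continuous.
have := continuous_mulmx (continuous_mulmx (cc _ _ (\row_j d j)) cg) (cc _ _ (\col_j star (d j))).
by move=> /continuous_mxP; exact.
Qed.

End Corner.

Section Telescope.
Variables (R : realType) (F : cstarAlgType R) (a0 a1 : F).
Hypotheses (i0 : isometry a0) (i1 : isometry a1) (a01 : star a0 * a1 = 0).

(** Two isometries with orthogonal ranges give infinitely many; this is needed because the size of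
    the stabilisation in [K1_trivial] is not bounded in advance. *)
Lemma powers_orthogonal i j : star (a1 ^+ i * a0) * (a1 ^+ j * a0) = (i == j)%:R.
Proof.
have a10 : star a1 * a0 = 0 by rewrite -[LHS]starK starM starK a01 star0.
elim: i j => [|i IH] [|j].
- by rewrite !expr0 !mul1r i0.
- by rewrite expr0 exprS mul1r mulrA (mulrA (star a0)) a01 !mul0r.
- by rewrite expr0 exprS mul1r !starM -!mulrA a10 !mulr0.
- rewrite eqSS -(IH j) !exprS !starM.
  transitivity (star a0 * star (a1 ^+ i) * (star a1 * a1) * a1 ^+ j * a0); first by nc.
  by rewrite i1; nc.
Qed.

(* The unitary d v d^* + 1 - d d^* is homotopic to 1 in F, because the whole
   stabilising homotopy of v fits in F along the isometries a1 ^+ i * a0. *)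
Lemma K1_trivial_path v : K1_trivial v -> exists d (y : R -> F),
  [/\ isometry d, {within `[0, 1], continuous y},
      forall t, t \in `[0, 1] -> unitary (y t),
      y 0 = d * v * star d + 1 - d * star d & y 1 = 1].
Proof.
move=> [k [g [cg gU g0 g1]]].
pose d (i : 'I_(1 + k)) := a1 ^+ i * a0.
have dd i j : star (d i) * d j = (i == j)%:R by rewrite powers_orthogonal.
exists (d (lshift k 0)), (fun t => corner d (g t) + 1 - corner d 1%:M); split.
- by rewrite /isometry dd eqxx.
- apply: continuous_sub; last exact: cst_continuous.
  by apply: continuous_add; [exact: continuous_corner | exact: cst_continuous].
- by move=> t t01; apply: corner_unitary => //; exact: gU.
- pose r := \row_j d j; pose c := \col_j star (d j).
  (* The identity block contributes the same term here and to the corner of the unit matrix, so it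
     cancels. *)
  have cE (x : 'M[F]_1) : corner d (block_mx x 0 0 1%:M) =
      (lsubmx r *m x *m usubmx c) 0 0 + (rsubmx r *m dsubmx c) 0 0.
    rewrite /corner -/r -/c -{1}(hsubmxK r) -{1}(vsubmxK c) mul_row_block mul_row_col.
    by rewrite !mulmx0 mulmx1 addr0 add0r mxE.
  rewrite g0 (scalar_mx_block 1 k 1) !cE !mxE !big_ord1 !mxE !big_ord1 !mxE mulr1n eqxx /= mulr1n.
  by nc.
- by rewrite g1 -(scalar_mx_block 1 k 1) addrAC subrr add0r.
Qed.

End Telescope.

Section Monodromy.
Variables (R : realType) (F : cstarAlgType R).

(* A unitary for every isometry r: the range of d makes room for the defect of r. *)
Definition absorb (d r : F) :=
  (1 - r * star r) * star d + r * d * star r * star d + r * (1 - d * star d).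

Lemma absorb_unitary (d r : F) : isometry d -> isometry r -> unitary (absorb d r).
Proof.
move=> id_ ir; rewrite /absorb; split; rewrite !(starD, starN, starM, starK, star1).
  by nc id_ ir.
by nc id_ ir.
Qed.

(** This identity ties the two paths together: passing from r to v r costs exactly v on the left
    and, on the right, the unitary that [K1_trivial_path] contracts. *)
Lemma absorb_mul (v d r : F) : unitary v -> isometry d -> isometry r ->
  absorb d (v * r) * (d * v * star d + 1 - d * star d) = v * absorb d r.
Proof.
move=> [vv vv'] id_ ir; rewrite /absorb !(starD, starN, starM, starK, star1).
by nc vv vv' id_ ir.
Qed.

(** The product of [absorb d (r t)], [y t] and the adjoint of [absorb d (r 1)] starts at v by
    [absorb_mul] and ends at 1. *)
Lemma homotopic_of_path (v d : F) (r y : R -> F) : unitary v -> isometry d ->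
  (forall t, isometry (r t)) -> continuous r -> r 0 = v * r 1 ->
  {within `[0, 1], continuous y} -> (forall t, t \in `[0, 1] -> unitary (y t)) ->
  y 0 = d * v * star d + 1 - d * star d -> y 1 = 1 ->
  homotopic_in R (@unitary R F) v 1.
Proof.
move=> uv id_ ir cr r01 cy uy y0 y1.
have ua t : unitary (absorb d (r t)) by exact: absorb_unitary.
exists (fun t => absorb d (r t) * y t * star (absorb d (r 1))); split.
- apply: continuous_mul; last exact: cst_continuous.
  apply: continuous_mul => //; apply: continuous_subspaceT.
  rewrite /absorb; repeat (apply: continuous_add || apply: continuous_sub ||
    apply: continuous_oppr ||
    apply: continuous_mul || apply: continuous_star || exact: cr || exact: cst_continuous).
- move=> t t01; apply: unitary_mul; last exact: unitary_star.
  by apply: unitary_mul; [exact: ua | exact: uy].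
- by rewrite y0 r01 absorb_mul// -mulrA; case: (ua 1) => _ ->; rewrite mulr1.
- by rewrite y1 mulr1; case: (ua 1).
Qed.

(* Rotates s into t v at parameter 0 and into t at parameter 1. *)
Definition rotation (v : F) (s t : R -> F) (x : R) :=
  sin (pi * x) *c: s x +
  t x * (Num.max 0 (cos (pi * x)) *c: v + Num.max 0 (- cos (pi * x)) *c: 1).

(** At most one of the coefficients p and q is nonzero, so p v + q has no cross terms, and a^2 + p^2
    + q^2 = 1. *)
Lemma rotation_isometry (v : F) (s t : R -> F) x : unitary v -> isometry (s x) ->
  isometry (t x) -> star (s x) * t x = 0 -> isometry (rotation v s t x).
Proof.
move=> [vv vv'] is_ it st; rewrite /rotation /isometry.
have ts : star (t x) * s x = 0 by rewrite -[LHS]starK starM starK st star0.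
set a := sin _; set p := Num.max _ _; set q := Num.max _ _.
have pq : p * q = 0.
  rewrite /p /q; have [c0|c0] := lerP 0 (cos (pi * x)).
    by rewrite (max_idPl (_ : - _ <= 0)) ?mulr0// oppr_le0.
  by rewrite mul0r.
have apq : a * a + p * p + q * q = 1.
  rewrite -(cos2Dsin2 (pi * x)) -/a /p /q; have [c0|c0] := lerP 0 (cos (pi * x)).
    by rewrite (max_idPl (_ : - _ <= 0)) ?oppr_le0//; ring.
  by rewrite (max_idPr (_ : 0 <= - _)) ?oppr_ge0 ?ltW//; ring.
clearbody a p q.
have mulcc (b c : R) (x1 x2 : F) : (b *c: x1) * (c *c: x2) = (b * c) *c: (x1 * x2).
  by rewrite -scalerAl -scalerAr scalecA.
set w := p *c: v + q *c: 1; set u := a *c: s x.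
have ut : star u * t x = 0 by rewrite /u starZr -scalerAl st scaler0.
have tu : star (t x) * u = 0 by rewrite /u -scalerAr ts scaler0.
have uu : star u * u = (a * a) *c: 1 by rewrite /u starZr mulcc is_.
have ww : star w * w = (p * p + q * q) *c: 1.
  rewrite /w starD !starZr star1 mulrDl !mulrDr !mulcc mulr1 mul1r vv mulr1.
  by rewrite (mulrC q p) pq !scale0r addr0 add0r scalecDl.
transitivity (star u * u + star w * w); first by rewrite starD starM; nc ut tu it.
by rewrite uu ww -scalecDl addrA apq scale1c.
Qed.

Lemma continuous_rotation (v : F) (s t : R -> F) : continuous s -> continuous t ->
  continuous (rotation v s t).
Proof.
have cpi : continuous (fun x : R => pi * x).
  by apply: continuousM_real; [exact: cst_continuous | move=> x; exact: cvg_id].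
have ccos : continuous (fun x : R => cos (pi * x)).
  by move=> x; exact: continuous_comp (cpi x) (@continuous_cos R _).
move=> cs ct; apply: continuous_add.
  by apply: continuous_scale => // x; exact: continuous_comp (cpi x) (@continuous_sin R _).
apply: continuous_mul => //; apply: continuous_add; apply: continuous_scale;
  try exact: cst_continuous; apply: continuous_max_real => //; try exact: cst_continuous.
by move=> x; apply: cvgN; exact: ccos.
Qed.

Lemma torus_K1_injective : separable F -> properly_infinite F ->
  properly_infinite_fibres_property R -> K1_injective F.
Proof.
move=> sF pF hc v uv kv.
have /properly_infiniteP[s [t [is_ it st]]] := torus_properly_infinite uv sF pF hc.
have /properly_infiniteP[a0 [a1 [i0 i1 a01]]] := pF.
have [d [y [id_ cy uy y0 y1]]] := K1_trivial_path i0 i1 a01 kv.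
apply: (@homotopic_of_path v d (rotation v s t) y) => //.
- move=> x; apply: rotation_isometry => //.
  + exact: (congr1 (fun f : torus uv => f x) is_).
  + exact: (congr1 (fun f : torus uv => f x) it).
  + exact: (congr1 (fun f : torus uv => f x) st).
- by apply: continuous_rotation; exact: torus_continuous.
(* The rotation is t 0 v at 0 and t 1 at 1, and t 0 v = v t 1 because t 0 = v t 1 v^*. *)
have [_ t01] := torus_twisted t.
rewrite /rotation mulr0 mulr1 sin0 sinpi cos0 cospi !scale0r !add0r.
rewrite opprK (max_idPl (_ : -1 <= 0)) ?oppr_le0// (max_idPr ler01) !scale0r !scale1c.
by have [vv _] := uv; rewrite addr0 add0r mulr1 t01 -!mulrA vv mulr1.
Qed.

End Monodromy.

Theorem corollary3p3 (R : realType) (T2 : cstarAlgType R) (s1 s2 : T2)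
    (F : cstarAlgType R) (j0 j1 : {lrmorphism T2 -> F}) :
  is_T2 s1 s2 -> is_full_free_product j0 j1 ->
  let admissible (u : F) :=
    [/\ unitary u, K1_trivial u,
        j1 s1 = j1 s1 * star (j0 s1) * j0 s1 &
        j1 s1 * star (j0 s1) * j0 s1 = u * j0 s1] in
  (exists u, admissible u) /\
  forall u, admissible u ->
    [<-> K1_injective F;
         connected_component (@unitary R F) 1 u;
         properly_infinite_fibres_property R].
Proof.
move=> T2P FP admissible; have [rel _ _] := T2P; have [sj0 sj1 _] := FP.
(* The relations give only s1 s1^* + s2 s2^* <= 1; orthogonality of the ranges is derived from
   it. *)
have [is1 is2 _] := rel; have os := isometries_orthogonal rel.
have pushed (j : {lrmorphism T2 -> F}) : star_hom j ->
    [/\ isometry (j s1), isometry (j s2) & star (j s1) * j s2 = 0].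
  move=> sj; split; [exact: star_hom_isometry|exact: star_hom_isometry|].
  by rewrite -sj -rmorphM os raddf0.
have [i1 i2 oi] := pushed j0 sj0; have [k1 k2 ok] := pushed j1 sj1.
have j1E : j1 s1 * star (j0 s1) * j0 s1 = j1 s1 by rewrite -mulrA i1 mulr1.
split=> [|u [uu ku _ ju]].
  have [u [uu ku ju]] := exists_admissible_unitary i1 i2 oi k1 k2 ok.
  by exists u; split; rewrite ?j1E.
rewrite j1E in ju.
tfae=> [inj|cu|hc].
- exact: homotopic_component uu (inj u uu ku).
- move=> X cX hX sX A theta Ax p cxA sA fib cnorm pinf.
  have cpu := connected_component_cayley cu.
  by apply: (glued_properly_infinite T2P FP cpu ju cX hX cxA fib cnorm pinf).
- apply: torus_K1_injective hc; first exact: free_product_separable T2P FP.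
  by apply/properly_infiniteP; exists (j0 s1), (j0 s2).
Qed.
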